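(* Let $\alpha\in(0,1]$, $\beta\in(0,1]$ and $\theta_0\in L^2(\mathbb{R}^2)\cap L^p(\mathbb{R}^2)$ with $p\in[1,2)$. Then any weak solution $\theta$ of $$\partial_t\theta+(u\cdot\nabla)\theta+\Lambda_{x_1}^{2\alpha}\theta+\Lambda_{x_2}^{2\beta}\theta=0,\qquad u=(-\mathcal{R}_2\theta,\mathcal{R}_1\theta),\qquad \theta(x,0)=\theta_0(x),$$ satisfies for all $t\ge0$ $$\|\theta(t)\|_{L^2}\le C_0(1+t)^{-\frac{(\alpha+\beta)(2-p)}{4\alpha\beta p}},$$ where the constant $C_0>0$ depends only on $\alpha,\beta,p$ and $\theta_0$.
   Context: Here $x=(x_1,x_2)\in\mathbb{R}^2$, $t>0$, and $\theta$ is a real scalar. The fractional operators are defined by the Fourier transform: $\widehat{\Lambda_{x_1}^{2\alpha}f}(\xi)=|\xi_1|^{2\alpha}\hat f(\xi)$, $\widehat{\Lambda_{x_2}^{2\beta}f}(\xi)=|\xi_2|^{2\beta}\hat f(\xi)$, $\widehat{\Lambda^{\eta}f}(\xi)=|\xi|^{\eta}\hat f(\xi)$. $\mathcal{R}_j=\partial_{x_j}\Lambda^{-1}$ are the 2D Riesz transforms, so $u=(-\partial_{x_2}\Lambda^{-1}\theta,\ \partial_{x_1}\Lambda^{-1}\theta)$. Convention: when $\alpha=\beta$, the term $\Lambda_{x_1}^{2\alpha}\theta+\Lambda_{x_2}^{2\alpha}\theta$ is understood as $\Lambda^{2\alpha}\theta$. Weak solution: a weakly continuous $\theta:[0,\infty)\to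 L^2(\mathbb{R}^2)$ with $\theta\in L^\infty(0,\infty;L^2)$ and $\Lambda_{x_1}^\alpha\theta,\Lambda_{x_2}^\beta\theta\in L^2(0,\infty;L^2)$, satisfying the equation and initial condition in the sense of distributions; satisfying the energy inequality $\|\theta(t)\|_{L^2}^2+2\int_{t_0}^t(\|\Lambda_{x_1}^\alpha\theta(\tau)\|_{L^2}^2+\|\Lambda_{x_2}^\beta\theta(\tau)\|_{L^2}^2)\,d\tau\le\|\theta(t_0)\|_{L^2}^2$ for $t_0=0$ and almost every $t_0>0$ and all $t\ge t_0$; and satisfying $\|\theta(t)\|_{L^q}\le\|\theta_0\|_{L^q}$ for all $t\geq 0$ and every $q\in[1,\infty]$ with $\theta_0\in L^q$. *)

(* Defs.v *)
From HB Require Import structures.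
From mathcomp Require Import all_boot all_order all_algebra.
From mathcomp Require Import all_classical all_reals all_analysis.
From mathcomp Require Import complex.
Set Implicit Arguments.
Unset Strict Implicit.
Unset Printing Implicit Defensive.
Import Order.TTheory GRing.Theory Num.Theory.
Import numFieldNormedType.Exports.
Local Open Scope classical_set_scope.
Local Open Scope complex_scope.
Local Open Scope ring_scope.

Section Plane.
Context {R : realType}.
Local Notation plane := (R * R)%type.

Local Notation lebesgue1 := (@lebesgue_measure R).
Local Notation lebesgue2 := (lebesgue1 \x lebesgue1)%E.

Definition Lp (q : \bar R) (f : plane -> R) : Prop := f \in Lfun lebesgue2 q.

Definition Lp_norm (q : \bar R) (f : plane -> R) : \bar R :=
  ('N[lebesgue2]_q [EFin \o f])%E.

Definition dot (x y : plane) : R := x.1 * y.1 + x.2 * y.2.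
Definition enorm (x : plane) : R := Num.sqrt (x.1 ^+ 2 + x.2 ^+ 2).

(* The integral of f(x) exp(- i x.xi) over the Euclidean ball |x| <= n. *)
Definition fourier_ball (n : nat) (f : plane -> R) (xi : plane) : R[i] :=
  (\int[lebesgue2]_(x in [set x | enorm x <= n%:R]) (f x * cos (dot x xi)))
  -i* (\int[lebesgue2]_(x in [set x | enorm x <= n%:R])
         (f x * sin (dot x xi))).

(* F is the Fourier-Plancherel transform of the square-integrable function f:
   the L^2-limit of the transforms of the truncations of f to balls. *)
Definition is_fourier (f : plane -> R) (F : plane -> R[i]) : Prop :=
  [/\ Lp 2%:E f,
      Lp 2%:E (fun xi => complex.Re (F xi)),
      Lp 2%:E (fun xi => complex.Im (F xi)) &
      (fun n : nat => Lp_norm 2%:E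
         (fun xi => ComplexField.Normc.normc (F xi - fourier_ball n f xi)))
        @ \oo --> 0%E].

Definition is_multiplier (m : plane -> R[i]) (f g : plane -> R) : Prop :=
  Lp 2%:E g /\
  exists F G : plane -> R[i],
    [/\ is_fourier f F, is_fourier g G &
        {ae lebesgue2, forall xi, G xi = m xi * F xi}].

(* f belongs to the L^2-domain of the Fourier multiplier of symbol m. *)
Definition multiplier_dom (m : plane -> R[i]) (f : plane -> R) : Prop :=
  exists g, is_multiplier m f g.

(* Determined almost everywhere on multiplier_dom m, junk outside of it. *)
Definition multiplier (m : plane -> R[i]) (f : plane -> R) : plane -> R :=
  get [set g | is_multiplier m f g].

Definition Lambda1_symbol (s : R) (xi : plane) : R[i] := (`|xi.1| `^ s)%:C.
Definition Lambda2_symbol (s : R) (xi : plane) : R[i] := (`|xi.2| `^ s)%:C.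
Definition Lambda_symbol (s : R) (xi : plane) : R[i] := (enorm xi `^ s)%:C.

Definition Lambda1 (s : R) := multiplier (Lambda1_symbol s).
Definition Lambda2 (s : R) := multiplier (Lambda2_symbol s).
Definition Lambda (s : R) := multiplier (Lambda_symbol s).

(* d_{x_j} has symbol i xi_j; since 0 `^ (-1) = 0, the symbol of d_{x_j}
   Lambda^{-1} is given the value 0 at the origin. *)
Definition Riesz1 :=
  multiplier (fun xi => 'i%C * (xi.1)%:C * Lambda_symbol (-1) xi).
Definition Riesz2 :=
  multiplier (fun xi => 'i%C * (xi.2)%:C * Lambda_symbol (-1) xi).

Definition velocity (f : plane -> R) (x : plane) : plane :=
  (- Riesz2 f x, Riesz1 f x).

(* Lambda_{x_1}^{2 alpha} + Lambda_{x_2}^{2 beta}, read as Lambda^{2 alpha}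
   when alpha = beta. *)
Definition dissipation (alpha beta : R) (f : plane -> R) (x : plane) : R :=
  if alpha == beta then Lambda (2 * alpha) f x
  else Lambda1 (2 * alpha) f x + Lambda2 (2 * beta) f x.

(* The quadratic form < dissipation f, f >, with the same convention; for
   alpha = beta <= 1 it is at most the sum of the two directional terms, so that the
   energy inequality below is then implied by the one with that sum. *)
Definition dissipation_energy (alpha beta : R) (f : plane -> R) : \bar R :=
  (if alpha == beta then Lp_norm 2%:E (Lambda alpha f) ^+ 2
   else Lp_norm 2%:E (Lambda1 alpha f) ^+ 2
        + Lp_norm 2%:E (Lambda2 beta f) ^+ 2)%E.

Local Notation spacetime := (R^o * (R^o * R^o))%type.

(* All iterated directional derivatives exist and are differentiable. *)
Definition smooth (phi : spacetime -> R^o) : Prop :=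
  forall (vs : seq spacetime) (z : spacetime),
    differentiable (foldr (fun v f => 'D_v f) phi vs) z.

(* The restrictions to t >= 0 of these functions are the elements of
   C_c^oo([0, +oo[ x R^2). *)
Definition test_function (phi : spacetime -> R^o) : Prop :=
  smooth phi /\ compact (closure [set z | phi z != 0]).

Definition weakly_continuous (theta : R -> plane -> R) : Prop :=
  forall g : plane -> R, Lp 2%:E g ->
    {within `[0, +oo[, continuous
       (fun t : R => \int[lebesgue2]_x (theta t x * g x) : R)}.

(* The equation and the initial condition in the sense of distributions on
   [0, +oo[ x R^2; as div u = 0, (u . grad) theta is div (theta u). *)
Definition distributional_solution (alpha beta : R) (theta0 : plane -> R)
    (theta : R -> plane -> R) : Prop :=
  forall phi : spacetime -> R^o, test_function phi ->
    \int[lebesgue1]_(t in `[0, +oo[)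
      (\int[lebesgue2]_x
         (theta t x *
          ('D_(1, (0, 0)) phi (t, x)
           + (velocity (theta t) x).1 * 'D_(0, (1, 0)) phi (t, x)
           + (velocity (theta t) x).2 * 'D_(0, (0, 1)) phi (t, x)
           - dissipation alpha beta (fun y => phi (t, y)) x)))
    + \int[lebesgue2]_x (theta0 x * phi (0, x)) = 0.

Definition energy_inequality (alpha beta : R) (theta : R -> plane -> R)
    (t0 : R) : Prop :=
  forall t : R, t0 <= t ->
    (Lp_norm 2%:E (theta t) ^+ 2
     + 2%:E * \int[lebesgue1]_(tau in `[t0, t])
                dissipation_energy alpha beta (theta tau)
     <= Lp_norm 2%:E (theta t0) ^+ 2)%E.

(* theta is only meaningful at times t >= 0. *)
Record weak_solution (alpha beta : R) (theta0 : plane -> R)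
    (theta : R -> plane -> R) : Prop := WeakSolution {
  weak_L2 : forall t, 0 <= t -> Lp 2%:E (theta t) ;
  weak_cont : weakly_continuous theta ;
  weak_LooL2 : exists M : R,
    {ae lebesgue1, forall t, 0 < t -> (Lp_norm 2%:E (theta t) <= M%:E)%E} ;
  weak_Lambda1_dom : {ae lebesgue1, forall t, 0 < t ->
    multiplier_dom (Lambda1_symbol alpha) (theta t)} ;
  weak_Lambda2_dom : {ae lebesgue1, forall t, 0 < t ->
    multiplier_dom (Lambda2_symbol beta) (theta t)} ;
  weak_Lambda1_L2L2 : (\int[lebesgue1]_(t in `]0%R, +oo[)
    Lp_norm 2%:E (Lambda1 alpha (theta t)) ^+ 2 < +oo)%E ;
  weak_Lambda2_L2L2 : (\int[lebesgue1]_(t in `]0%R, +oo[)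
    Lp_norm 2%:E (Lambda2 beta (theta t)) ^+ 2 < +oo)%E ;
  weak_equation : distributional_solution alpha beta theta0 theta ;
  weak_energy0 : energy_inequality alpha beta theta 0 ;
  weak_energy : {ae lebesgue1, forall t0, 0 < t0 ->
    energy_inequality alpha beta theta t0} ;
  weak_Lq : forall q : \bar R, (1 <= q)%E -> Lp q theta0 ->
    forall t, 0 <= t -> (Lp_norm q (theta t) <= Lp_norm q theta0)%E
}.

End Plane.

(* Main.v *)
Require Import Defs.
From HB Require Import structures.
From mathcomp Require Import all_boot all_order all_algebra.
From mathcomp Require Import complex.
From mathcomp Require Import all_classical all_reals all_analysis.
From mathcomp Require Import measurable_realfun interval_inference ring lra.
Set Implicit Arguments.
Unset Strict Implicit.
Unset Printing Implicit Defensive.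
Import Order.TTheory GRing.Theory Num.Theory.
Import numFieldNormedType.Exports.
Local Open Scope classical_set_scope.
Local Open Scope ring_scope.

(** The decay comes from the balance between the dissipation and the
    conservation of the [L^p] bound with [p < 2], as in Nash's treatment of the
    heat equation. Write [y t] for the squared [L^2] norm of [theta t], [E t]
    for the dissipation energy and [sg = (alpha + beta)(2 - p) / (2 alpha beta p)].

    The heart is a Nash-type inequality [y <= 2 lam E + C lam ^ (- sg)], valid
    for every cutoff [lam > 0] ([nash_dissipation]). By Plancherel, [y] is the
    mass of the transform of [theta]. Frequencies with
    [lam (|xi_1| ^ (2 alpha) + |xi_2| ^ (2 beta)) >= 1] are paid for by
    [lam E]; the others lie in a box of area of order
    [lam ^ (- 1 / (2 alpha) - 1 / (2 beta))],
    on which the [L^p] bound limits the mass. The cutoff is made by a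
    weight [w], a product in each coordinate of [2 q - q ^ 2], [q = exp (- a |s|)]
    ([wt]), for which [1 - w] is at most the symbol of [lam E] ([onem_wt2_le]).
    The transform of [w] is an explicit nonnegative, bounded and integrable
    kernel [K], so the low-frequency mass is the double integral of
    [f x * f y * K x y]. A pointwise weighted arithmetic-geometric inequality
    bounds it by a power of the [L^p] norm ([schur_bound]), which does the work
    of the Hausdorff-Young inequality.

    A suitable [lam] gives [E >= c y ^ (1 + 1 / sg)]
    ([dissipation_energy_ge]). The energy inequality started at almost every
    time shows that [y] is at least [y t] at almost every time before [t], so for almost
    every [s < t] one gets [(t - s) c y(t) ^ (1 + 1 / sg) <= y(s)] ([energy_step]). Using this
    with [s] between [t / 4] and [t / 2], the supremum [M] of [t ^ sg y t]
    satisfies [M ^ (1 + 1 / sg) <= L M], hence is bounded ([algebraic_decay]).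

    Plancherel's theorem is obtained through the Hartley transform, whose real
    kernel [cas = cos + sin] is symmetric. For a real function it carries the
    same information as the Fourier transform, which is recovered from its even
    and odd parts ([is_fourier_hartley], [is_hartley_fourier]). The identity
    between weighted energy and kernel form, for weights increasing to [1],
    shows that it is bounded by [2 pi] on [L^2] ([hartley_bounded]) and that
    the bound is attained by indicators of rectangles ([hartley_rect_ge]).
    A nonnegative quadratic form that vanishes at a vector has that vector in
    its kernel; as rectangles determine a function, the square of the
    transform is [(2 pi) ^ 2] ([hartley_involution]), which gives both
    [plancherel] and [hartley_surjective]. Surjectivity enters when
    [alpha = beta]: it shows that a function in the domains of both directional
    operators lies in the domain of the isotropic one. *)

(** * Square-integrable functions *)

Section SquareIntegrable.
Context d (T : measurableType d) (R : realType).
Variable mu : {measure set T -> \bar R}.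
Implicit Types (f g h : T -> R) (u v : nat -> T -> R).
Local Notation L2 f := (f \in Lfun mu 2%:E).

Definition ip f g : R := \int[mu]_x (f x * g x).
Definition sq f : R := ip f f.

Lemma L2_measurable f : L2 f -> measurable_fun setT f.
Proof. by move=> /sub_Lfun_mfun; rewrite inE. Qed.

Lemma L2P f : measurable_fun setT f ->
  mu.-integrable setT (fun x => (f x * f x)%:E) -> L2 f.
Proof.
move=> mf iff; rewrite inE; apply/andP; split; rewrite inE //=.
rewrite /finite_norm unlock; apply: poweR_lty.
have /integrableP[_] := iff; apply: le_lt_trans.
rewrite le_eqVlt; apply/orP; left; apply/eqP.
apply: eq_integral => x _ /=.
by rewrite powR_mulrn// -normrX expr2.
Qed.

Lemma L2_mul_integrable f g : L2 f -> L2 g ->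
  mu.-integrable setT (fun x => (f x * g x)%:E).
Proof. by move=> lf lg; exact/Lfun1_integrable/Lfun2_mul_Lfun1. Qed.

Lemma L2D f g : L2 f -> L2 g -> L2 (fun x => f x + g x).
Proof.
move=> lf lg; have mf := L2_measurable lf; have mg := L2_measurable lg.
apply: L2P; first exact: measurable_funD.
have : mu.-integrable setT ((fun x => (f x * f x)%:E) \+ (fun x => (f x * g x)%:E)
   \+ ((fun x => (f x * g x)%:E) \+ (fun x => (g x * g x)%:E))).
  by apply: integrableD => //; apply: integrableD => //; exact: L2_mul_integrable.
by apply: eq_integrable => // x _ /=; rewrite -!EFinD; congr EFin; ring.
Qed.

Lemma L2Z c f : L2 f -> L2 (fun x => c * f x).
Proof.
move=> lf; have mf := L2_measurable lf.
apply: L2P; first exact: measurable_funM.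
have : mu.-integrable setT (fun x => (c * c)%:E * (f x * f x)%:E)%E.
  by apply: integrableZl => //; exact: L2_mul_integrable.
by apply: eq_integrable => // x _ /=; rewrite -!EFinM; congr EFin; ring.
Qed.

Lemma L2B f g : L2 f -> L2 g -> L2 (fun x => f x - g x).
Proof.
move=> lf lg.
have -> : (fun x => f x - g x) = (fun x => f x + (-1) * g x).
  by apply/funext => x; rewrite mulN1r.
by apply: L2D => //; exact: L2Z.
Qed.

Lemma L2_le f g : measurable_fun setT f -> L2 g ->
  (forall x, `|f x| <= `|g x|) -> L2 f.
Proof.
move=> mf lg fg; apply: L2P => //.
apply: le_integrable (L2_mul_integrable lg lg) => //.
  by apply/measurable_EFinP; exact: measurable_funM.
by move=> x _ /=; rewrite lee_fin !normrM ler_pM.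
Qed.

Lemma ipC f g : ip f g = ip g f.
Proof. by apply: eq_Rintegral => x _; rewrite mulrC. Qed.

Lemma ipDl f g h : L2 f -> L2 g -> L2 h ->
  ip (fun x => f x + g x) h = ip f h + ip g h.
Proof.
move=> lf lg lh; rewrite /ip.
under eq_Rintegral do rewrite mulrDl.
by rewrite RintegralD//; exact: L2_mul_integrable.
Qed.

Lemma ipZl c f g : L2 f -> L2 g -> ip (fun x => c * f x) g = c * ip f g.
Proof.
move=> lf lg; rewrite /ip.
under eq_Rintegral do rewrite -mulrA.
by rewrite RintegralZl//; exact: L2_mul_integrable.
Qed.

Lemma ipBl f g h : L2 f -> L2 g -> L2 h ->
  ip (fun x => f x - g x) h = ip f h - ip g h.
Proof.
move=> lf lg lh; rewrite /ip.
under eq_Rintegral do rewrite mulrBl.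
by rewrite RintegralB//; exact: L2_mul_integrable.
Qed.

Lemma ipDr f g h : L2 f -> L2 g -> L2 h ->
  ip h (fun x => f x + g x) = ip h f + ip h g.
Proof. by move=> *; rewrite ipC ipDl// !(ipC h). Qed.
Lemma ipBr f g h : L2 f -> L2 g -> L2 h ->
  ip h (fun x => f x - g x) = ip h f - ip h g.
Proof. by move=> *; rewrite ipC ipBl// !(ipC h). Qed.
Lemma ipZr c f g : L2 f -> L2 g -> ip f (fun x => c * g x) = c * ip f g.
Proof. by move=> *; rewrite ipC ipZl// (ipC f). Qed.

Lemma sq_ge0 f : 0 <= sq f.
Proof. by apply: Rintegral_ge0 => x _; rewrite -expr2 sqr_ge0. Qed.

Lemma sqD f g : L2 f -> L2 g ->
  sq (fun x => f x + g x) = sq f + 2 * ip f g + sq g.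
Proof.
move=> lf lg; rewrite /sq ipDl ?ipDr ?(ipC g f)//; last exact: L2D.
by ring.
Qed.

Lemma sqB f g : L2 f -> L2 g ->
  sq (fun x => f x - g x) = sq f - 2 * ip f g + sq g.
Proof.
move=> lf lg; rewrite /sq ipBl ?ipBr ?(ipC g f)//; last exact: L2B.
by ring.
Qed.

Lemma sqZ c f : L2 f -> sq (fun x => c * f x) = c ^+ 2 * sq f.
Proof. by move=> lf; rewrite /sq ipZl ?ipZr//; [ring|exact: L2Z]. Qed.

Lemma le_sq f g : measurable_fun setT f -> L2 g ->
  (forall x, `|f x| <= `|g x|) -> sq f <= sq g.
Proof.
move=> mf lg fg; have lf := L2_le mf lg fg.
apply: le_Rintegral => //; [exact: L2_mul_integrable..|].
by move=> x _; rewrite -!expr2 -(real_normK (num_real (f x))) -(real_normK (num_real (g x))) lerXn2r// nnegrE.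
Qed.

Lemma sq_EFin f : L2 f -> (\int[mu]_x ((f x * f x)%:E))%E = (sq f)%:E.
Proof.
by move=> lf; rewrite /sq /ip /Rintegral fineK//; apply: integrable_fin_num => //; exact: L2_mul_integrable.
Qed.

Lemma Lnorm2_sq f : L2 f -> ('N[mu]_2%:E [EFin \o f] ^+ 2 = (sq f)%:E)%E.
Proof.
move=> lf; rewrite -sq_EFin//.
have -> : (\int[mu]_x (f x * f x)%:E = 'N[mu]_2%:E[EFin \o f] `^ 2)%E.
  rewrite powR_Lnorm//; apply: eq_integral => x _ /=.
  by rewrite powR_mulrn// -normrX expr2 ger0_norm// -expr2 sqr_ge0.
have := Lnorm_ge0 mu 2%:E (EFin \o f).
case: ('N[mu]_2%:E[EFin \o f])%E => [r r0||//].
  by rewrite poweR_EFin powR_mulrn//.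
by move=> _; rewrite poweRyr.
Qed.

Lemma ae_eq_sq f g : L2 f -> L2 g -> {ae mu, forall x, f x = g x} -> sq f = sq g.
Proof.
move=> lf lg fg; rewrite /sq /ip /Rintegral; congr fine.
apply: ae_eq_integral => //.
- by apply/measurable_EFinP/measurable_funM; exact: L2_measurable.
- by apply/measurable_EFinP/measurable_funM; exact: L2_measurable.
- by apply: filterS fg => x ->.
Qed.

Lemma sq0_ae f : L2 f -> sq f = 0 -> {ae mu, forall x, f x = 0}.
Proof.
move=> lf f0; have mf := L2_measurable lf.
have : ae_eq mu setT (fun x => (f x * f x)%:E) (cst 0%E).
  apply/(ae_eq_integral_abs _ measurableT).
    by apply/measurable_EFinP; exact: measurable_funM.
  rewrite -[RHS]/(0%:E) -f0 -sq_EFin//; apply: eq_integral => x _ /=.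
  by rewrite ger0_norm// -expr2 sqr_ge0.
by apply: filterS => x /= /(_ I) [] /eqP; rewrite mulf_eq0 orbb => /eqP.
Qed.

Lemma cauchy_schwarz f g : L2 f -> L2 g -> ip f g ^+ 2 <= sq f * sq g.
Proof.
move=> lf lg; have [g0|] := eqVneq (sq g) 0.
  suff -> : ip f g = 0 by rewrite g0 mulr0 expr0n.
  rewrite /ip /Rintegral (@ae_eq_integral _ _ _ mu setT (cst 0%E)) ?integral0//=.
    by apply/measurable_EFinP/measurable_funM; exact: L2_measurable.
  by apply: filterS (sq0_ae lg g0) => x /= -> _; rewrite mulr0.
move=> g0; have gp : 0 < sq g by rewrite lt_neqAle eq_sym g0 sq_ge0.
have := sq_ge0 (fun x => f x - (ip f g / sq g) * g x).
rewrite sqB//; last exact: L2Z.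
rewrite sqZ// ipZr//.
have -> : sq f - 2 * (ip f g / sq g * ip f g) + (ip f g / sq g) ^+ 2 * sq g =
  sq f - ip f g ^+ 2 / sq g by field.
by rewrite subr_ge0 ler_pdivrMr.
Qed.

Definition cvg2 u f := sq (fun x => u n x - f x) @[n --> \oo] --> (0 : R).

Lemma norm_ip_le f g : L2 f -> L2 g -> `|ip f g| <= Num.sqrt (sq f) * Num.sqrt (sq g).
Proof.
move=> lf lg; rewrite -sqrtrM ?sq_ge0// -sqrtr_sqr ler_sqrt ?cauchy_schwarz//.
by rewrite mulr_ge0 ?sq_ge0.
Qed.

Lemma sqrt_cvg0 (a : nat -> R) : a @ \oo --> (0 : R) -> Num.sqrt (a n) @[n --> \oo] --> (0 : R).
Proof.
move=> a0; rewrite -(@sqrtr0 R).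
exact: (continuous_cvg _ (@sqrt_continuous R 0)).
Qed.

Lemma cvg2_ip u v f g : (forall n, L2 (u n)) -> (forall n, L2 (v n)) -> L2 f -> L2 g ->
  cvg2 u f -> cvg2 v g -> ip (u n) (v n) @[n --> \oo] --> ip f g.
Proof.
move=> lu lv lf lg uf vg.
have lD n : L2 (fun x => u n x - f x) by exact: L2B.
have lE n : L2 (fun x => v n x - g x) by exact: L2B.
set a := fun n => Num.sqrt (sq (fun x => u n x - f x)).
set b := fun n => Num.sqrt (sq (fun x => v n x - g x)).
have a0 : a @ \oo --> (0 : R) by exact: sqrt_cvg0.
have b0 : b @ \oo --> (0 : R) by exact: sqrt_cvg0.
set c := fun n => a n * b n + a n * Num.sqrt (sq g) + Num.sqrt (sq f) * b n.
have c0 : c @ \oo --> (0 : R).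
  have -> : (0 : R) = 0 * 0 + 0 * Num.sqrt (sq g) + Num.sqrt (sq f) * 0 by ring.
  apply: cvgD; first apply: cvgD.
  - exact: cvgM.
  - exact: cvgMl.
  - exact: cvgMr.
apply/subr_cvg0.
apply: (@squeeze_cvgr _ _ _ _ (fun n => - c n) c) => //; last first.
  by rewrite -oppr0; exact: cvgN.
apply: nearW => n; rewrite -ler_norml.
have -> : ip (u n) (v n) - ip f g = ip (fun x => u n x - f x) (fun x => v n x - g x)
   + ip (fun x => u n x - f x) g + ip f (fun x => v n x - g x).
  by rewrite !ipBl// ?ipBr//; ring.
apply: le_trans (ler_normD _ _) _; apply: lerD; last exact: norm_ip_le.
by apply: le_trans (ler_normD _ _) _; apply: lerD; exact: norm_ip_le.
Qed.

End SquareIntegrable.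

(** * A Young-type bound for nonnegative kernels *)

Section Schur.
Context {R : realType}.

(** Young's inequality for the conjugate exponents [1 / s] and [1 / (1 - s)]. *)
Lemma powR_weighted_AGM (s x y : R) : 0 <= s <= 1 -> 0 <= x -> 0 <= y ->
  x `^ s * y `^ (1 - s) <= s * x + (1 - s) * y.
Proof.
move=> /andP[s0 s1] x0 y0.
have [->|sn0] := eqVneq s 0; first by rewrite powRr0 subr0 powRr1// !mul1r mul0r add0r.
have [->|sn1] := eqVneq s 1; first by rewrite powRr1// subrr powRr0 mulr1 mul1r mul0r addr0.
have sp : 0 < s by rewrite lt_neqAle eq_sym sn0.
have sq : 0 < 1 - s by rewrite subr_gt0 lt_neqAle sn1.
have := @conjugate_powR R (x `^ s) (y `^ (1 - s)) s^-1 (1 - s)^-1.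
rewrite !powR_ge0 !invr_gt0 sp sq !invrK => /(_ isT isT isT isT).
rewrite -!powRrM !mulfV ?gt_eqF// !powRr1// [x * _]mulrC [y * _]mulrC.
by apply; ring.
Qed.

(** Since [p (1 + s) = 2], the product [a b k ^ (1 - s)] is the geometric mean of
    [a^p b^p], [a^p k] and [b^p k] with weights [s], [(1 - s) / 2] and
    [(1 - s) / 2]; the remaining factor [k ^ s] is at most [M ^ s]. The
    normalizations by [N] and [kap] make each of the three terms integrate to at
    most [1] when [N] bounds the integral of [a^p] and [kap] the marginals of
    the kernel. *)
Lemma schur_pointwise (s p M N kap a b k : R) : 0 <= s <= 1 -> p * (1 + s) = 2 ->
  0 < N -> 0 < kap -> 0 <= a -> 0 <= b -> 0 <= k <= M ->
  a * b * k <= (M `^ s * N `^ (1 + s) * kap `^ (1 - s)) *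
    (s * (a `^ p * b `^ p / N ^+ 2) +
     (1 - s) / 2 * (a `^ p * k / (N * kap) + b `^ p * k / (N * kap))).
Proof.
move=> s01 ps N0 kap0 a0 b0 /andP[k0 kM]; have /andP[s0 s1] := s01.
have s1n : 1 + s != 0 by apply: lt0r_neq0; lra.
have M0 : 0 <= M by exact: le_trans kM.
have C0 : 0 <= M `^ s * N `^ (1 + s) * kap `^ (1 - s) by rewrite !mulr_ge0 ?powR_ge0.
have S0 : 0 <= (1 - s) / 2 by lra.
have NK : 0 <= N * kap by rewrite mulr_ge0// ltW.
have NN : 0 <= N ^+ 2 by rewrite exprn_ge0// ltW.
have [abk|] := eqVneq (a * b * k) 0.
  rewrite abk; apply: mulr_ge0 => //; apply: addr_ge0; apply: mulr_ge0 => //.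
    by rewrite divr_ge0// mulr_ge0 ?powR_ge0.
  by apply: addr_ge0; apply: divr_ge0 => //; rewrite mulr_ge0 ?powR_ge0.
rewrite !mulf_eq0 !negb_or => /andP[/andP[an bn] kn].
have ap : 0 < a by rewrite lt_neqAle eq_sym an.
have bp : 0 < b by rewrite lt_neqAle eq_sym bn.
have kp : 0 < k by rewrite lt_neqAle eq_sym kn.
set u := a `^ p * b `^ p / N ^+ 2.
set v := a `^ p * k / (N * kap); set w := b `^ p * k / (N * kap).
have u0 : 0 <= u by rewrite /u divr_ge0// mulr_ge0 ?powR_ge0.
have v0 : 0 <= v by rewrite /v divr_ge0// mulr_ge0 ?powR_ge0.
have w0 : 0 <= w by rewrite /w divr_ge0// mulr_ge0 ?powR_ge0.
have Kk : k <= M `^ s * k `^ (1 - s).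
  have {1}-> : k = k `^ s * k `^ (1 - s).
    by rewrite -powRD ?kn ?implybT// addrC subrK powRr1.
  by rewrite ler_wpM2r ?powR_ge0// ge0_ler_powR// nnegrE// (le_trans k0).
have E : a * b * k `^ (1 - s) =
   N `^ (1 + s) * kap `^ (1 - s) * (u `^ s * (v `^ 2^-1 * w `^ (1 - 2^-1)) `^ (1 - s)).
  have powE (x r : R) : (expR x) `^ r = expR (r * x).
    by rewrite /powR gt_eqF ?expR_gt0// expRK.
  rewrite /u /v /w -(lnK ap) -(lnK bp) -(lnK kp) -(lnK N0) -(lnK kap0).
  rewrite -expRM_natl !powE -!expRD -!expRN -!expRD !powE -!expRD !powE -!expRD.
  have -> : p = 2 / (1 + s) by rewrite -ps mulfK.
  by congr expR; field.
have le1 : a * b * k <= M `^ s * (a * b * k `^ (1 - s)).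
  by rewrite mulrCA ler_wpM2l// mulr_ge0.
apply: (le_trans le1); rewrite E mulrA [M `^ s * _]mulrA ler_wpM2l//.
apply: (le_trans (powR_weighted_AGM s01 u0 _)).
  by rewrite mulr_ge0 ?powR_ge0.
rewrite lerD2l -mulrA ler_wpM2l ?subr_ge0//.
have h01 : 0 <= (2^-1 : R) <= 1 by lra.
by apply: (le_trans (powR_weighted_AGM h01 v0 w0)); lra.
Qed.

End Schur.

Section SchurIntegral.
Context d (T : measurableType d) (R : realType).
Variable mu : {sigma_finite_measure set T -> \bar R}.
Local Open Scope ereal_scope.

(** Interpolates between the Schur test ([s = 0], [p = 2], only the marginals of
    the kernel matter) and the uniform bound ([s = 1], [p = 1], only its supremum
    matters): [schur_pointwise] is integrated term by term with Tonelli. *)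
Lemma schur_bound (f : T -> R) (K : T -> T -> R) (s p M N kap : R) :
  (0 <= s <= 1)%R -> (p * (1 + s) = 2)%R -> (0 < N)%R -> (0 < kap)%R ->
  measurable_fun setT f -> measurable_fun setT (fun z : T * T => K z.1 z.2) ->
  (forall x y, 0 <= K x y <= M)%R ->
  (forall x, \int[mu]_y (K x y)%:E <= kap%:E) ->
  (forall y, \int[mu]_x (K x y)%:E <= kap%:E) ->
  \int[mu]_x (`|f x| `^ p)%:E <= N%:E ->
  \int[mu]_x \int[mu]_y (`|f x| * `|f y| * K x y)%:E <=
    (M `^ s * N `^ (1 + s) * kap `^ (1 - s))%:E.
Proof.
move=> s01 ps N0 kap0 mf mK K0 K1 K2 fN.
have /andP[s0 s1] := s01.
pose P x := (`|f x| `^ p)%R.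
have mP : measurable_fun setT P.
  by apply: (measurableT_comp (measurable_powR p)); exact: measurableT_comp.
have P0 x : (0 <= P x)%R by exact: powR_ge0.
have K0' x y : (0 <= K x y)%R by have /andP[] := K0 x y.
have mfst (g : T -> R) : measurable_fun setT g -> measurable_fun setT (fun z : T * T => g z.1).
  by move=> mg; exact: measurableT_comp.
have msnd (g : T -> R) : measurable_fun setT g -> measurable_fun setT (fun z : T * T => g z.2).
  by move=> mg; exact: measurableT_comp.
have mKl x : measurable_fun setT (K x).
  exact: (measurableT_comp mK (measurable_pair1 x)).
have mKr y : measurable_fun setT (K ^~ y).
  exact: (measurableT_comp mK (measurable_pair2 y)).
pose C := (M `^ s * N `^ (1 + s) * kap `^ (1 - s))%R.
have C0 : (0 <= C)%R by rewrite !mulr_ge0 ?powR_ge0.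
pose c := ((1 - s) / 2)%R.
have c0 : (0 <= c)%R by rewrite /c; lra.
pose U (z : T * T) := (s * (P z.1 * P z.2 / N ^+ 2))%R.
pose V (z : T * T) := (c * (P z.1 * K z.1 z.2 / (N * kap)))%R.
pose W (z : T * T) := (c * (P z.2 * K z.1 z.2 / (N * kap)))%R.
have NN : (0 <= N ^+ 2)%R by rewrite exprn_ge0// ltW.
have NK : (0 <= N * kap)%R by rewrite mulr_ge0// ltW.
have U0 z : (0 <= U z)%R by rewrite /U mulr_ge0// divr_ge0// mulr_ge0.
have V0 z : (0 <= V z)%R by rewrite /V mulr_ge0// divr_ge0// mulr_ge0.
have W0 z : (0 <= W z)%R by rewrite /W mulr_ge0// divr_ge0// mulr_ge0.
have mU : measurable_fun setT U.
  by apply: measurable_funM => //; apply: measurable_funM => //; apply: measurable_funM; [exact: mfst|exact: msnd].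
have mV : measurable_fun setT V.
  by apply: measurable_funM => //; apply: measurable_funM => //; apply: measurable_funM => //; exact: mfst.
have mW : measurable_fun setT W.
  by apply: measurable_funM => //; apply: measurable_funM => //; apply: measurable_funM => //; exact: msnd.
have iP (k : R) : (0 <= k)%R -> \int[mu]_y (k * P y)%:E <= (k * N)%:E.
  move=> k0; under eq_integral do rewrite EFinM.
  rewrite ge0_integralZl_EFin//; [|by move=> y _; rewrite lee_fin|exact/measurable_EFinP].
  by rewrite EFinM; apply: lee_wpmul2l.
have iF : forall (G : T * T -> R) (k : R), (0 <= k)%R -> (forall z, 0 <= G z)%R ->
    measurable_fun setT G -> (forall x, \int[mu]_y (G (x, y))%:E <= (k * P x)%:E) ->
    \int[mu \x mu]_z (G z)%:E <= (k * N)%:E.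
  move=> G k k0 G0 mG hG; have mG' : measurable_fun setT (EFin \o G) by exact/measurable_EFinP.
  rewrite fubini_tonelli1//; apply: le_trans (iP k k0).
  apply: ge0_le_integral => //=.
  - by move=> x _; apply: integral_ge0 => y _; rewrite lee_fin.
  - exact: (measurable_fun_fubini_tonelli_F (EFin \o G)).
  - by apply/measurable_EFinP; exact: measurable_funM.
  - by move=> x _; exact: hG.
have iG : forall (G : T * T -> R) (k : R), (0 <= k)%R -> (forall z, 0 <= G z)%R ->
    measurable_fun setT G -> (forall y, \int[mu]_x (G (x, y))%:E <= (k * P y)%:E) ->
    \int[mu \x mu]_z (G z)%:E <= (k * N)%:E.
  move=> G k k0 G0 mG hG; have mG' : measurable_fun setT (EFin \o G) by exact/measurable_EFinP.
  rewrite fubini_tonelli2//; apply: le_trans (iP k k0).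
  apply: ge0_le_integral => //=.
  - by move=> x _; apply: integral_ge0 => y _; rewrite lee_fin.
  - exact: (measurable_fun_fubini_tonelli_G (EFin \o G)).
  - by apply/measurable_EFinP; exact: measurable_funM.
  - by move=> x _; exact: hG.
have Nn : (N != 0)%R by exact: lt0r_neq0.
have kapn : (kap != 0)%R by exact: lt0r_neq0.
have NKn : (N * kap != 0)%R by rewrite mulf_neq0.
have iU : \int[mu \x mu]_z (U z)%:E <= s%:E.
  have -> : s = (s / N * N)%R by rewrite divfK.
  apply: iF => //; first by rewrite divr_ge0// ltW.
  move=> x.
  have -> : (s / N * P x = s * P x / N^+2 * N)%R by field.
  apply: le_trans (iP _ _); last by rewrite divr_ge0// mulr_ge0.
  rewrite le_eqVlt; apply/orP; left; apply/eqP; apply: eq_integral => y _.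
  by congr EFin; rewrite /U /=; ring.
have iV : \int[mu \x mu]_z (V z)%:E <= c%:E.
  have -> : c = (c / N * N)%R by rewrite divfK.
  apply: iF => //; first by rewrite divr_ge0// ltW.
  move=> x; have e0 : (0 <= c * P x / (N * kap))%R by rewrite divr_ge0// mulr_ge0.
  have -> : (c / N * P x = c * P x / (N * kap) * kap)%R by field; rewrite Nn kapn.
  rewrite EFinM; apply: le_trans (lee_wpmul2l _ (K1 x)); last by rewrite lee_fin.
  rewrite -ge0_integralZl_EFin//; [|by move=> y _; rewrite lee_fin|exact/measurable_EFinP].
  rewrite le_eqVlt; apply/orP; left; apply/eqP; apply: eq_integral => y _.
  by rewrite -EFinM; congr EFin; rewrite /V /=; ring.
have iW : \int[mu \x mu]_z (W z)%:E <= c%:E.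
  have -> : c = (c / N * N)%R by rewrite divfK.
  apply: iG => //; first by rewrite divr_ge0// ltW.
  move=> x; have e0 : (0 <= c * P x / (N * kap))%R by rewrite divr_ge0// mulr_ge0.
  have -> : (c / N * P x = c * P x / (N * kap) * kap)%R by field; rewrite Nn kapn.
  rewrite EFinM; apply: le_trans (lee_wpmul2l _ (K2 x)); last by rewrite lee_fin.
  rewrite -ge0_integralZl_EFin//; [|by move=> y _; rewrite lee_fin|exact/measurable_EFinP/mKr].
  rewrite le_eqVlt; apply/orP; left; apply/eqP; apply: eq_integral => y _.
  by rewrite -EFinM; congr EFin; rewrite /W /=; ring.
pose F (z : T * T) := (`|f z.1| * `|f z.2| * K z.1 z.2)%R.
have F0 z : (0 <= F z)%R by rewrite /F !mulr_ge0.
have mnf : measurable_fun setT (fun x => `|f x|%R) by exact: measurableT_comp.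
have mF : measurable_fun setT F.
  by apply: measurable_funM => //; apply: measurable_funM; [exact: (mfst (fun x => `|f x|%R))|exact: (msnd (fun x => `|f x|%R))].
have -> : \int[mu]_x \int[mu]_y (`|f x| * `|f y| * K x y)%:E = \int[mu \x mu]_z (F z)%:E.
  by rewrite fubini_tonelli1; [|exact/measurable_EFinP|by move=> z; rewrite lee_fin].
apply: (@le_trans _ _ (\int[mu \x mu]_z (C * (U z + (V z + W z)))%:E)).
  apply: ge0_le_integral => //=.
  - by move=> z _; rewrite lee_fin.
  - exact/measurable_EFinP.
  - apply/measurable_EFinP; apply: measurable_funM => //.
    by apply: measurable_funD => //; exact: measurable_funD.
  move=> z _; rewrite lee_fin /F.
  apply: (le_trans (schur_pointwise s01 ps N0 kap0 (normr_ge0 (f z.1)) (normr_ge0 (f z.2)) (K0 z.1 z.2))).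
  by rewrite ler_wpM2l// /U /V /W mulrDr.
under eq_integral do rewrite EFinM.
rewrite ge0_integralZl_EFin//; last 2 first.
- by move=> z _; rewrite lee_fin !addr_ge0.
- by apply/measurable_EFinP; apply: measurable_funD => //; exact: measurable_funD.
rewrite -[leRHS]mule1; apply: lee_wpmul2l; first by rewrite lee_fin.
under eq_integral do rewrite EFinD.
rewrite ge0_integralD//; last 4 first.
- by move=> z _; rewrite lee_fin.
- exact/measurable_EFinP.
- by move=> z _; rewrite lee_fin addr_ge0.
- by apply/measurable_EFinP; exact: measurable_funD.
under [X in _ + X]eq_integral do rewrite EFinD.
rewrite ge0_integralD//; last 4 first.
- by move=> z _; rewrite lee_fin.
- exact/measurable_EFinP.
- by move=> z _; rewrite lee_fin.
- exact/measurable_EFinP.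
have -> : 1 = s%:E + (c%:E + c%:E) by rewrite -!EFinD; congr EFin; rewrite /c; field.
exact: leeD iU (leeD iV iW).
Qed.

End SchurIntegral.

(** * Mean-square completeness and limits *)

Section Complete.
Context d (T : measurableType d) (R : realType).
Variable mu : {measure set T -> \bar R}.
Implicit Types (f g h : T -> R) (u v : nat -> T -> R).
Local Notation L2 f := (f \in Lfun mu 2%:E).

(** The weighted sum of squares with weights [4 ^ k] has integral at most
    the sum of the [2 ^- k], so it is finite almost everywhere; there the [k]-th
    difference is at most a constant times [2 ^- k]. *)
Lemma ae_cvg_of_summable_differences u : (forall n, L2 (u n)) ->
  (forall k, sq mu (fun x => u k.+1 x - u k x) <= (8^-1) ^+ k) ->
  {ae mu, forall x, cvgn (fun n => u n x)}.
Proof.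
move=> lu hu; pose dd k x := u k.+1 x - u k x.
have ld k : L2 (dd k) by exact: L2B.
pose S x := (\sum_(k <oo) (4 ^+ k * (dd k x * dd k x))%:E)%E.
have t0 k x : 0 <= 4 ^+ k * (dd k x * dd k x).
  by rewrite mulr_ge0// -?expr2 ?sqr_ge0// exprn_ge0.
have mt k : measurable_fun setT (fun x => (4 ^+ k * (dd k x * dd k x))%:E).
  by apply/measurable_EFinP; apply: measurable_funM => //; apply: measurable_funM; exact: L2_measurable.
have mS : measurable_fun setT S.
  by apply: ge0_emeasurable_sum => // k x _ _; rewrite lee_fin.
have S0 x : (0 <= S x)%E by apply: nneseries_ge0 => k _ _; rewrite lee_fin.
have Sfin : (\int[mu]_x S x < +oo)%E.
  rewrite /S integral_nneseries//; last by move=> n x _; rewrite lee_fin.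
  apply: (@le_lt_trans _ _ (\sum_(k <oo) ((2^-1) ^+ k)%:E)%E).
    apply: lee_nneseries => [k _ _|k _].
      by apply: integral_ge0 => x _; rewrite lee_fin.
    under eq_integral do rewrite EFinM.
    rewrite ge0_integralZl_EFin ?exprn_ge0//; last 2 first.
    - by move=> x _; rewrite lee_fin -expr2 sqr_ge0.
    - by apply/measurable_EFinP; apply: measurable_funM; exact: L2_measurable.
    rewrite sq_EFin// -EFinM lee_fin.
    have -> : (2^-1 : R) ^+ k = 4 ^+ k * 8^-1 ^+ k by rewrite -exprMn; congr (_ ^+ _); lra.
    by apply: ler_wpM2l (hu k); rewrite exprn_ge0.
  have := @cvg_geometric_eseries_half R 2 0; move/cvg_lim => /(_ (@ereal_hausdorff R)).
  rewrite (_ : eseries _ = eseries (fun k => ((2^-1) ^+ k)%:E)).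
    by rewrite /eseries => ->; rewrite ltry.
  congr eseries; apply/funext => k; congr EFin.
  by rewrite addn1 expnS natrM natrX exprVn invfM mulrA divff ?mul1r.
have iS : mu.-integrable setT S.
  apply/integrableP; split => //; apply: le_lt_trans Sfin.
  by rewrite le_eqVlt; apply/orP; left; apply/eqP; apply: eq_integral => x _; rewrite gee0_abs.
apply: filterS (integrable_ae measurableT iS) => x /(_ I) Sx.
set C := fine (S x).
have dC k : `|dd k x| <= Num.sqrt C * (2^-1) ^+ k.
  have : ((4 ^+ k * (dd k x * dd k x))%:E <= C%:E)%E.
    rewrite /C fineK//.
    apply: le_trans (nneseries_lim_ge k.+1 _) => [|i _]; last by rewrite lee_fin.
    rewrite big_nat_recr//= leeDr// sume_ge0// => i _; by rewrite lee_fin.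
  rewrite lee_fin => h.
  rewrite -(ler_pM2r (x := 2 ^+ k)) ?exprn_gt0//.
  rewrite -mulrA -exprMn mulVf// expr1n mulr1.
  have -> : `|dd k x| * 2 ^+ k = Num.sqrt (4 ^+ k * (dd k x * dd k x)).
    have -> : (4 : R) = 2 ^+ 2 by rewrite expr2; lra.
    rewrite -exprM mulnC exprM -expr2 -exprMn sqrtr_sqr normrM mulrC ger0_norm// exprn_ge0//.
  by rewrite ler_sqrt// (le_trans _ h).
have cS : cvgn (series (fun k => dd k x)).
  apply: normed_cvg; apply: (@series_le_cvg _ _ (fun k => Num.sqrt C * (2^-1) ^+ k)) => /= .
  - by move=> n; rewrite normr_ge0.
  - by move=> n; rewrite mulr_ge0 ?sqrtr_ge0// exprn_ge0// invr_ge0.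
  - by move=> n; exact: dC.
  - apply: is_cvg_geometric_series; rewrite ger0_norm ?invr_ge0//; lra.
have -> : (fun n => u n x) = (fun n => u 0%N x + series (fun k => dd k x) n).
  by apply/funext => n; rewrite (eq_sum_telescope (fun n => u n x)).
by apply: is_cvgD => //; exact: is_cvg_cst.
Qed.

(** The upper limit is measurable everywhere and is the limit where there is
    one. *)
Lemma measurable_ae_limit u : (forall n, measurable_fun setT (u n)) ->
  {ae mu, forall x, cvgn (fun n => u n x)} ->
  exists f, measurable_fun setT f /\
    {ae mu, forall x, u n x @[n --> \oo] --> f x}.
Proof.
move=> mu_ cu; exists (fun x => fine (limn_esup (fun n => (u n x)%:E))); split.
  apply: measurableT_comp => //.
  apply: (@measurable_fun_limn_esup _ _ _ _ (fun n x => (u n x)%:E)) => n.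
  exact/measurable_EFinP.
apply: filterS cu => x cx.
suff /cvg_limn_einf_sup[_ ->] : (u n x)%:E @[n --> \oo] --> (limn (fun n => u n x))%:E by [].
by apply: cvg_EFin; [exact: nearW|exact: cx].
Qed.

Lemma fatou_sq u f g (e : R) : (forall n, L2 (u n)) -> measurable_fun setT f -> L2 g ->
  {ae mu, forall x, u n x @[n --> \oo] --> f x} ->
  (\forall n \near \oo, sq mu (fun x => u n x - g x) <= e) ->
  L2 (fun x => f x - g x) /\ sq mu (fun x => f x - g x) <= e.
Proof.
move=> lu mf lg uf ue.
have mg := L2_measurable lg.
have mfg : measurable_fun setT (fun x => f x - g x) by exact: measurable_funB.
have ld n : L2 (fun x => u n x - g x) by exact: L2B.
pose D n x := ((u n x - g x) * (u n x - g x))%:E.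
have mD n : measurable_fun setT (D n).
  by apply/measurable_EFinP; apply: measurable_funM; exact: L2_measurable.
have mF : measurable_fun setT (fun x => ((f x - g x) * (f x - g x))%:E).
  by apply/measurable_EFinP; exact: measurable_funM.
have D0 n x : setT x -> (0 <= D n x)%E by move=> _; rewrite lee_fin -expr2 sqr_ge0.
have h : (\int[mu]_x ((f x - g x) * (f x - g x))%:E <= e%:E)%E.
  have -> : (\int[mu]_x ((f x - g x) * (f x - g x))%:E = \int[mu]_x limn_einf (D ^~ x))%E.
    apply: ae_eq_integral => //.
    - apply: (eq_measurable_fun (fun x => - limn_esup (fun n => - D n x))%E).
        by move=> x _; rewrite -limn_einfN; congr limn_einf; apply/funext => n; exact: oppeK.
      apply: measurableT_comp => //.
      apply: (@measurable_fun_limn_esup _ _ _ _ (fun n x => - D n x)%E) => n.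
      by apply: measurableT_comp => //; exact: mD.
    - apply: filterS uf => x cx _ /=.
      have cD : D n x @[n --> \oo] --> ((f x - g x) * (f x - g x))%:E.
        apply: cvg_EFin; first by apply: nearW.
        have cb : (fun n => u n x - g x) @ \oo --> f x - g x.
          by apply: cvgB => //; exact: cvg_cst.
        by apply: cvgM.
      by have [-> _] := cvg_limn_einf_sup cD.
  apply: (le_trans (fatou mu measurableT mD D0)).
  rewrite limn_einf_lim; apply: lime_le; first exact: is_cvg_einfs.
  apply: filterS ue => n ue; apply: (@le_trans _ _ (sq mu (fun x => u n x - g x))%:E); last by rewrite lee_fin.
  by rewrite -sq_EFin//; apply: ereal_inf_lbound; exists n => //=.
have lfg : L2 (fun x => f x - g x).
  apply: L2P => //; apply/integrableP; split => //.
  apply: le_lt_trans (ltry e); apply: le_trans h.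
  by rewrite le_eqVlt; apply/orP; left; apply/eqP; apply: eq_integral => x _; rewrite gee0_abs// lee_fin -expr2 sqr_ge0.
by split => //; rewrite -lee_fin -sq_EFin.
Qed.

Definition cauchy2 u := forall e, 0 < e ->
  exists N, forall m n, (N <= m)%N -> (N <= n)%N -> sq mu (fun x => u m x - u n x) <= e.

(** A subsequence along which the differences are geometrically small converges
    almost everywhere, and Fatou's lemma turns the Cauchy bounds into bounds on
    the distance to its limit. *)
Lemma L2_complete u : (forall n, L2 (u n)) -> cauchy2 u ->
  exists f, L2 f /\ cvg2 mu u f.
Proof.
move=> lu cu.
have /choice[N hN] k : exists N, forall m n, (N <= m)%N -> (N <= n)%N ->
    sq mu (fun x => u m x - u n x) <= 8^-1 ^+ k.
  by apply: cu; rewrite exprn_gt0// invr_gt0.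
(* nondecreasing, above [N], and tending to infinity thanks to the term [k] *)
pose phi k := (k + \sum_(i < k.+1) N i)%N.
have Nphi k : (N k <= phi k)%N by rewrite /phi big_ord_recr /= addnA leq_addl.
have phiS k : (phi k <= phi k.+1)%N by rewrite /phi leq_add// [leqRHS]big_ord_recr /= leq_addr.
have [f [mf uf]] : exists f, measurable_fun setT f /\
    {ae mu, forall x, u (phi n) x @[n --> \oo] --> f x}.
  apply: measurable_ae_limit; first by move=> n; exact: L2_measurable.
  apply: ae_cvg_of_summable_differences => // k.
  by apply: hN; [exact: (leq_trans _ (phiS k))|exact: Nphi].
have key e n M : (forall m, (M <= m)%N -> sq mu (fun x => u m x - u n x) <= e) ->
    L2 (fun x => f x - u n x) /\ sq mu (fun x => f x - u n x) <= e.
  move=> hM; apply: (fatou_sq (u := fun k => u (phi k))) => //.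
  exists M => // k /= Mk; apply: hM; apply: (leq_trans Mk).
  by rewrite /phi leq_addr.
have lf : L2 f.
  have [N0 hN0] := cu 1 ltr01.
  have [lfu _] := key 1 N0 N0 (fun m Nm => hN0 m N0 Nm (leqnn _)).
  have -> : f = (fun x => (f x - u N0 x) + u N0 x) by apply/funext => x; rewrite subrK.
  exact: L2D.
exists f; split => //.
apply/cvgrPdist_le => e e0; have [N0 hN0] := cu e e0.
exists N0 => // n /= Nn; rewrite sub0r normrN ger0_norm ?sq_ge0//.
have [_] := key e n N0 (fun m Nm => hN0 m n Nm Nn).
by rewrite !sqB// (ipC mu f) => h; apply: le_trans h; lra.
Qed.

End Complete.

Section Limits.
Context d (T : measurableType d) (R : realType).
Variable mu : {measure set T -> \bar R}.
Implicit Types (f g h : T -> R) (u v : nat -> T -> R).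
Local Notation L2 f := (f \in Lfun mu 2%:E).

Lemma sqD_le f g : L2 f -> L2 g -> sq mu (fun x => f x + g x) <= 2 * sq mu f + 2 * sq mu g.
Proof.
by move=> lf lg; have := sq_ge0 mu (fun x => f x - g x); rewrite sqB// sqD//; lra.
Qed.

Lemma cvg2_squeeze u f v g : (forall n, sq mu (fun x => v n x - g x) <= sq mu (fun x => u n x - f x)) ->
  cvg2 mu u f -> cvg2 mu v g.
Proof.
move=> le; apply: (@squeeze_cvgr _ _ _ _ (fun=> 0)) => //; last exact: cvg_cst.
by apply: nearW => n; rewrite sq_ge0 le.
Qed.

Lemma cvg2D u v f g : (forall n, L2 (u n)) -> (forall n, L2 (v n)) -> L2 f -> L2 g ->
  cvg2 mu u f -> cvg2 mu v g -> cvg2 mu (fun n x => u n x + v n x) (fun x => f x + g x).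
Proof.
move=> lu lv lf lg uf vg.
apply: (@squeeze_cvgr _ _ _ _ (fun=> 0) (fun n => 2 * sq mu (fun x => u n x - f x)
   + 2 * sq mu (fun x => v n x - g x))).
- apply: nearW => n; rewrite sq_ge0/=.
  rewrite [X in sq mu X <= _](_ : _ = (fun x => (u n x - f x) + (v n x - g x))).
    by apply: sqD_le; exact: L2B.
  by apply/funext => x; ring.
- exact: cvg_cst.
- have -> : (0 : R) = 2 * 0 + 2 * 0 by ring.
  by apply: cvgD; exact: cvgMr.
Qed.

Lemma cvg2Z c u f : (forall n, L2 (u n)) -> L2 f ->
  cvg2 mu u f -> cvg2 mu (fun n x => c * u n x) (fun x => c * f x).
Proof.
move=> lu lf uf; rewrite /cvg2.
under eq_fun => n.
  rewrite [X in sq mu X](_ : _ = (fun x => c * (u n x - f x))); last first.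
    by apply/funext => x; ring.
  rewrite sqZ; last exact: L2B.
  over.
by rewrite -(mulr0 (c ^+ 2)); exact: cvgMr.
Qed.

Lemma cvg2B u v f g : (forall n, L2 (u n)) -> (forall n, L2 (v n)) -> L2 f -> L2 g ->
  cvg2 mu u f -> cvg2 mu v g -> cvg2 mu (fun n x => u n x - v n x) (fun x => f x - g x).
Proof.
move=> lu lv lf lg uf vg.
have E (a b : T -> R) : (fun x => a x - b x) = (fun x => a x + (-1) * b x).
  by apply/funext => x; rewrite mulN1r.
rewrite (E f g) (_ : (fun n x => u n x - v n x) = (fun n x => u n x + (-1) * v n x)).
  by apply: cvg2D => //; [move=> n|idtac|]; [exact: L2Z..|exact: cvg2Z].
by apply/funext => n; exact: E.
Qed.

Lemma cvg2_sq u f : (forall n, L2 (u n)) -> L2 f -> cvg2 mu u f ->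
  sq mu (u n) @[n --> \oo] --> sq mu f.
Proof. by move=> lu lf uf; exact: cvg2_ip. Qed.

Lemma cvg2_unique u f g : (forall n, L2 (u n)) -> L2 f -> L2 g ->
  cvg2 mu u f -> cvg2 mu u g -> {ae mu, forall x, f x = g x}.
Proof.
move=> lu lf lg uf ug.
have lfg := L2B lf lg.
have := cvg2_sq (fun n => L2B (lu n) (lu n)) lfg (cvg2B lu lu lf lg uf ug).
under eq_fun => n.
  rewrite sqB// (_ : _ + _ = 0); last by rewrite /sq; ring.
  over.
move/cvg_lim => /(_ (@Rhausdorff R)); rewrite lim_cst// => /esym h.
by apply: filterS (sq0_ae lfg h) => x /eqP; rewrite subr_eq0 => /eqP.
Qed.

Lemma cvg2_cauchy u f : (forall n, L2 (u n)) -> L2 f -> cvg2 mu u f -> cauchy2 mu u.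
Proof.
move=> lu lf uf e e0; have e4 : 0 < e / 4 by rewrite divr_gt0.
have /cvgrPdist_le/(_ _ e4)[N _ hN] := uf.
exists N => m n Nm Nn.
have {}hN k : (N <= k)%N -> sq mu (fun x => u k x - f x) <= e / 4.
  by move=> /hN /=; rewrite sub0r normrN ger0_norm// sq_ge0.
rewrite [X in sq mu X <= _](_ : _ = (fun x => (u m x - f x) + (-1) * (u n x - f x))); last first.
  by apply/funext => x; ring.
apply: le_trans (sqD_le _ _) _; [exact: L2B|by apply: L2Z; exact: L2B|].
rewrite sqZ; last exact: L2B.
by have := hN m Nm; have := hN n Nn; lra.
Qed.

Lemma cvg2_ae u f g : (forall n, L2 (u n)) -> L2 f -> L2 g ->
  {ae mu, forall x, f x = g x} -> cvg2 mu u f -> cvg2 mu u g.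
Proof.
move=> lu lf lg fg; apply: cvg2_squeeze => n; rewrite le_eqVlt; apply/orP; left; apply/eqP.
by apply: ae_eq_sq; [exact: L2B..|apply: filterS fg => x ->].
Qed.

End Limits.

(** * A low-frequency weight with an explicit transform *)

Section Reflection.
Context {R : realType}.
Local Notation leb := (@lebesgue_measure R).
Local Open Scope ereal_scope.

(** The map [x |-> s - x] preserves the length of intervals, hence Lebesgue
    measure. It serves for the reflection ([s = 0]) as well as for convolution
    kernels [x - y]. *)
Lemma integral_reflect (s : R) (f : R -> \bar R) :
  measurable_fun setT f -> (forall x, 0 <= f x) ->
  \int[leb]_x f (s - x)%R = \int[leb]_x f x.
Proof.
move=> mf f0.
have mr : measurable_fun setT ((fun x => s - x)%R : measurableTypeR R -> measurableTypeR R).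
  by apply: measurable_funB => //.
rewrite -[LHS]/(\int[leb]_(x in ((fun x => s - x)%R : measurableTypeR R -> measurableTypeR R) @^-1` setT) (f \o ((fun x => s - x)%R : measurableTypeR R -> measurableTypeR R)) x).
rewrite -(ge0_integral_pushforward mr leb)//.
apply: eq_measure_integral => A mA _; apply/esym/lebesgue_measure_unique => //.
move=> _ [[a b]] _ <-.
rewrite [LHS]lebesgue_measure_itv/= /pushforward /=.
have -> : (fun x => s - x)%R @^-1` `]a, b] = `[(s - b)%R, (s - a)%R[%classic.
  by apply/seteqP; split => x /=; rewrite !in_itv/= => /andP[? ?]; apply/andP; split; lra.
rewrite lebesgue_measure_itv/= !lte_fin -!EFinB.
have -> : (s - b < s - a = (a < b))%R by apply/idP/idP; lra.
by case: ifP => // _; congr EFin; ring.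
Qed.
End Reflection.

Section Laplace.
Context {R : realType}.
Local Notation leb := (@lebesgue_measure R).
Implicit Types c z x : R.

Lemma cvgy_expRN c : 0 < c -> expR (- (c * x)) @[x --> +oo] --> (0 : R).
Proof.
move=> c0.
apply: (@cvg_comp _ _ _ (fun x => c * x) (fun y => expR (- y)) _ (pinfty_nbhs R)); last exact: cvgr_expR.
exact: gt0_cvgMry.
Qed.

(* an antiderivative of [expcos] on the positive half-line *)
Let F c z x : R := expR (- (c * x)) *
  (z / (c ^+ 2 + z ^+ 2) * sin (z * x) - c / (c ^+ 2 + z ^+ 2) * cos (z * x) - c^-1).

Let dF c z x : 0 < c -> is_derive x 1 (F c z) (expR (- (c * x)) * (1 + cos (z * x))).
Proof.
move=> c0.
have cn : c != 0 by exact: lt0r_neq0.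
have cz : c ^+ 2 + z ^+ 2 != 0.
  by rewrite lt0r_neq0// ltr_wpDr ?sqr_ge0// exprn_gt0.
rewrite /F; apply: is_derive_eq.
rewrite /GRing.scale /=.
by field; rewrite cn.
Qed.

Let cF c z : 0 < c -> continuous (F c z).
Proof. by move=> c0 x; apply/differentiable_continuous/derivable1_diffP; exact: (@ex_derive _ _ _ _ _ _ _ (dF z x c0)). Qed.

Let F0 c z : F c z 0 = - (c / (c ^+ 2 + z ^+ 2) + c^-1).
Proof. by rewrite /F !mulr0 oppr0 expR0 sin0 cos0; ring. Qed.

Let Fy c z : 0 < c -> F c z x @[x --> +oo] --> (0 : R).
Proof.
move=> c0.
set M := `|z / (c ^+ 2 + z ^+ 2)| + `|c / (c ^+ 2 + z ^+ 2)| + `|c^-1|.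
apply/norm_cvg0P.
apply: (@squeeze_cvgr _ _ _ _ (fun=> 0) (fun x => expR (- (c * x)) * M)).
- apply: nearW => x; rewrite normr_ge0 normrM ger0_norm ?expR_ge0//= ler_wpM2l ?expR_ge0//.
  apply: le_trans (ler_normB _ _) _; rewrite lerD2r.
  apply: le_trans (ler_normB _ _) _; rewrite !normrM lerD//.
    by rewrite -[leRHS]mulr1 ler_wpM2l ?mulr_ge0// ler_norml sin_geN1 sin_le1.
  by rewrite -[leRHS]mulr1 ler_wpM2l ?mulr_ge0// ler_norml cos_geN1 cos_le1.
- exact: cvg_cst.
- by rewrite -(mul0r M); apply: cvgMl; exact: cvgy_expRN.
Qed.

(** The summand [1] makes the Laplace integrand nonnegative, so that its integral
    over a half-line can be read off an antiderivative without knowing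
    integrability beforehand. *)
Definition expcos c z x := expR (- (c * `|x|)) * (1 + cos (z * x)).

Lemma expcos_ge0 c z x : 0 <= expcos c z x.
Proof. by rewrite mulr_ge0 ?expR_ge0// -lerBlDl sub0r cos_geN1. Qed.

Lemma continuous_expcos c z : continuous (expcos c z).
Proof.
move=> x; apply: cvgM.
  apply: continuous_comp; last exact: continuous_expR.
  by apply: cvgN; apply: cvgMr; exact: norm_continuous.
apply: cvgD; first exact: cvg_cst.
apply: continuous_comp; last exact: continuous_cos.
by apply: cvgMr; exact: cvg_id.
Qed.

Lemma integral_expcos c z : 0 < c ->
  (\int[leb]_x (expcos c z x)%:E = (2 * (c / (c ^+ 2 + z ^+ 2) + c^-1))%:E)%E.
Proof.
move=> c0; rewrite ge0_symfun_integralT.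
- rewrite -set_itvcy (@ge0_continuous_FTC2y _ _ (F c z) _ 0).
  + by rewrite F0 sub0e EFinN oppeK.
  + by move=> x _; exact: expcos_ge0.
  + by apply: continuous_subspaceT; exact: continuous_expcos.
  + exact: Fy.
  + by move=> x _; exact: (@ex_derive _ _ _ _ _ _ _ (dF z x c0)).
  + by apply: cvg_at_right_filter; exact: cF.
  + move=> x; rewrite in_itv/= andbT => x0.
    by rewrite derive1E (@derive_val _ _ _ _ _ _ _ (dF z x c0)) /expcos gtr0_norm.
- exact: expcos_ge0.
- exact: continuous_expcos.
- by move=> x; rewrite /expcos /= normrN mulrN cosN.
Qed.

End Laplace.

Section Kernel.
Context {R : realType}.
Local Notation leb := (@lebesgue_measure R).
Implicit Types (a c z x dlt : R).

Let e c x : R := expR (- (c * `|x|)).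

Let e_ge0 c x : 0 <= e c x. Proof. exact: expR_ge0. Qed.

Let ce c : continuous (e c).
Proof.
move=> x; apply: continuous_comp; last exact: continuous_expR.
by apply: cvgN; apply: cvgMr; exact: norm_continuous.
Qed.

Let me c : measurable_fun setT (e c).
Proof. exact: continuous_measurable_fun. Qed.

Let mtrig (f : R -> R) z : continuous f -> measurable_fun setT (fun x : R => f (z * x)).
Proof.
move=> cf; apply: continuous_measurable_fun => x; apply: continuous_comp; last exact: cf.
by apply: cvgMr; exact: cvg_id.
Qed.

Let ie c : 0 < c -> leb.-integrable setT (EFin \o e c).
Proof.
move=> c0; apply/integrableP; split.
  apply/measurable_EFinP. exact: me.
apply: (@le_lt_trans _ _ (\int[leb]_x (expcos c 0 x)%:E)%E); last first.
  by rewrite integral_expcos// ltry.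
apply: ge0_le_integral => //=.
- by apply/measurable_EFinP; apply: measurableT_comp; [|exact: me].
- by apply/measurable_EFinP; apply: continuous_measurable_fun; exact: continuous_expcos.
- move=> x _; rewrite lee_fin /expcos mul0r cos0 ger0_norm ?e_ge0//.
  by rewrite -[leLHS]mulr1 ler_wpM2l ?e_ge0//; lra.
Qed.

Let ief c (f : R -> R) z : 0 < c -> continuous f -> (forall x, `|f x| <= 1) ->
  leb.-integrable setT (fun x => (e c x * f (z * x))%:E).
Proof.
move=> c0 cf f1; apply: le_integrable (ie c0) => //.
  by apply/measurable_EFinP; apply: measurable_funM; [exact: me|exact: mtrig].
move=> x _; rewrite lee_fin /= normrM -[leRHS]mulr1 ler_wpM2l//.
Qed.

Lemma normr_cos_le1 x : `|cos x| <= 1. Proof. by rewrite ler_norml cos_geN1 cos_le1. Qed.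
Lemma normr_sin_le1 x : `|sin x| <= 1. Proof. by rewrite ler_norml sin_geN1 sin_le1. Qed.

Let iecos c z : 0 < c -> leb.-integrable setT (fun x => (e c x * cos (z * x))%:E).
Proof. by move=> c0; apply: ief => //; [exact: continuous_cos|exact: normr_cos_le1]. Qed.
Let iesin c z : 0 < c -> leb.-integrable setT (fun x => (e c x * sin (z * x))%:E).
Proof. by move=> c0; apply: ief => //; [exact: continuous_sin|exact: normr_sin_le1]. Qed.

Let Ie c : 0 < c -> \int[leb]_x e c x = 2 / c.
Proof.
move=> c0; have := integral_expcos 0 c0.
have -> : (\int[leb]_x (expcos c 0 x)%:E = \int[leb]_x (2%:E * (e c x)%:E))%E.
  by apply: eq_integral => x _; rewrite -EFinM /expcos mul0r cos0; congr EFin; rewrite mulrC; congr (_ * _); lra.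
rewrite ge0_integralZl_EFin//; last 2 first.
  by move=> x _; rewrite lee_fin.
  by apply/measurable_EFinP; exact: me.
have := integrable_fin_num measurableT (ie c0); rewrite /Rintegral.
case: (\int[leb]_x _)%E => // r _ /= [] h.
have cn := lt0r_neq0 c0.
have -> : r = c / (c ^+ 2 + 0 ^+ 2) + c^-1 by apply: (@mulfI _ 2); rewrite ?h.
by rewrite expr0n addr0; field.
Qed.

Let Iecos c z : 0 < c -> \int[leb]_x (e c x * cos (z * x)) = 2 * c / (c ^+ 2 + z ^+ 2).
Proof.
move=> c0; have cn := lt0r_neq0 c0.
have cz : c ^+ 2 + z ^+ 2 != 0.
  by rewrite lt0r_neq0// ltr_wpDr ?sqr_ge0// exprn_gt0.
have : \int[leb]_x (e c x + e c x * cos (z * x)) = 2 * (c / (c ^+ 2 + z ^+ 2) + c^-1).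
  rewrite /Rintegral -[RHS]/(fine (_%:E)) -(integral_expcos z c0); congr fine.
  by apply: eq_integral => x _; rewrite /expcos mulrDr mulr1.
rewrite RintegralD//; [|exact: ie|exact: iecos].
rewrite Ie// => h; have -> : \int[leb]_x (e c x * cos (z * x)) = 2 * (c / (c ^+ 2 + z ^+ 2) + c^-1) - 2 / c.
  by rewrite -h addrAC subrr add0r.
by field; rewrite cz.
Qed.

Let Iesin c z : 0 < c -> \int[leb]_x (e c x * sin (z * x)) = 0.
Proof.
move=> c0; have aux (r s : R) : r + s = r - s -> s = 0 by lra.
pose f x := e c x * (1 + sin (z * x)).
have f0 x : (0 <= (f x)%:E)%E by rewrite lee_fin mulr_ge0// -lerBlDl sub0r sin_geN1.
have mf : measurable_fun setT (fun x => (f x)%:E).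
  apply/measurable_EFinP; apply: measurable_funM; first exact: me.
  apply: measurable_funD => //.
  by apply: mtrig; exact: continuous_sin.
have Rf : \int[leb]_x f x = \int[leb]_x e c x + \int[leb]_x (e c x * sin (z * x)).
  rewrite -RintegralD//; [|exact: ie|exact: iesin].
  by apply: eq_Rintegral => x _; rewrite /f mulrDr mulr1.
have Rf' : \int[leb]_x f x = \int[leb]_x e c x - \int[leb]_x (e c x * sin (z * x)).
  rewrite -RintegralB//; [|exact: ie|exact: iesin].
  rewrite /Rintegral -(integral_reflect 0 mf f0); congr fine.
  by apply: eq_integral => x _; rewrite /f /e sub0r normrN mulrN sinN; congr EFin; ring.
exact: (aux _ _ (etrans (esym Rf) Rf')).
Qed.

(** With [q = expR (- a `|x|)] this is [2 q - q ^+ 2 = 1 - (1 - q) ^+ 2], which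
    differs from [1] by a quadratic term near the origin: [q] alone would
    differ by a linear one and would restrict the orders [s] in [onem_wt_le] to
    [s <= 1 / 2]. Its transform is still a combination of two Poisson kernels. *)
Definition wt a x : R := 2 * expR (- (a * `|x|)) - expR (- (2 * a * `|x|)).

Lemma wtE a x : wt a x = 1 - (1 - expR (- (a * `|x|))) ^+ 2.
Proof.
rewrite /wt.
have -> : - (2 * a * `|x|) = - (a * `|x|) + - (a * `|x|) by ring.
by rewrite expRD; ring.
Qed.

Lemma wt_itv a x : 0 < a -> 0 <= wt a x <= 1.
Proof.
move=> a0; rewrite wtE.
have : 0 <= expR (- (a * `|x|)) by exact: expR_ge0.
have : expR (- (a * `|x|)) <= 1 by rewrite -expR0 ler_expR oppr_le0 mulr_ge0// ltW.
by move: (expR _) => q q1 q0; apply/andP; split; nra.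
Qed.

(** For small [y = a |x|] the left side is of order [y ^ 2], which is at most
    [y ^ (2 s)] because [s <= 1]; for [1 <= y] the right side is at least [1]. *)
Lemma onem_wt_le a x (s : R) : 0 < a -> 0 < s <= 1 -> 1 - wt a x <= (a * `|x|) `^ (2 * s).
Proof.
move=> a0 /andP[s0 s1]; rewrite wtE subKr.
set y := a * `|x|; have y0 : 0 <= y by rewrite mulr_ge0// ltW.
have q0 : 0 <= 1 - expR (- y) by rewrite subr_ge0 -expR0 ler_expR oppr_le0.
have q1 : 1 - expR (- y) <= 1 by rewrite gerBl expR_ge0.
have qy : 1 - expR (- y) <= y by have := expR_ge1Dx (- y); lra.
have [y1|y1] := leP 1 y.
  apply: (@le_trans _ _ 1); first by rewrite expr_le1.
  by rewrite -[leLHS](powRr0 y); apply: ler_powR => //; apply: mulr_ge0; lra.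
have [->|yn] := eqVneq y 0.
  by rewrite oppr0 expR0 subrr expr0n/= powR_ge0.
apply: (@le_trans _ _ (y ^+ 2)); first by rewrite lerXn2r// nnegrE.
rewrite -powR_mulrn//; apply: ger_powR; last lra.
by rewrite lt_neqAle eq_sym yn y0 ltW.
Qed.

Lemma continuous_wt a : continuous (wt a).
Proof. by move=> x; apply: cvgB; [apply: cvgMr|]; exact: ce. Qed.

Lemma measurable_wt a : measurable_fun setT (wt a).
Proof. by apply: continuous_measurable_fun; exact: continuous_wt. Qed.

Let wt_e a x : wt a x = 2 * e a x - e (2 * a) x. Proof. by []. Qed.

Lemma integrable_wt a : 0 < a -> leb.-integrable setT (EFin \o wt a).
Proof.
move=> a0; have a2 : 0 < 2 * a by rewrite mulr_gt0.
rewrite (_ : EFin \o wt a = (fun x => 2%:E * (e a x)%:E - (e (2 * a) x)%:E)%E) //.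
by apply: integrableB => //; [apply: integrableZl => //|]; exact: ie.
Qed.

Let Iwtf a (f : R -> R) z : 0 < a -> continuous f -> (forall x, `|f x| <= 1) ->
  \int[leb]_x (wt a x * f (z * x)) =
  2 * (\int[leb]_x (e a x * f (z * x))) - \int[leb]_x (e (2 * a) x * f (z * x)).
Proof.
move=> a0 cf f1; have a2 : 0 < 2 * a by rewrite mulr_gt0.
have i1 := ief z a0 cf f1; have i2 := ief z a2 cf f1.
rewrite -RintegralZl// -RintegralB//; last by apply: integrableZl i1.
by apply: eq_Rintegral => x _; rewrite wt_e; ring.
Qed.

(** The cosine transform of [wt a], see [integral_wt_cos]. *)
Definition kern a z : R := 4 * a / (a ^+ 2 + z ^+ 2) - 4 * a / ((2 * a) ^+ 2 + z ^+ 2).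

Lemma integral_wt_cos a z : 0 < a -> \int[leb]_x (wt a x * cos (z * x)) = kern a z.
Proof.
move=> a0; have a2 : 0 < 2 * a by rewrite mulr_gt0.
rewrite Iwtf//; [|exact: continuous_cos|exact: normr_cos_le1].
by rewrite !Iecos// /kern; congr (_ - _); ring.
Qed.

(** The weight is even. *)
Lemma integral_wt_sin a z : 0 < a -> \int[leb]_x (wt a x * sin (z * x)) = 0.
Proof.
move=> a0; have a2 : 0 < 2 * a by rewrite mulr_gt0.
rewrite Iwtf//; [|exact: continuous_sin|exact: normr_sin_le1].
by rewrite !Iesin// mulr0 subrr.
Qed.

Lemma kernN a z : kern a (- z) = kern a z.
Proof. by rewrite /kern sqrrN. Qed.

Let den_neq0 c z : 0 < c -> c ^+ 2 + z ^+ 2 != 0.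
Proof. by move=> c0; rewrite lt0r_neq0// ltr_wpDr ?sqr_ge0// exprn_gt0. Qed.

(** Reducing to a common denominator gives
    [12 a ^ 3 / ((a ^ 2 + z ^ 2) (4 a ^ 2 + z ^ 2))], largest at [z = 0]. *)
Lemma kern_itv a z : 0 < a -> 0 <= kern a z <= 3 / a.
Proof.
move=> a0; have a2 : 0 < 2 * a by rewrite mulr_gt0.
have d1 := den_neq0 z a0; have d2 := den_neq0 z a2; have an := lt0r_neq0 a0.
have E : kern a z = 12 * a ^+ 3 / ((a ^+ 2 + z ^+ 2) * ((2 * a) ^+ 2 + z ^+ 2)).
  by rewrite /kern; field; rewrite d1 d2.
have z0 := sqr_ge0 z.
have D0 : 0 < (a ^+ 2 + z ^+ 2) * ((2 * a) ^+ 2 + z ^+ 2).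
  by rewrite mulr_gt0// ltr_wpDr ?sqr_ge0// exprn_gt0.
rewrite E; apply/andP; split.
  by rewrite divr_ge0 ?(ltW D0)// mulr_ge0// exprn_ge0// ltW.
rewrite ler_pdivrMr// mulrAC ler_pdivlMr//.
rewrite -subr_ge0.
have -> : 3 * ((a ^+ 2 + z ^+ 2) * ((2 * a) ^+ 2 + z ^+ 2)) - 12 * a ^+ 3 * a =
  15 * (a ^+ 2 * z ^+ 2) + 3 * (z ^+ 2 * z ^+ 2) by ring.
by rewrite addr_ge0// mulr_ge0// mulr_ge0 ?sqr_ge0.
Qed.

(* an antiderivative of [kern a] *)
Let G a z : R := 4 * atan (a^-1 * z) - 2 * atan ((2 * a)^-1 * z).

Let dG a z : 0 < a -> is_derive z 1 (G a) (kern a z).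
Proof.
move=> a0; have a2 : 0 < 2 * a by rewrite mulr_gt0.
have d1 := den_neq0 z a0; have d2 := den_neq0 z a2; have an := lt0r_neq0 a0.
rewrite /G; apply: is_derive_eq.
rewrite /GRing.scale /= /kern.
by field; rewrite d1 d2.
Qed.

Let derivG a z : 0 < a -> derivable (G a) z 1.
Proof. by move=> a0; exact: (@ex_derive _ _ _ _ _ _ _ (dG z a0)). Qed.

Let G_continuous a : 0 < a -> continuous (G a).
Proof. by move=> a0 x; apply/differentiable_continuous/derivable1_diffP; exact: derivG. Qed.

Lemma continuous_kern a : 0 < a -> continuous (kern a).
Proof.
move=> a0 z; have a2 : 0 < 2 * a by rewrite mulr_gt0.
have c2 c : 0 < c -> 4 * a / (c ^+ 2 + x ^+ 2) @[x --> z] --> 4 * a / (c ^+ 2 + z ^+ 2).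
  move=> c0; apply: cvgMr; apply: cvgV; first exact: den_neq0.
  by apply: cvgD; [exact: cvg_cst|exact: exprn_continuous].
by apply: cvgB; exact: c2.
Qed.

Lemma measurable_kern a : 0 < a -> measurable_fun setT (kern a).
Proof. by move=> a0; apply: continuous_measurable_fun; exact: continuous_kern. Qed.

Let kern_ge0 a z : 0 < a -> 0 <= kern a z.
Proof. by move=> /kern_itv-/(_ z)/andP[]. Qed.

Lemma integral_kern a : 0 < a -> (\int[leb]_z (kern a z)%:E = (2 * pi)%:E)%E.
Proof.
move=> a0; rewrite ge0_symfun_integralT.
- have yc c : 0 < c -> atan (c * z) @[z --> +oo] --> (pi / 2 : R).
    move=> c0; apply: (@cvg_comp _ _ _ (fun z => c * z) (@atan R) _ (pinfty_nbhs R)); last exact: cvgy_atan.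
    exact: gt0_cvgMry.
  rewrite -set_itvcy (@ge0_continuous_FTC2y _ _ (G a) _ (4 * (pi / 2) - 2 * (pi / 2))).
  + rewrite /G !mulr0 atan0 !mulr0 subrr sube0 -EFinM; congr EFin; lra.
  + by move=> x _; exact: kern_ge0.
  + by apply: continuous_subspaceT; exact: continuous_kern.
  + by apply: cvgB; apply: cvgMr; apply: yc; rewrite invr_gt0// mulr_gt0.
  + by move=> x _; exact: derivG.
  + by apply: cvg_at_right_filter; exact: G_continuous.
  + by move=> x _; rewrite derive1E (@derive_val _ _ _ _ _ _ _ (dG x a0)).
- by move=> x; exact: kern_ge0.
- exact: continuous_kern.
- by move=> x; rewrite /= kernN.
Qed.

Lemma integral_kern_shift a x : 0 < a -> (\int[leb]_y (kern a (x - y))%:E = (2 * pi)%:E)%E.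
Proof.
move=> a0; rewrite -(integral_kern a0) -(@integral_reflect _ x (EFin \o kern a))//.
  by apply/measurable_EFinP; exact: measurable_kern.
by move=> y; rewrite lee_fin kern_ge0.
Qed.

(** The mass of [kern a] on [[- dlt, dlt]], see [integral_kern_itv]. *)
Definition kern_mass a dlt : R := 2 * (4 * atan (a^-1 * dlt) - 2 * atan ((2 * a)^-1 * dlt)).

Lemma integral_kern_itv a dlt : 0 < a -> 0 < dlt ->
  (\int[leb]_(z in `[(- dlt)%R, dlt]) (kern a z)%:E = (kern_mass a dlt)%:E)%E.
Proof.
move=> a0 d0; rewrite (@continuous_FTC2 _ _ (G a)).
- by rewrite -EFinB /G !mulrN !atanN /kern_mass; congr EFin; ring.
- lra.
- by apply: continuous_subspaceT; exact: continuous_kern.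
- split.
  + by move=> x _; exact: derivG.
  + by apply: cvg_at_right_filter; exact: G_continuous.
  + by apply: cvg_at_left_filter; exact: G_continuous.
- by move=> x _; rewrite derive1E (@derive_val _ _ _ _ _ _ _ (dG x a0)).
Qed.

(** As its width tends to [0], the kernel becomes a Dirac mass of weight [2 pi]:
    this is what makes the bound of the transform sharp on rectangles. *)
Lemma cvg_kern_mass dlt : 0 < dlt -> kern_mass (n.+1%:R^-1) dlt @[n --> \oo] --> 2 * pi.
Proof.
move=> d0; rewrite /kern_mass.
have yc c : 0 < c -> atan (c * n.+1%:R) @[n --> \oo] --> (pi / 2 : R).
  move=> c0; apply: (@cvg_comp _ _ _ (fun n => c * n.+1%:R) (@atan R) _ (pinfty_nbhs R)); last exact: cvgy_atan.
  apply: (@cvg_comp _ _ _ (fun n => n.+1%:R) (fun x => c * x) _ (pinfty_nbhs R)); last exact: gt0_cvgMry.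
  apply/cvgryPge => A; near=> n; rewrite (@le_trans _ _ n%:R)// ?ler_nat//.
  by near: n; exact: nbhs_infty_ger.
have -> : 2 * pi = 2 * (4 * (pi / 2) - 2 * (pi / 2)) :> R by lra.
apply: cvgMr; apply: cvgB; apply: cvgMr.
  by under eq_fun do rewrite invrK mulrC; exact: yc.
under eq_fun do rewrite invfM invrK mulrC mulrA; apply: yc.
by rewrite divr_gt0.
Unshelve. all: by end_near. Qed.

(** Translating [x] to the origin turns the [dlt]-neighbourhood of [x] into
    [[- dlt, dlt]]. *)
Lemma kern_mass_le a dlt x (I : set R) : 0 < a -> 0 < dlt -> measurable I ->
  `[x - dlt, x + dlt] `<=` I ->
  ((kern_mass a dlt)%:E <= \int[leb]_(y in I) (kern a (x - y))%:E)%E.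
Proof.
move=> a0 d0 mI xI.
have k0 y : (0 <= (kern a y)%:E)%E by rewrite lee_fin kern_ge0.
have mk : measurable_fun setT (fun y : R => (kern a y)%:E).
  by apply/measurable_EFinP; exact: measurable_kern.
have mks : measurable_fun setT (fun y : R => (kern a (x - y))%:E).
  apply/measurable_EFinP; apply: (measurableT_comp (measurable_kern a0)).
  exact: measurable_funB.
apply: (@le_trans _ _ (\int[leb]_(y in `[(x - dlt)%R, (x + dlt)%R]) (kern a (x - y))%:E)%E); last first.
  by apply: ge0_subset_integral => //; apply: measurable_funTS.
rewrite -integral_kern_itv// integral_mkcond [leRHS]integral_mkcond.
rewrite -(@integral_reflect _ x ((fun z => (kern a z)%:E) \_ `[- dlt, dlt])).
- rewrite le_eqVlt; apply/orP; left; apply/eqP; apply: eq_integral => y _.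
  rewrite !patchE !mem_setE !in_itv/=.
  by have -> : (- dlt <= x - y <= dlt) = (x - dlt <= y <= x + dlt) by apply/idP/idP => /andP[? ?]; apply/andP; split; lra.
- by apply/(measurable_restrictT _ _).1 => //; apply: measurable_funTS.
- by move=> y; rewrite patchE; case: ifP.
Qed.

End Kernel.

(** * Integration on the plane *)

Section ProductIntegral.
Context d1 d2 (T1 : measurableType d1) (T2 : measurableType d2) (R : realType).
Variables (m1 : {sigma_finite_measure set T1 -> \bar R})
  (m2 : {sigma_finite_measure set T2 -> \bar R}).
Implicit Types (f : T1 -> R) (g : T2 -> R).

(** Tonelli for the absolute value, with [M] taken out of both integrals. *)
Lemma integrable_prod_mul f g (k : T1 * T2 -> R) (M : R) :
  m1.-integrable setT (EFin \o f) -> m2.-integrable setT (EFin \o g) ->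
  measurable_fun setT k -> (forall z, `|k z| <= M) ->
  (m1 \x m2)%E.-integrable setT (fun z => (f z.1 * g z.2 * k z)%:E).
Proof.
move=> intf intg mk kM.
have mf : measurable_fun setT f by apply/measurable_EFinP; exact: measurable_int intf.
have mg : measurable_fun setT g by apply/measurable_EFinP; exact: measurable_int intg.
have mF : measurable_fun setT (fun z : T1 * T2 => (f z.1 * g z.2 * k z)%:E).
  apply/measurable_EFinP; apply: measurable_funM => //; apply: measurable_funM.
    exact: (measurableT_comp mf).
  exact: (measurableT_comp mg).
have /integrableP[_ If] := intf; have /integrableP[_ Ig] := intg.
apply/(integrable12ltyP _ _ mF) => /=.
have [[z _]|no] := pselect (exists z : T1 * T2, True); last first.
  rewrite [X in (X < _)%E](_ : _ = 0%E) ?ltry//; apply: integral0_eq => x _.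
  by apply: integral0_eq => y _; exfalso; apply: no; exists (x, y).
have M0 : 0 <= M by apply: le_trans (kM z).
set G := (\int[m2]_y `|(g y)%:E|)%E.
have G0 : (0 <= G)%E by exact: integral_ge0.
have Gf : G \is a fin_num by rewrite ge0_fin_numE.
apply: (@le_lt_trans _ _ (\int[m1]_x (`|(f x)%:E| * (G * M%:E)))%E); last first.
  rewrite ge0_integralZr//; last 2 first.
    by apply: measurableT_comp => //; exact/measurable_EFinP.
    by rewrite mule_ge0// lee_fin.
  by apply: lte_mul_pinfty => //; [exact: integral_ge0|rewrite ge0_fin_numE//; exact: integral_ge0|rewrite -(fineK Gf) -EFinM ltry].
apply: ge0_le_integral => //=.
- by move=> x _; apply: integral_ge0 => y _; rewrite lee_fin.
- apply: (measurable_fun_fubini_tonelli_F (fun z => `|f z.1 * g z.2 * k z|%:E)) => //.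
  apply/measurable_EFinP; apply: measurableT_comp => //; exact/measurable_EFinP.
- apply: emeasurable_funM => //; apply/measurable_EFinP; exact: measurableT_comp.
- move=> x _; rewrite muleC -muleA.
  apply: (@le_trans _ _ (\int[m2]_y (`|(g y)%:E| * (M * `|f x|)%:E))%E).
    apply: ge0_le_integral => //=.
    + apply/measurable_EFinP; apply: measurableT_comp => //; apply: measurable_funM => //.
        by apply: measurable_funM.
      exact: (measurableT_comp mk (pair1_measurable x)).
    + apply: emeasurable_funM => //; apply/measurable_EFinP; exact: measurableT_comp.
    + move=> y _; rewrite lee_fin !normrM.
      rewrite [leRHS](_ : _ = `|f x| * `|g y| * M); last by ring.
      by rewrite ler_wpM2l.
  rewrite ge0_integralZr//.
  - by apply/measurable_EFinP; exact: measurableT_comp.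
  - by rewrite lee_fin mulr_ge0.
Qed.

Lemma Rintegral_prod f g :
  m1.-integrable setT (EFin \o f) -> m2.-integrable setT (EFin \o g) ->
  \int[(m1 \x m2)%E]_z (f z.1 * g z.2) = (\int[m1]_x f x) * (\int[m2]_y g y).
Proof.
move=> intf intg.
have iF : (m1 \x m2)%E.-integrable setT (fun z => (f z.1 * g z.2)%:E).
  have := @integrable_prod_mul f g (fun=> 1) 1 intf intg.
  rewrite (_ : (fun z => _) = (fun z => (f z.1 * g z.2)%:E)); last first.
    by apply/funext => z; rewrite mulr1.
  by apply => // z; rewrite normr1.
rewrite /Rintegral -integral12_prod_meas1//= -[in RHS]fineM; last 2 first.
- exact: integrable_fin_num.
- exact: integrable_fin_num.
congr fine; rewrite -(fineK (integrable_fin_num measurableT intg)).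
rewrite -integralZr//; apply: eq_integral => x _.
rewrite (fineK (integrable_fin_num measurableT intg)) /fubini_F/=.
by under eq_integral do rewrite EFinM; rewrite integralZl.
Qed.

Lemma Rintegral_swap (F : T1 * T2 -> R) :
  (m1 \x m2)%E.-integrable setT (EFin \o F) ->
  (forall x, m2.-integrable setT (fun y => (F (x, y))%:E)) ->
  (forall y, m1.-integrable setT (fun x => (F (x, y))%:E)) ->
  \int[m1]_x \int[m2]_y F (x, y) = \int[m2]_y \int[m1]_x F (x, y).
Proof.
move=> iF i1 i2; rewrite /Rintegral; congr fine.
transitivity (\int[m1]_x \int[m2]_y (F (x, y))%:E)%E.
  by apply: eq_integral => x _; rewrite fineK//; exact: integrable_fin_num.
rewrite (Fubini iF); apply: eq_integral => y _.
by rewrite fineK//; exact: integrable_fin_num.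
Qed.

End ProductIntegral.

(** The product measure under a name of its own, which carries its structure of
    sigma-finite measure. *)
Definition leb2 {R : realType} : set (measurableTypeR R * measurableTypeR R) -> \bar R :=
  (@lebesgue_measure R \x @lebesgue_measure R)%E.
HB.instance Definition _ (R : realType) := Measure.on (@leb2 R).

Lemma leb2_sigma_finite (R : realType) : sigma_finite setT (@leb2 R).
Proof.
have /sigma_finiteP[F [TF ndF Foo]] := sigma_finiteT (@lebesgue_measure R).
exists (fun n => F n `*` F n).
  rewrite -setXTT TF predeqE => -[x y]; split.
    move=> [/= [n _ Fnx] [k _ Gky]]; exists (maxn n k) => //; split.
    - by move: x Fnx; exact/subsetPset/ndF/leq_maxl.
    - by move: y Gky; exact/subsetPset/ndF/leq_maxr.
  by move=> [n _ []/= ? ?]; split; exists n.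
move=> k; have [? ?] := Foo k.
split; first exact: measurableX.
by rewrite /leb2 product_measure1E// lte_mul_pinfty// ge0_fin_numE.
Qed.
HB.instance Definition _ (R : realType) := 
  Measure_isSigmaFinite.Build _ _ _ (@leb2 R) (@leb2_sigma_finite R).

Section PlaneMeasure.
Context {R : realType}.
Local Notation leb := (@lebesgue_measure R).
Implicit Types f g : measurableTypeR R -> R.

Lemma integrable_leb2_mul f g :
  leb.-integrable setT (EFin \o f) -> leb.-integrable setT (EFin \o g) ->
  (@leb2 R).-integrable setT (fun z => (f z.1 * g z.2)%:E).
Proof.
move=> intf intg.
have := integrable_prod_mul intf intg (@measurable_cst _ _ _ _ setT (1 : R)) (M := 1).
move=> /(_ (fun=> ltac:(rewrite normr1; exact: lexx))).
by apply: eq_integrable => // z _; rewrite mulr1.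
Qed.

Lemma Rintegral_leb2_mul f g :
  leb.-integrable setT (EFin \o f) -> leb.-integrable setT (EFin \o g) ->
  \int[@leb2 R]_z (f z.1 * g z.2) = (\int[leb]_x f x) * (\int[leb]_y g y).
Proof. exact: Rintegral_prod. Qed.

Lemma integral_leb2 (F : measurableTypeR R * measurableTypeR R -> \bar R) :
  measurable_fun setT F -> (forall z, (0 <= F z)%E) ->
  (\int[@leb2 R]_z F z = \int[leb]_x \int[leb]_y F (x, y))%E.
Proof. by move=> mF F0; exact: fubini_tonelli1. Qed.

End PlaneMeasure.

(** * The Hartley transform of integrable functions *)

Section Hartley.
Context {R : realType}.
Local Notation line := (measurableTypeR R).
Local Notation plane := (line * line)%type.
Local Notation leb := (@lebesgue_measure R).
Local Notation mu := (@leb2 R).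
Implicit Types (f g h : plane -> R) (x y z xi : plane).

(** The kernel of the Hartley transform; [cas (dot x xi)] is real and symmetric
    in [x] and [xi]. *)
Definition cas (s : R) : R := cos s + sin s.

Lemma normr_cas_le2 s : `|cas s| <= 2.
Proof.
apply: le_trans (ler_normD _ _) _; rewrite (_ : 2 = 1 + 1)//.
by apply: lerD; [exact: normr_cos_le1|exact: normr_sin_le1].
Qed.

Lemma casM (s t : R) : cas s * cas t = cos (s - t) + sin (s + t).
Proof. by rewrite /cas cosB sinD; ring. Qed.

Lemma dotC x y : dot x y = dot y x.
Proof. by rewrite /dot; ring. Qed.

Lemma measurable_dot : measurable_fun setT (fun z : plane * plane => dot z.1 z.2).
Proof.
have m1 : measurable_fun setT (fun z : plane * plane => z.1.1).
  exact: (measurableT_comp (@measurable_fst _ _ _ _) (@measurable_fst _ _ _ _)).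
have m2 : measurable_fun setT (fun z : plane * plane => z.2.1).
  exact: (measurableT_comp (@measurable_fst _ _ _ _) (@measurable_snd _ _ _ _)).
have m3 : measurable_fun setT (fun z : plane * plane => z.1.2).
  exact: (measurableT_comp (@measurable_snd _ _ _ _) (@measurable_fst _ _ _ _)).
have m4 : measurable_fun setT (fun z : plane * plane => z.2.2).
  exact: (measurableT_comp (@measurable_snd _ _ _ _) (@measurable_snd _ _ _ _)).
by apply: measurable_funD; apply: measurable_funM.
Qed.

Lemma measurable_cas : measurable_fun setT cas.
Proof.
apply: measurable_funD; apply: continuous_measurable_fun.
  exact: continuous_cos.
exact: continuous_sin.
Qed.

Lemma measurable_casdot : measurable_fun setT (fun z : plane * plane => cas (dot z.1 z.2)).
Proof. exact: (measurableT_comp measurable_cas measurable_dot). Qed.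

Definition hartley f xi : R := \int[mu]_x (f x * cas (dot x xi)).

Lemma integrable_mul_cas f xi : mu.-integrable setT (EFin \o f) ->
  mu.-integrable setT (fun x => (f x * cas (dot x xi))%:E).
Proof.
move=> intf; have mf : measurable_fun setT f by apply/measurable_EFinP; exact: measurable_int intf.
apply: (le_integrable measurableT _ _ (integrableZl measurableT 2 intf)) => /=.
  apply/measurable_EFinP; apply: measurable_funM => //.
  exact: (measurableT_comp measurable_casdot (pair2_measurable xi)).
move=> x _; rewrite lee_fin !normrM mulrC (ger0_norm (_ : 0 <= 2))// ler_wpM2r//.
exact: normr_cas_le2.
Qed.

(** The integrals of the positive and negative parts are measurable in the
    frequency by Tonelli, and so is their difference. *)
Lemma measurable_hartley f : measurable_fun setT f -> measurable_fun setT (hartley f).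
Proof.
move=> mf; pose F (z : plane * plane) := (f z.2 * cas (dot z.2 z.1))%:E.
have mF : measurable_fun setT F.
  apply/measurable_EFinP; apply: measurable_funM; first exact: (measurableT_comp mf).
  by under eq_fun do rewrite dotC; exact: measurable_casdot.
have mFp : measurable_fun setT (fun xi => \int[mu]_x (F^\+ (xi, x)))%E.
  by apply: (measurable_fun_fubini_tonelli_F (F^\+)%E) => //; exact: measurable_funepos.
have mFn : measurable_fun setT (fun xi => \int[mu]_x (F^\- (xi, x)))%E.
  by apply: (measurable_fun_fubini_tonelli_F (F^\-)%E) => //; exact: measurable_funeneg.
rewrite (_ : hartley f = (fun xi => fine ((\int[mu]_x (F^\+ (xi, x))) - \int[mu]_x (F^\- (xi, x)))%E)).
  by apply: measurableT_comp => //; exact: emeasurable_funB.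
apply/funext => xi; rewrite /hartley /Rintegral integralE; congr (fine (_ - _)).
  by apply: eq_integral => x _; rewrite !funeposE.
by apply: eq_integral => x _; rewrite !funenegE.
Qed.

Lemma normr_hartley_le f xi : mu.-integrable setT (EFin \o f) ->
  `|hartley f xi| <= 2 * \int[mu]_x `|f x|.
Proof.
move=> intf; apply: le_trans (le_normr_Rintegral measurableT (integrable_mul_cas xi intf)) _.
have intf' : mu.-integrable setT (EFin \o (fun x => `|f x|)) by exact: (integrable_norm intf).
rewrite -RintegralZl//; apply: le_Rintegral => //.
- exact: (integrable_norm (integrable_mul_cas xi intf)).
- by apply: (integrableZl measurableT 2 intf').
- by move=> x _; rewrite normrM mulrC ler_wpM2r// normr_cas_le2.
Qed.

Lemma integrable_hartley_mul f g : mu.-integrable setT (EFin \o f) ->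
  mu.-integrable setT (EFin \o g) ->
  mu.-integrable setT (fun xi => (hartley f xi * g xi)%:E).
Proof.
move=> intf intg.
have mf : measurable_fun setT f by apply/measurable_EFinP; exact: measurable_int intf.
have mg : measurable_fun setT g by apply/measurable_EFinP; exact: measurable_int intg.
apply: (le_integrable measurableT _ _ (integrableZl measurableT (2 * \int[mu]_x `|f x|) intg)) => /=.
  by apply/measurable_EFinP; apply: measurable_funM => //; exact: measurable_hartley.
move=> x _; rewrite lee_fin !normrM ler_wpM2r//.
by rewrite -normrM; apply: le_trans (normr_hartley_le x intf) (ler_norm _).
Qed.

(** Fubini and the symmetry of the kernel. *)
Lemma hartley_sym f g : mu.-integrable setT (EFin \o f) ->
  mu.-integrable setT (EFin \o g) ->
  \int[mu]_xi (hartley f xi * g xi) = \int[mu]_x (f x * hartley g x).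
Proof.
move=> intf intg.
have iF := integrable_prod_mul intf intg measurable_casdot (fun z : plane * plane => normr_cas_le2 (dot z.1 z.2)).
transitivity (\int[mu]_xi \int[mu]_x (f x * g xi * cas (dot x xi))).
  apply: eq_Rintegral => xi _; rewrite /hartley -RintegralZr//; last exact: integrable_mul_cas.
  by apply: eq_Rintegral => x _; ring.
rewrite -(Rintegral_swap iF) /=.
- apply: eq_Rintegral => x _; rewrite /hartley -RintegralZl//; last exact: integrable_mul_cas.
  by apply: eq_Rintegral => xi _; rewrite (dotC xi); ring.
- move=> x; have := integrableZl measurableT (f x) (integrable_mul_cas x intg).
  by apply: eq_integrable => // y _; rewrite -EFinM (dotC y) mulrA.
- move=> y; have := integrableZl measurableT (g y) (integrable_mul_cas y intf).
  by apply: eq_integrable => // x _; rewrite -EFinM; congr EFin; ring.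
Qed.

Definition wt2 (a b : R) xi : R := wt a xi.1 * wt b xi.2.
Definition kern2 (a b : R) x y : R := kern a (x.1 - y.1) * kern b (x.2 - y.2).

Lemma integrable_wt2 (a b : R) : 0 < a -> 0 < b -> mu.-integrable setT (EFin \o wt2 a b).
Proof.
by move=> a0 b0; exact: (integrable_leb2_mul (integrable_wt a0) (integrable_wt b0)).
Qed.

Let integrable_wt_mul (f : R -> R) (a z : R) : 0 < a -> continuous f -> (forall s, `|f s| <= 1) ->
  leb.-integrable setT (EFin \o (fun s => wt a s * f (z * s))).
Proof.
move=> a0 cf f1; apply: (le_integrable measurableT _ _ (integrable_wt a0)) => /=.
  apply/measurable_EFinP; apply: measurable_funM; first exact: measurable_wt.
  apply: continuous_measurable_fun => x; apply: continuous_comp; last exact: cf.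
  by apply: cvgMr; exact: cvg_id.
by move=> x _; rewrite lee_fin normrM -[leRHS]mulr1 ler_wpM2l.
Qed.

(** Product formulas write [cas (dot y xi) * cas (dot x xi)] with the cosine of
    the difference and the sine of the sum. The weight is even in each
    coordinate, so only the product of the two cosine transforms, taken at
    [x - y], survives. *)
Lemma hartley_wt2_cas (a b : R) x y : 0 < a -> 0 < b ->
  hartley (fun xi => wt2 a b xi * cas (dot y xi)) x = kern2 a b x y.
Proof.
move=> a0 b0; rewrite /hartley.
have ic (c z : R) (c0 : 0 < c) := integrable_wt_mul z c0 (@continuous_cos R) (@normr_cos_le1 R).
have is_ (c z : R) (c0 : 0 < c) := integrable_wt_mul z c0 (@continuous_sin R) (@normr_sin_le1 R).
pose CC (z xi : plane) := (wt a xi.1 * cos (z.1 * xi.1)) * (wt b xi.2 * cos (z.2 * xi.2)).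
pose SS (z xi : plane) := (wt a xi.1 * sin (z.1 * xi.1)) * (wt b xi.2 * sin (z.2 * xi.2)).
pose SC (z xi : plane) := (wt a xi.1 * sin (z.1 * xi.1)) * (wt b xi.2 * cos (z.2 * xi.2)).
pose CS (z xi : plane) := (wt a xi.1 * cos (z.1 * xi.1)) * (wt b xi.2 * sin (z.2 * xi.2)).
pose p := (x.1 - y.1, x.2 - y.2). pose q := (x.1 + y.1, x.2 + y.2).
have iCC z : mu.-integrable setT (EFin \o CC z) by exact: (integrable_leb2_mul (ic a z.1 a0) (ic b z.2 b0)).
have iSS z : mu.-integrable setT (EFin \o SS z) by exact: (integrable_leb2_mul (is_ a z.1 a0) (is_ b z.2 b0)).
have iSC z : mu.-integrable setT (EFin \o SC z) by exact: (integrable_leb2_mul (is_ a z.1 a0) (ic b z.2 b0)).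
have iCS z : mu.-integrable setT (EFin \o CS z) by exact: (integrable_leb2_mul (ic a z.1 a0) (is_ b z.2 b0)).
transitivity (\int[mu]_xi ((CC p xi - SS p xi) + (SC q xi + CS q xi))).
  apply: eq_Rintegral => xi _; rewrite -mulrA casM (dotC xi).
  have -> : dot y xi - dot x xi = - (p.1 * xi.1 + p.2 * xi.2) by rewrite /dot /p /=; ring.
  have -> : dot y xi + dot x xi = q.1 * xi.1 + q.2 * xi.2 by rewrite /dot /q /=; ring.
  by rewrite cosN cosD sinD /wt2 /CC /SS /SC /CS; ring.
rewrite RintegralD//; last 2 first.
- exact: (integrableB measurableT (iCC p) (iSS p)).
- exact: (integrableD measurableT (iSC q) (iCS q)).
rewrite (RintegralB measurableT (iCC p) (iSS p)) (RintegralD measurableT (iSC q) (iCS q)).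
rewrite /CC /SS /SC /CS.
rewrite (Rintegral_leb2_mul (ic a p.1 a0) (ic b p.2 b0)).
rewrite (Rintegral_leb2_mul (is_ a p.1 a0) (is_ b p.2 b0)).
rewrite (Rintegral_leb2_mul (is_ a q.1 a0) (ic b q.2 b0)).
rewrite (Rintegral_leb2_mul (ic a q.1 a0) (is_ b q.2 b0)).
rewrite !integral_wt_sin// !integral_wt_cos//.
by rewrite /kern2 /p /=; ring.
Qed.

End Hartley.

(** * Weighted energy and the low-frequency estimate *)

Section WeightedEnergy.
Context {R : realType}.
Local Notation plane := (measurableTypeR R * measurableTypeR R)%type.
Local Notation leb := (@lebesgue_measure R).
Local Notation mu := (@leb2 R).
Implicit Types (a b : R) (f g h : plane -> R) (x y z xi : plane).

(** The square of the norm of the transform, equal to the total mass of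
    [kern2 a b x]. *)
Definition plancherel_cst : R := (2 * pi) ^+ 2.

Lemma plancherel_cst_gt0 : 0 < plancherel_cst.
Proof. by rewrite exprn_gt0// mulr_gt0// pi_gt0. Qed.

Lemma kern2C a b x y : kern2 a b x y = kern2 a b y x.
Proof. by rewrite /kern2 -(kernN a) -(kernN b) !opprB. Qed.

Lemma kern2_itv a b x y : 0 < a -> 0 < b -> 0 <= kern2 a b x y <= 9 / (a * b).
Proof.
move=> a0 b0; have /andP[k1 k2] := kern_itv (x.1 - y.1) a0.
have /andP[k3 k4] := kern_itv (x.2 - y.2) b0.
rewrite /kern2 mulr_ge0//=; apply: le_trans (ler_pM k1 k3 k2 k4) _.
by rewrite le_eqVlt; apply/orP; left; apply/eqP; field; rewrite !lt0r_neq0.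
Qed.

Lemma measurable_kern2 a b : 0 < a -> 0 < b ->
  measurable_fun setT (fun z : plane * plane => kern2 a b z.1 z.2).
Proof.
move=> a0 b0.
have m1 : measurable_fun setT (fun z : plane * plane => z.1.1).
  exact: (measurableT_comp (@measurable_fst _ _ _ _) (@measurable_fst _ _ _ _)).
have m2 : measurable_fun setT (fun z : plane * plane => z.2.1).
  exact: (measurableT_comp (@measurable_fst _ _ _ _) (@measurable_snd _ _ _ _)).
have m3 : measurable_fun setT (fun z : plane * plane => z.1.2).
  exact: (measurableT_comp (@measurable_snd _ _ _ _) (@measurable_fst _ _ _ _)).
have m4 : measurable_fun setT (fun z : plane * plane => z.2.2).
  exact: (measurableT_comp (@measurable_snd _ _ _ _) (@measurable_snd _ _ _ _)).
apply: measurable_funM.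
  by apply: (measurableT_comp (measurable_kern a0)); exact: measurable_funB.
by apply: (measurableT_comp (measurable_kern b0)); exact: measurable_funB.
Qed.

Lemma integral_kern2 a b x : 0 < a -> 0 < b -> (\int[mu]_y (kern2 a b x y)%:E = plancherel_cst%:E)%E.
Proof.
move=> a0 b0; have k0 (c z : R) : 0 < c -> 0 <= kern c z.
  by move=> /kern_itv => /(_ z)/andP[].
have mk (c z : R) : 0 < c -> measurable_fun setT (fun y : measurableTypeR R => (kern c (z - y))%:E).
  move=> c0; apply/measurable_EFinP; apply: (measurableT_comp (measurable_kern c0)).
  exact: measurable_funB.
rewrite integral_leb2.
- under eq_integral => y1 _.
    under eq_integral do rewrite /kern2 /= EFinM.
    rewrite ge0_integralZl_EFin//; [|by move=> z _; rewrite lee_fin k0|exact: mk|exact: k0].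
    rewrite integral_kern_shift// -EFinM mulrC EFinM.
    over.
  rewrite ge0_integralZl_EFin//; [|by move=> z _; rewrite lee_fin k0|exact: mk|by rewrite mulr_ge0// pi_ge0].
  by rewrite integral_kern_shift// -EFinM.
- apply/measurable_EFinP.
  exact: (measurableT_comp (measurable_kern2 a0 b0) (pair1_measurable x)).
- by move=> y; rewrite lee_fin; have /andP[] := kern2_itv x y a0 b0.
Qed.

Lemma wt2_itv a b xi : 0 < a -> 0 < b -> 0 <= wt2 a b xi <= 1.
Proof.
move=> a0 b0; have /andP[k1 k2] := wt_itv xi.1 a0; have /andP[k3 k4] := wt_itv xi.2 b0.
by rewrite /wt2 mulr_ge0//= mulr_ile1.
Qed.

Lemma measurable_wt2 a b : measurable_fun setT (wt2 a b).
Proof.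
apply: measurable_funM; apply: measurableT_comp.
- exact: measurable_wt.
- exact: measurable_fst.
- exact: measurable_wt.
- exact: measurable_snd.
Qed.

(** Symmetry of the transform is used twice: moving it off one factor leaves the
    transform of [wt2 a b * hartley h], and moving it off that factor leaves the
    transform of the weighted kernel, which is [kern2]. *)
Lemma weighted_energyE a b h : 0 < a -> 0 < b -> mu.-integrable setT (EFin \o h) ->
  \int[mu]_xi (wt2 a b xi * hartley h xi ^+ 2) =
  \int[mu]_x (h x * \int[mu]_y (h y * kern2 a b x y)).
Proof.
move=> a0 b0 ih.
have ihw := integrable_hartley_mul ih (integrable_wt2 a0 b0).
transitivity (\int[mu]_xi (hartley h xi * (hartley h xi * wt2 a b xi))).
  by apply: eq_Rintegral => xi _; ring.
rewrite (hartley_sym ih ihw); apply: eq_Rintegral => x _; congr (_ * _).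
rewrite {1}/hartley.
transitivity (\int[mu]_xi (hartley h xi * (wt2 a b xi * cas (dot x xi)))).
  by apply: eq_Rintegral => xi _; rewrite mulrA (dotC x).
rewrite hartley_sym//.
  by apply: eq_Rintegral => y _; rewrite hartley_wt2_cas// kern2C.
have := integrable_mul_cas x (integrable_wt2 a0 b0).
by apply: eq_integrable => // xi _; rewrite /= dotC.
Qed.

Lemma integrable_weighted a b h : 0 < a -> 0 < b -> mu.-integrable setT (EFin \o h) ->
  mu.-integrable setT (fun xi => (wt2 a b xi * hartley h xi ^+ 2)%:E).
Proof.
move=> a0 b0 ih.
have := integrable_hartley_mul ih (integrable_hartley_mul ih (integrable_wt2 a0 b0)).
by apply: eq_integrable => // xi _; congr EFin; ring.
Qed.

Lemma integrable_kern2_form a b h : 0 < a -> 0 < b -> mu.-integrable setT (EFin \o h) ->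
  mu.-integrable setT (fun x => (h x * \int[mu]_y (h y * kern2 a b x y))%:E).
Proof.
move=> a0 b0 ih.
have := integrable_hartley_mul (integrable_hartley_mul ih (integrable_wt2 a0 b0)) ih.
apply: eq_integrable => // x _; rewrite mulrC; congr (_ * _)%:E.
transitivity (\int[mu]_xi (hartley h xi * (wt2 a b xi * cas (dot x xi)))).
  by apply: eq_Rintegral => xi _; rewrite mulrA (dotC x).
rewrite hartley_sym//.
  by apply: eq_Rintegral => y _; rewrite hartley_wt2_cas// kern2C.
have := integrable_mul_cas x (integrable_wt2 a0 b0).
by apply: eq_integrable => // xi _; rewrite /= dotC.
Qed.

(** The kernel form has kernel bounded by [9 / (a b)] with marginals
    [plancherel_cst], so that the Young-type bound applies. For [s = 0] this is a
    mean-square bound uniform in the weight; for [s > 0] it is the gain at low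
    frequencies. *)
Lemma weighted_energy_le a b h (s p N : R) : 0 < a -> 0 < b ->
  0 <= s <= 1 -> p * (1 + s) = 2 -> 0 < N ->
  mu.-integrable setT (EFin \o h) ->
  (\int[mu]_x (`|h x| `^ p)%:E <= N%:E)%E ->
  \int[mu]_xi (wt2 a b xi * hartley h xi ^+ 2) <=
    (9 / (a * b)) `^ s * N `^ (1 + s) * plancherel_cst `^ (1 - s).
Proof.
move=> a0 b0 s01 ps N0 ih hN; rewrite weighted_energyE//.
have mh : measurable_fun setT h by apply/measurable_EFinP; exact: measurable_int ih.
have k0 x y : 0 <= kern2 a b x y by have /andP[] := kern2_itv x y a0 b0.
have mk := measurable_kern2 a0 b0.
have mkx x : measurable_fun setT (kern2 a b x) by exact: (measurableT_comp mk (pair1_measurable x)).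
rewrite -lee_fin.
apply: le_trans (@schur_bound _ _ _ mu h (kern2 a b) s p (9 / (a * b)) N plancherel_cst s01 ps N0 plancherel_cst_gt0 mh mk _ _ _ hN); last 3 first.
- by move=> x y; exact: kern2_itv.
- by move=> x; rewrite integral_kern2.
- by move=> y; under eq_integral do rewrite kern2C; rewrite integral_kern2.
have ik x : mu.-integrable setT (fun y => (h y * kern2 a b x y)%:E).
  apply: (le_integrable measurableT _ _ (integrableZl measurableT (9 / (a * b)) ih)) => /=.
    by apply/measurable_EFinP; exact: measurable_funM.
  move=> y _; rewrite lee_fin normrM [leRHS]normrM mulrC ler_wpM2r//.
  have /andP[_ k9] := kern2_itv x y a0 b0.
  by rewrite ger0_norm//; apply: le_trans k9 (ler_norm _).
have iE := integrable_kern2_form a0 b0 ih.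
apply: (@le_trans _ _ (\int[mu]_x `|h x * \int[mu]_y (h y * kern2 a b x y)|%:E)%E).
  rewrite /Rintegral fineK; last exact: integrable_fin_num.
  apply: le_trans (lee_abs _) _.
  by apply: (le_abse_integral mu measurableT (measurable_int _ iE)).
apply: ge0_le_integral => //=.
- by apply/measurable_EFinP; apply: measurableT_comp => //; apply/measurable_EFinP; exact: measurable_int iE.
- apply: (measurable_fun_fubini_tonelli_F (fun z : plane * plane => (`|h z.1| * `|h z.2| * kern2 a b z.1 z.2)%:E)).
    apply/measurable_EFinP; apply: measurable_funM => //; apply: measurable_funM; apply: measurableT_comp => //.
      exact: (measurableT_comp mh (@measurable_fst _ _ _ _)).
    exact: (measurableT_comp mh (@measurable_snd _ _ _ _)).
  by move=> z; rewrite lee_fin mulr_ge0// mulr_ge0.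
- move=> x _; rewrite normrM EFinM.
  under eq_integral do rewrite -mulrA EFinM.
  rewrite ge0_integralZl_EFin//; last 2 first.
  + by move=> y _; rewrite lee_fin mulr_ge0.
  + by apply/measurable_EFinP; apply: measurable_funM => //; exact: measurableT_comp.
  apply: lee_wpmul2l; first by rewrite lee_fin.
  rewrite (EFin_normr_Rintegral measurableT (ik x)); apply: le_trans (le_abse_integral mu measurableT (measurable_int _ (ik x))) _.
  rewrite le_eqVlt; apply/orP; left; apply/eqP; apply: eq_integral => y _ /=.
  by rewrite normrM (ger0_norm (k0 _ _)).
Qed.

End WeightedEnergy.

(** * The mean-square bound for the Hartley transform *)

Section Truncation.
Context {R : realType}.
Local Notation plane := (measurableTypeR R * measurableTypeR R)%type.
Local Notation leb := (@lebesgue_measure R).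
Local Notation mu := (@leb2 R).
Local Notation L2 f := (f \in Lfun mu 2%:E).
Implicit Types (a b : R) (f g h : plane -> R) (x y z xi : plane).

Definition disk (n : nat) : set plane := [set x | enorm x <= n%:R].
Definition trunc n f : plane -> R := f \_ (disk n).

Lemma measurable_enorm : measurable_fun setT (@enorm R : plane -> R).
Proof.
apply: (measurableT_comp (continuous_measurable_fun (@sqrt_continuous R))).
apply: measurable_funD; apply: measurable_funX.
  exact: measurable_fst.
exact: measurable_snd.
Qed.

Lemma measurable_disk n : measurable (disk n).
Proof.
rewrite (_ : disk n = (@enorm R : plane -> R) @^-1` `]-oo, n%:R]).
  by rewrite -[X in measurable X]setTI; exact: measurable_enorm.
by apply/seteqP; split => x /=; rewrite in_itv.
Qed.

Lemma normr1_le_enorm x : `|x.1| <= enorm x.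
Proof. by rewrite -sqrtr_sqr ler_sqrt ?lerDl ?sqr_ge0// addr_ge0// sqr_ge0. Qed.

Lemma normr2_le_enorm x : `|x.2| <= enorm x.
Proof. by rewrite -sqrtr_sqr ler_sqrt ?lerDr ?sqr_ge0// addr_ge0// sqr_ge0. Qed.

Lemma disk_lty n : (mu (disk n) < +oo)%E.
Proof.
pose I : set (measurableTypeR R) := `[- n%:R, n%:R]%classic.
apply: (@le_lt_trans _ _ (mu (I `*` I))).
  apply: le_measure; rewrite ?inE.
  - exact: measurable_disk.
  - by apply: measurableX; exact: measurable_itv.
  - move=> x /= xn; rewrite /I /= !in_itv /= -!ler_norml; split.
      exact: le_trans (normr1_le_enorm x) xn.
    exact: le_trans (normr2_le_enorm x) xn.
have mI : measurable I by exact: measurable_itv.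
have E : (leb I = (n%:R + n%:R)%:E)%E.
  rewrite [LHS]lebesgue_measure_itv/= lte_fin; case: ifPn; first by rewrite -EFinB opprK.
  rewrite -leNgt => n0; congr EFin; have : 0 <= (n%:R : R) by []; lra.
have -> : (mu (I `*` I) = leb I * leb I)%E by exact: (product_measure1E leb leb mI mI).
by rewrite E -EFinM ltry.
Qed.

Lemma truncE n f x : trunc n f x = f x * \1_(disk n) x.
Proof. by rewrite /trunc patchE indicE; case: (x \in disk n); rewrite ?mulr1 ?mulr0. Qed.

Lemma normr_trunc_le n f x : `|trunc n f x| <= `|f x|.
Proof. by rewrite /trunc patchE; case: ifP => // _; rewrite normr0. Qed.

Lemma measurable_trunc n f : measurable_fun setT f -> measurable_fun setT (trunc n f).
Proof.
move=> mf; rewrite (_ : trunc n f = fun x => f x * \1_(disk n) x).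
  by apply: measurable_funM => //; apply: measurable_indic; exact: measurable_disk.
by apply/funext => x; exact: truncE.
Qed.

Lemma L2_trunc n f : L2 f -> L2 (trunc n f).
Proof.
move=> lf; apply: (L2_le _ lf).
  by apply: measurable_trunc; exact: L2_measurable lf.
by move=> x; exact: normr_trunc_le.
Qed.

Lemma integrable_trunc n f : L2 f -> mu.-integrable setT (EFin \o trunc n f).
Proof.
move=> lf; have mf := L2_measurable lf.
have i1 := L2_mul_integrable lf lf.
have i2 : mu.-integrable setT (EFin \o \1_(disk n)).
  apply/integrableP; split.
    by apply/measurable_EFinP; apply: measurable_indic; exact: measurable_disk.
  under eq_integral do rewrite gee0_abs ?lee_fin//.
  by rewrite integral_indic ?setIT ?disk_lty//; exact: measurable_disk.
apply: (le_integrable measurableT _ _ (integrableD measurableT i1 i2)) => /=.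
  by apply/measurable_EFinP; exact: measurable_trunc.
move=> x _; rewrite lee_fin truncE indicE.
case: (x \in disk n); last by rewrite mulr0 normr0.
have f2 : 0 <= f x * f x by rewrite -expr2 sqr_ge0.
rewrite mulr1 [leRHS]ger0_norm ?addr_ge0//.
have : 0 <= (`|f x| - 1) ^+ 2 by exact: sqr_ge0.
have -> : f x * f x = `|f x| ^+ 2 by rewrite real_normK ?num_real// expr2.
have := normr_ge0 (f x); rewrite /=; move: (`|f x|) => r; nra.
Qed.

Lemma trunc_cvg2 f : L2 f -> cvg2 mu (fun n => trunc n f) f.
Proof.
move=> lf; have mf := L2_measurable lf.
pose u n x := ((trunc n f x - f x) * (trunc n f x - f x))%:E.
have mu_ n : measurable_fun setT (u n).
  apply/measurable_EFinP; apply: measurable_funM; apply: measurable_funB => //; exact: measurable_trunc.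
have cu : {ae mu, forall x, setT x -> u n x @[n --> \oo] --> 0%E}.
  apply: aeW => x _; apply: cvg_near_cst.
  have [N hN] : exists N : nat, enorm x <= N%:R.
    by exists (Num.truncn (enorm x)).+1; apply: ltW; exact: truncnS_gt.
  exists N => // n /= Nn; rewrite /u /trunc patchE mem_set ?subrr ?mulr0//.
  by rewrite /disk /= (le_trans hN)// ler_nat.
have domu : {ae mu, forall x n, setT x -> (`|u n x| <= (f x * f x)%:E)%E}.
  apply: aeW => x n _; rewrite lee_fin normrM -normrM ger0_norm -?expr2 ?sqr_ge0//.
  rewrite /trunc patchE; case: ifP => _; first by rewrite subrr expr0n sqr_ge0.
  by rewrite sub0r sqrrN.
have [_ _] := dominated_convergence measurableT mu_ (measurable_cst 0%E) cu (L2_mul_integrable lf lf) domu.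
rewrite integral0 => h.
rewrite /cvg2 -[0]/(fine 0%E); apply: fine_cvg.
exact: h.
Qed.

Definition wt2n n : plane -> R := wt2 n.+1%:R^-1 n.+1%:R^-1.

Lemma cvg_wt2n xi : wt2n n xi @[n --> \oo] --> (1 : R).
Proof.
have c1 (s : R) : wt (n.+1%:R^-1) s @[n --> \oo] --> (1 : R).
  rewrite /wt [X in _ --> X](_ : (1 : R) = 2 * expR 0 - expR 0); last by rewrite expR0; ring.
  have e0 (r : R) : expR (- (n.+1%:R^-1 * r)) @[n --> \oo] --> expR 0.
    apply: (continuous_cvg _ (@continuous_expR R 0)).
    have h : n.+1%:R^-1 * r @[n --> \oo] --> 0 * r by apply: cvgMl; exact: cvg_harmonic.
    by rewrite mul0r in h; rewrite -oppr0; exact: cvgN h.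
  apply: cvgB; first by apply: cvgMr; exact: e0.
  by under eq_fun do rewrite mulrC mulrA mulrC; exact: e0.
by rewrite -[X in _ --> X](mulr1 1); apply: cvgM; exact: c1.
Qed.

(** Fatou's lemma as the weights tend to [1]. *)
Lemma weighted_limit (A : plane -> R) (c : R) : measurable_fun setT A ->
  (forall n, mu.-integrable setT (fun xi => (wt2n n xi * A xi ^+ 2)%:E)) ->
  (forall n, \int[mu]_xi (wt2n n xi * A xi ^+ 2) <= c) ->
  L2 A /\ sq mu A <= c.
Proof.
move=> mA iA hA.
have w0 n xi : 0 <= wt2n n xi by have /andP[] := @wt2_itv R n.+1%:R^-1 n.+1%:R^-1 xi ltac:(by rewrite invr_gt0) ltac:(by rewrite invr_gt0).
pose u n xi := Num.sqrt (wt2n n xi) * A xi.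
have uu n xi : u n xi * u n xi = wt2n n xi * A xi ^+ 2.
  by rewrite /u mulrACA -!expr2 sqr_sqrtr.
have mun n : measurable_fun setT (u n).
  apply: measurable_funM => //.
  apply: (measurableT_comp (continuous_measurable_fun (@sqrt_continuous R))).
  exact: measurable_wt2.
have lu n : L2 (u n).
  by apply: L2P => //; have := iA n; apply: eq_integrable => // xi _; rewrite uu.
have l0 : L2 (fun=> 0 : R).
  apply: L2P => //; under eq_fun do rewrite mulr0; exact: integrable0.
have su n : sq mu (u n) <= c.
  by apply: le_trans (hA n); rewrite le_eqVlt; apply/orP; left; apply/eqP; apply: eq_Rintegral => xi _; rewrite uu.
have [] := @fatou_sq _ _ _ mu u A (fun=> 0) c lu mA l0.
- apply: aeW => xi; rewrite /u -[A xi in X in _ --> X]mul1r.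
  apply: cvgMl; rewrite -(@sqrtr1 R).
  by apply: (continuous_cvg _ (@sqrt_continuous R 1)); exact: cvg_wt2n.
- by apply: nearW => n; rewrite [X in sq mu X](_ : _ = u n)//; apply/funext => xi; rewrite subr0.
rewrite (_ : (fun x => A x - 0) = A); last by apply/funext => xi; rewrite subr0.
by split.
Qed.

(** The weighted energy bound with [s = 0] does not depend on the weight. It asks
    for a positive [N], hence the slack [e] added to the square norm. *)
Lemma hartley_bounded h : mu.-integrable setT (EFin \o h) -> L2 h ->
  L2 (hartley h) /\ sq mu (hartley h) <= plancherel_cst * sq mu h.
Proof.
move=> ih lh; have mh := L2_measurable lh.
have np n : 0 < n.+1%:R^-1 :> R by rewrite invr_gt0.
have key e : 0 < e -> L2 (hartley h) /\ sq mu (hartley h) <= plancherel_cst * (sq mu h + e).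
  move=> e0; apply: weighted_limit; first exact: measurable_hartley.
    by move=> n; exact: integrable_weighted.
  move=> n; have N0 : 0 < sq mu h + e by rewrite ltr_wpDl ?sq_ge0.
  have s01 : 0 <= (0 : R) <= 1 by rewrite lexx ler01.
  have ps : 2 * (1 + 0) = 2 :> R by rewrite addr0 mulr1.
  apply: le_trans (weighted_energy_le (np n) (np n) s01 ps N0 ih _) _.
    apply: (@le_trans _ _ (sq mu h)%:E); last by rewrite lee_fin lerDl ltW.
    rewrite -sq_EFin// le_eqVlt; apply/orP; left; apply/eqP; apply: eq_integral => x _.
    by rewrite powR_mulrn// real_normK ?num_real// expr2.
  by rewrite powRr0 mul1r addr0 subr0 (powRr1 (ltW N0)) (powRr1 (ltW plancherel_cst_gt0)) mulrC.
have [lH _] := key 1 ltr01; split => //.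
apply/ler_addgt0Pr => e e0; have e1 : 0 < e / plancherel_cst by rewrite divr_gt0// plancherel_cst_gt0.
have [_] := key _ e1; rewrite mulrDr mulrCA divff ?mulr1// lt0r_neq0//; exact: plancherel_cst_gt0.
Qed.

End Truncation.

(** * Extension to square-integrable functions *)

Section HartleyL2.
Context {R : realType}.
Local Notation plane := (measurableTypeR R * measurableTypeR R)%type.
Local Notation mu := (@leb2 R).
Local Notation L2 f := (f \in Lfun mu 2%:E).
Implicit Types (a b c : R) (f g h A B : plane -> R) (x y z xi : plane).

Lemma hartleyD c f g : mu.-integrable setT (EFin \o f) -> mu.-integrable setT (EFin \o g) ->
  hartley (fun x => f x + c * g x) = (fun xi => hartley f xi + c * hartley g xi).
Proof.
move=> intf intg; apply/funext => xi; rewrite /hartley.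
have ic := integrable_mul_cas xi intg.
rewrite -RintegralZl// -RintegralD//; last 2 first.
- exact: integrable_mul_cas.
- by have := integrableZl measurableT c ic; apply: eq_integrable => // x _; rewrite EFinM.
by apply: eq_Rintegral => x _; ring.
Qed.

(** The transform of a square-integrable function is a mean-square limit of
    transforms of truncations, as in the definition of the Fourier transform;
    being defined almost everywhere, it is a relation. *)
Definition is_hartley f A := [/\ L2 f, L2 A & cvg2 mu (fun n => hartley (trunc n f)) A].

Lemma truncD n c f g : trunc n (fun x => f x + c * g x) = (fun x => trunc n f x + c * trunc n g x).
Proof. by apply/funext => x; rewrite !truncE; ring. Qed.

Lemma L2_hartley_trunc n f : L2 f -> L2 (hartley (trunc n f)).
Proof. by move=> lf; have [] := hartley_bounded (integrable_trunc n lf) (L2_trunc n lf). Qed.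

(** Truncations form a Cauchy sequence and the transform is bounded. *)
Lemma is_hartley_ex f : L2 f -> exists A, is_hartley f A.
Proof.
move=> lf; have lH n := L2_hartley_trunc n lf.
have [A [lA cA]] : exists A, L2 A /\ cvg2 mu (fun n => hartley (trunc n f)) A; last by exists A.
apply: L2_complete => // e e0.
have e1 : 0 < e / plancherel_cst by rewrite divr_gt0// plancherel_cst_gt0.
have [N hN] := cvg2_cauchy (fun n => L2_trunc n lf) lf (trunc_cvg2 lf) e1.
exists N => m n Nm Nn; have := hN m n Nm Nn.
have it k := integrable_trunc k lf.
have E : (fun x => hartley (trunc m f) x - hartley (trunc n f) x) =
    hartley (fun x => trunc m f x + -1 * trunc n f x).
  by rewrite hartleyD//; apply/funext => x; ring.
have i2 : mu.-integrable setT (EFin \o (fun x => trunc m f x + -1 * trunc n f x)).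
  have := integrableB measurableT (it m) (it n).
  by apply: eq_integrable => // x _; rewrite /= mulN1r.
have lt2 : L2 (fun x => trunc m f x + -1 * trunc n f x).
  by apply: L2D; [exact: L2_trunc|apply: L2Z; exact: L2_trunc].
have [_ hb] := hartley_bounded i2 lt2.
rewrite E => h; apply: le_trans hb _; rewrite mulrC -ler_pdivlMr ?plancherel_cst_gt0//.
apply: le_trans h; rewrite le_eqVlt; apply/orP; left; apply/eqP.
by congr sq; apply/funext => x; rewrite mulN1r.
Qed.

Lemma is_hartley_le f A : is_hartley f A -> sq mu A <= plancherel_cst * sq mu f.
Proof.
move=> [lf lA cA].
have c1 := cvg2_sq (fun n => L2_hartley_trunc n lf) lA cA.
rewrite -(cvg_lim (@Rhausdorff R) c1); apply: limr_le; first by apply/cvg_ex; exists (sq mu A).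
apply: nearW => n.
have [_ hb] := hartley_bounded (integrable_trunc n lf) (L2_trunc n lf).
apply: le_trans hb _; rewrite ler_pM2l ?plancherel_cst_gt0//; apply: le_sq => //.
  by apply: measurable_trunc; exact: L2_measurable lf.
by move=> x; exact: normr_trunc_le.
Qed.

Lemma is_hartleyD c f g A B : is_hartley f A -> is_hartley g B ->
  is_hartley (fun x => f x + c * g x) (fun x => A x + c * B x).
Proof.
move=> [lf lA cA] [lg lB cB]; split.
- by apply: L2D => //; exact: L2Z.
- by apply: L2D => //; exact: L2Z.
- rewrite (_ : (fun n => _) = (fun n xi => hartley (trunc n f) xi + c * hartley (trunc n g) xi)).
    apply: cvg2D => //.
    + by move=> n; exact: L2_hartley_trunc.
    + by move=> n; apply: L2Z; exact: L2_hartley_trunc.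
    + exact: L2Z.
    + by apply: cvg2Z => // n; exact: L2_hartley_trunc.
  by apply/funext => n; rewrite truncD hartleyD//; exact: integrable_trunc.
Qed.

Lemma is_hartley_sym f g A B : is_hartley f A -> is_hartley g B -> ip mu A g = ip mu f B.
Proof.
move=> [lf lA cA] [lg lB cB].
have c1 := cvg2_ip (fun n => L2_hartley_trunc n lf) (fun n => L2_trunc n lg) lA lg cA (trunc_cvg2 lg).
have c2 := cvg2_ip (fun n => L2_trunc n lf) (fun n => L2_hartley_trunc n lg) lf lB (trunc_cvg2 lf) cB.
apply: (cvg_unique (@Rhausdorff R) c1).
apply: cvg_trans c2; apply: near_eq_cvg; apply: nearW => n.
by rewrite /ip hartley_sym//; exact: integrable_trunc.
Qed.

Lemma is_hartley_unique f A B : is_hartley f A -> is_hartley f B -> {ae mu, forall x, A x = B x}.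
Proof.
move=> [lf lA cA] [_ lB cB].
exact: (cvg2_unique (fun n => L2_hartley_trunc n lf)).
Qed.

Lemma is_hartley_ae f A B : L2 B -> {ae mu, forall x, A x = B x} -> is_hartley f A -> is_hartley f B.
Proof.
move=> lB AB [lf lA cA]; split => //.
by apply: (cvg2_ae _ _ _ AB cA) => // n; exact: L2_hartley_trunc.
Qed.

(** Truncation only decreases the [L^p] integral, and the square root of the
    weight, being at most [1], preserves mean-square limits. *)
Lemma is_hartley_weighted_le a b f A (s p N : R) : 0 < a -> 0 < b ->
  0 <= s <= 1 -> p * (1 + s) = 2 -> 0 < N -> is_hartley f A ->
  (\int[mu]_x (`|f x| `^ p)%:E <= N%:E)%E ->
  \int[mu]_xi (wt2 a b xi * A xi ^+ 2) <=
    (9 / (a * b)) `^ s * N `^ (1 + s) * plancherel_cst `^ (1 - s).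
Proof.
move=> a0 b0 s01 ps N0 [lf lA cA] fN.
have mf := L2_measurable lf.
have lH n := L2_hartley_trunc n lf.
have w01 xi := wt2_itv xi a0 b0.
pose r xi := Num.sqrt (wt2 a b xi).
have r2 xi : r xi * r xi = wt2 a b xi by rewrite -expr2 sqr_sqrtr//; have /andP[] := w01 xi.
have r1 xi : `|r xi| <= 1.
  by rewrite ger0_norm ?sqrtr_ge0// -(@sqrtr1 R) ler_sqrt//; have /andP[] := w01 xi.
have mr : measurable_fun setT r.
  apply: (measurableT_comp (continuous_measurable_fun (@sqrt_continuous R))).
  exact: measurable_wt2.
have lr B : L2 B -> L2 (fun xi => r xi * B xi).
  move=> lB; apply: (L2_le _ lB).
    by apply: measurable_funM => //; exact: L2_measurable lB.
  by move=> xi; rewrite normrM -[leRHS]mul1r ler_wpM2r.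
have srB B : sq mu (fun xi => r xi * B xi) = \int[mu]_xi (wt2 a b xi * B xi ^+ 2).
  by apply: eq_Rintegral => xi _; rewrite mulrACA r2 expr2.
have cr : cvg2 mu (fun n xi => r xi * hartley (trunc n f) xi) (fun xi => r xi * A xi).
  apply: cvg2_squeeze cA => n.
  have lB : L2 (fun x => hartley (trunc n f) x - A x) by exact: L2B.
  apply: le_sq => //.
    by apply: measurable_funB; apply: L2_measurable; exact: lr.
  by move=> xi; rewrite -mulrBr normrM -[leRHS]mul1r ler_wpM2r.
rewrite -srB.
have c1 := cvg2_sq (fun n => lr _ (lH n)) (lr _ lA) cr.
rewrite -(cvg_lim (@Rhausdorff R) c1); apply: limr_le; first by apply/cvg_ex; eexists; exact: c1.
apply: nearW => n; rewrite srB.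
apply: (weighted_energy_le a0 b0 s01 ps N0 (integrable_trunc n lf)).
apply: le_trans fN; apply: ge0_le_integral => //=.
- apply/measurable_EFinP; apply: (measurableT_comp (measurable_powR p)); apply: measurableT_comp => //.
  exact: measurable_trunc.
- by apply/measurable_EFinP; apply: (measurableT_comp (measurable_powR p)); exact: measurableT_comp.
- move=> x _; rewrite lee_fin ge0_ler_powR ?nnegrE ?normr_trunc_le//.
  (* [p] is positive, since [p (1 + s) = 2] with [0 <= s] *)
  have /andP[s0 s1] := s01; rewrite leNgt; apply/negP => p0.
  by have : p * (1 + s) < 0; [rewrite pmulr_llt0//; lra|rewrite ps; lra].
Qed.

End HartleyL2.

(** * Rectangles determine a function *)

Section DynkinIntegral.
Context d (T : measurableType d) (R : realType).
Variable mu : {measure set T -> \bar R}.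
Local Open Scope ereal_scope.

(** The sets on which the integral vanishes are stable under complement and
    disjoint countable unions, so Dynkin's theorem extends the property from
    a generating family stable under intersection. Relativizing to [D] allows
    [u] to be integrable on [D] alone. *)
Lemma integral0_dynkin (G : set (set T)) (D : set T) (u : T -> \bar R) :
  @measurable _ T = <<s G >> -> setI_closed G -> measurable D ->
  mu.-integrable D u -> \int[mu]_(x in D) u x = 0 ->
  (forall S, G S -> \int[mu]_(x in S `&` D) u x = 0) ->
  forall S, measurable S -> \int[mu]_(x in S `&` D) u x = 0.
Proof.
move=> GE GI mD iu uD uG S; rewrite GE.
have iS A : measurable A -> mu.-integrable (A `&` D) u.
  by move=> mA; apply: (integrableS mD) => //; exact: measurableI.
apply: (dynkin_induction (G := G) (P := fun S => \int[mu]_(x in S `&` D) u x = 0)) => //.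
- by rewrite setTI.
- move=> A mA uA; have mAD : measurable (A `&` D) by exact: measurableI.
  have mACD : measurable (~` A `&` D) by apply: measurableI => //; exact: measurableC.
  have E : (A `&` D) `|` (~` A `&` D) = D by rewrite -setIUl setUv setTI.
  move: uD; rewrite -{1}E integral_setU//; last 2 first.
  + by rewrite E; exact: measurable_int iu.
  + by apply/disj_set2P; rewrite setIACA setICr set0I.
  by rewrite uA add0e.
- move=> F mF tF uF; rewrite setI_bigcupl integral_bigcup.
  + by apply: eseries0 => n _ _; exact: uF.
  + exact: trivIset_setIr.
  + by move=> k; exact: measurableI.
  + by rewrite -setI_bigcupl; apply: iS; exact: bigcupT_measurable.
Qed.

End DynkinIntegral.

Section Rectangles.
Context {R : realType}.
Local Notation plane := (measurableTypeR R * measurableTypeR R)%type.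
Local Notation mu := (@leb2 R).
Local Notation L2 f := (f \in Lfun mu 2%:E).

(** Half-open intervals make the family stable under intersection. *)
Definition rect (a b c e : R) : set plane := (`]a, b]%classic `*` `]c, e]%classic).
Definition rects : set (set plane) := [set S | exists I J, [/\ ocitv I, ocitv J & S = I `*` J]].

Lemma measurable_rect a b c e : measurable (rect a b c e).
Proof. by apply: measurableX; exact: measurable_itv. Qed.

Lemma rectsP S : rects S -> exists a b c e, S = rect a b c e.
Proof. by move=> [I [J [[[a b] _ <-] [[c e] _ <-] ->]]]; exists a, b, c, e. Qed.

Lemma rects_rect a b c e : rects (rect a b c e).
Proof. by exists `]a, b]%classic, `]c, e]%classic; split; [exact: is_ocitv|exact: is_ocitv|]. Qed.

Lemma rectsI : setI_closed rects.
Proof.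
move=> _ _ [I1 [J1 [oI1 oJ1 ->]]] [I2 [J2 [oI2 oJ2 ->]]].
exists (I1 `&` I2), (J1 `&` J2); split; [exact: ocitvI|exact: ocitvI|].
by rewrite setXI.
Qed.

(** Each coordinate projection is measurable for the sigma-algebra generated by
    rectangles, since a vertical or horizontal strip is an increasing union of
    rectangles. *)
Lemma measurable_rects : @measurable _ plane = <<s rects >>.
Proof.
rewrite eqEsubset; split; last first.
  apply: smallest_sub; first exact: sigma_algebra_measurable.
  by move=> S /rectsP[a [b [c [e ->]]]]; exact: measurable_rect.
rewrite measurable_prod_measurableType; apply: smallest_sub.
  exact: smallest_sigma_algebra.
pose T' := g_sigma_algebraType rects.
have mfst : measurable_fun (setT : set T') (fst : T' -> measurableTypeR R).
  apply: (measurability (@ocitv R)) => // _ [I oI <-]; rewrite setTI.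
  have -> : fst @^-1` I = \bigcup_n (I `*` `]- n%:R, n%:R]%classic) :> set T'.
    apply/seteqP; split => [[x y] /= Ix|[x y] [n _] []//].
    exists (Num.truncn `|y|).+1 => //; split => //=; rewrite in_itv/=.
    have := truncnS_gt `|y|; rewrite ltr_norml => /andP[-> h]; exact: ltW.
  apply: bigcupT_measurable => n; apply: sub_sigma_algebra; exists I, `]- n%:R, n%:R]%classic.
  by split => //; exact: is_ocitv.
have msnd : measurable_fun (setT : set T') (snd : T' -> measurableTypeR R).
  apply: (measurability (@ocitv R)) => // _ [I oI <-]; rewrite setTI.
  have -> : snd @^-1` I = \bigcup_n (`]- n%:R, n%:R]%classic `*` I) :> set T'.
    apply/seteqP; split => [[x y] /= Ix|[x y] [n _] []//].
    exists (Num.truncn `|x|).+1 => //; split => //=; rewrite in_itv/=.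
    have := truncnS_gt `|x|; rewrite ltr_norml => /andP[-> h]; exact: ltW.
  apply: bigcupT_measurable => n; apply: sub_sigma_algebra; exists `]- n%:R, n%:R]%classic, I.
  by split => //; exact: is_ocitv.
move=> _ [A mA] [B mB] <-.
have -> : A `*` B = (fst @^-1` A) `&` (snd @^-1` B) :> set T' by [].
have m1 := mfst measurableT A mA; have m2 := msnd measurableT B mB.
by rewrite !setTI in m1 m2; exact: (@measurableI _ T').
Qed.

Lemma leb2_rect a b c e : a <= b -> c <= e -> (mu (rect a b c e) = ((b - a) * (e - c))%:E)%E.
Proof.
move=> ab ce.
have E (r s : R) : r <= s -> (@lebesgue_measure R `]r, s]%classic = (s - r)%:E)%E.
  move=> rs; rewrite [LHS]lebesgue_measure_itv/= lte_fin.
  case: ifPn => //; rewrite -leNgt => sr; congr EFin.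
  by apply/esym/eqP; rewrite subr_eq0 eq_le rs sr.
have mI (r s : R) : measurable (`]r, s]%classic : set (measurableTypeR R)) by exact: measurable_itv.
have -> : (mu (rect a b c e) = @lebesgue_measure R `]a, b]%classic * @lebesgue_measure R `]c, e]%classic)%E.
  exact: (product_measure1E _ _ (mI _ _) (mI _ _)).
by rewrite !E// -EFinM.
Qed.

Lemma leb2_rect_lty a b c e : (mu (rect a b c e) < +oo)%E.
Proof.
apply: (@le_lt_trans _ _ (mu (rect (a - `|b|) (a + `|b - a|) (c - `|e|) (c + `|e - c|)))).
  apply: le_measure; rewrite ?inE; try exact: measurable_rect.
  move=> [x y] /= [] /=; rewrite !in_itv/= => /andP[ax xb] /andP[cy ye].
  have h1 : a - `|b| <= a by have := normr_ge0 b; lra.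
  have h2 : b <= a + `|b - a| by have := ler_norm (b - a); lra.
  have h3 : c - `|e| <= c by have := normr_ge0 e; lra.
  have h4 : e <= c + `|e - c| by have := ler_norm (e - c); lra.
  split; rewrite /= in_itv/=; apply/andP; split.
  - exact: le_lt_trans h1 ax.
  - exact: le_trans xb h2.
  - exact: le_lt_trans h3 cy.
  - exact: le_trans ye h4.
rewrite leb2_rect ?ltry//.
- by have := normr_ge0 b; have := normr_ge0 (b - a); lra.
- by have := normr_ge0 e; have := normr_ge0 (e - c); lra.
Qed.

Lemma L2_indic_rect a b c e : L2 (\1_(rect a b c e)).
Proof.
have mi := measurable_indic (R := R) (D := setT) (measurable_rect a b c e).
apply: L2P => //; apply/integrableP; split.
  by apply/measurable_EFinP; exact: measurable_funM.
under eq_integral => x _.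
  rewrite gee0_abs ?lee_fin ?mulr_ge0// indicE -natrM mulnb andbb -indicE.
  over.
rewrite integral_indic ?setIT ?leb2_rect_lty//; exact: measurable_rect.
Qed.

Lemma ip_indic_rect a b c e (u : plane -> R) : L2 u ->
  (\int[mu]_(x in rect a b c e) (u x)%:E = (ip mu \1_(rect a b c e) u)%:E)%E.
Proof.
move=> lu; have i1 := L2_mul_integrable (L2_indic_rect a b c e) lu.
rewrite /ip /Rintegral fineK; last exact: integrable_fin_num.
rewrite [LHS]integral_mkcond; apply: eq_integral => x _.
by rewrite patchE indicE; case: (x \in _); rewrite ?mul1r ?mul0r.
Qed.

(** A square-integrable function is integrable on each square centred at the
    origin, to which [integral0_dynkin] applies; these squares exhaust the
    plane. *)
Lemma ae0_of_rects (u : plane -> R) : L2 u ->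
  (forall a b c e, ip mu \1_(rect a b c e) u = 0) ->
  {ae mu, forall x, u x = 0}.
Proof.
move=> lu u0; have mu_ := L2_measurable lu.
pose B (n : nat) := rect (- n%:R) n%:R (- n%:R) n%:R.
have mB n : measurable (B n) by exact: measurable_rect.
have aeB n : {ae mu, forall x, B n x -> u x = 0}.
  have iB : mu.-integrable (B n) (EFin \o u).
    have := L2_mul_integrable (L2_indic_rect (- n%:R) n%:R (- n%:R) n%:R) lu.
    move=> h; apply/integrable_mkcond => //; apply: eq_integrable h => // x _.
    by rewrite patchE indicE; case: (x \in _); rewrite ?mul1r ?mul0r.
  have h : forall S, measurable S -> (\int[mu]_(x in S `&` B n) (u x)%:E = 0)%E.
    apply: (integral0_dynkin measurable_rects rectsI (mB n) iB).
      by rewrite ip_indic_rect// u0.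
    move=> S rS; have /rectsP[a [b [c [e ->]]]] := rectsI rS (rects_rect (- n%:R) n%:R (- n%:R) n%:R).
    by rewrite ip_indic_rect// u0.
  have : ae_eq mu (B n) (EFin \o u) (cst 0%E).
    apply: integral_ae_eq => // E EB mE.
    by rewrite integral0 -(setIidl EB); exact: h.
  by apply: filterS => x /= h' Bx; have [] := h' Bx.
have : {ae mu, forall x n, B n x -> u x = 0} by apply/ae_foralln.
apply: filterS => x /(_ (Num.truncn (`|x.1| + `|x.2|)).+1); apply.
have := truncnS_gt (`|x.1| + `|x.2|); set N := _.+1%:R => hN.
have h1 : `|x.1| < N by apply: le_lt_trans hN; rewrite lerDl.
have h2 : `|x.2| < N by apply: le_lt_trans hN; rewrite lerDr.
move: h1 h2; rewrite !ltr_norml => /andP[p1 p2] /andP[p3 p4].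
by split => /=; rewrite in_itv/= ?p1 ?p3 ltW.
Qed.

End Rectangles.

(** * Plancherel's theorem *)

Section RectangleEnergy.
Context {R : realType}.
Local Notation plane := (measurableTypeR R * measurableTypeR R)%type.
Local Notation leb := (@lebesgue_measure R).
Local Notation mu := (@leb2 R).
Local Notation L2 f := (f \in Lfun mu 2%:E).
Implicit Types (a b c e x y v dlt : R) (u g : plane -> R).

Lemma integrable_kern_shift v x : 0 < v -> leb.-integrable setT (fun y => (kern v (x - y))%:E).
Proof.
move=> v0; apply/integrableP; split.
  apply/measurable_EFinP; apply: (measurableT_comp (measurable_kern v0)).
  exact: measurable_funB.
under eq_integral.
  move=> y _; rewrite gee0_abs; last by rewrite lee_fin; have /andP[] := kern_itv (x - y) v0.
  over.
by rewrite integral_kern_shift// ltry.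
Qed.

Lemma kern_mass_ge0 v dlt : 0 < v -> 0 < dlt -> 0 <= kern_mass v dlt.
Proof.
move=> v0 d0; rewrite -lee_fin -integral_kern_itv//; apply: integral_ge0 => y _.
by rewrite lee_fin; have /andP[] := kern_itv y v0.
Qed.

Let kern_itv_ge v dlt a b x : 0 < v -> 0 < dlt -> a + dlt < x -> x <= b - dlt ->
  leb.-integrable setT (EFin \o (fun y => \1_(`]a, b]%classic) y * kern v (x - y))) /\
  kern_mass v dlt <= \int[leb]_y (\1_(`]a, b]%classic) y * kern v (x - y)).
Proof.
move=> v0 d0 ax xb.
have mI : measurable (`]a, b]%classic : set (measurableTypeR R)) by exact: measurable_itv.
have ik := integrable_kern_shift x v0.
have E : (fun y => (\1_(`]a, b]%classic) y * kern v (x - y))%:E) =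
    (fun y => (kern v (x - y))%:E) \_ (`]a, b]%classic).
  by apply/funext => y; rewrite patchE indicE; case: (y \in _); rewrite ?mul1r ?mul0r.
have i1 : leb.-integrable setT (EFin \o (fun y => \1_(`]a, b]%classic) y * kern v (x - y))).
  rewrite (_ : EFin \o _ = (fun y => (kern v (x - y))%:E) \_ (`]a, b]%classic)); last exact: E.
  apply/(integrable_mkcond _ mI); exact: (integrableS measurableT mI (@subsetT _ _) ik).
split => //; rewrite -lee_fin /Rintegral fineK; last exact: integrable_fin_num i1.
rewrite E -integral_mkcond; apply: kern_mass_le => // y /=.
by rewrite !in_itv/= => /andP[y1 y2]; apply/andP; split; lra.
Qed.

Lemma integrable_indic_rect a b c e : mu.-integrable setT (EFin \o \1_(rect a b c e)).
Proof.
apply/integrableP; split.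
  by apply/measurable_EFinP; apply: measurable_indic; exact: measurable_rect.
under eq_integral do rewrite gee0_abs ?lee_fin//.
by rewrite integral_indic ?setIT ?leb2_rect_lty//; exact: measurable_rect.
Qed.

Lemma indic_rectE a b c e (z : plane) :
  \1_(rect a b c e) z = \1_(`]a, b]%classic) z.1 * \1_(`]c, e]%classic) z.2 :> R.
Proof.
by rewrite !indicE -natrM mulnb /rect; congr ((nat_of_bool _)%:R); apply/idP/andP; rewrite !inE /= => -[].
Qed.

(** At a point of the rectangle at distance more than [dlt] from the boundary, the
    kernel form is at least the square of the one-dimensional mass carried by
    [[- dlt, dlt]]. *)
Lemma hartley_rect_mass v dlt a b c e : 0 < v -> 0 < dlt ->
  a + dlt <= b - dlt -> c + dlt <= e - dlt ->
  kern_mass v dlt ^+ 2 * ((b - a - 2 * dlt) * (e - c - 2 * dlt)) <=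
  \int[mu]_xi (wt2 v v xi * hartley \1_(rect a b c e) xi ^+ 2).
Proof.
move=> v0 d0 ab ce; rewrite weighted_energyE//; last exact: integrable_indic_rect.
set m := kern_mass v dlt; have m0 : 0 <= m by exact: kern_mass_ge0.
set S := rect (a + dlt) (b - dlt) (c + dlt) (e - dlt).
have -> : m ^+ 2 * ((b - a - 2 * dlt) * (e - c - 2 * dlt)) = \int[mu]_x (m ^+ 2 * \1_S x).
  rewrite RintegralZl//; last exact: integrable_indic_rect.
  rewrite /Rintegral integral_indic ?setIT//; last exact: measurable_rect.
  transitivity (m ^+ 2 * fine (((b - dlt - (a + dlt)) * (e - dlt - (c + dlt)))%:E)).
    by congr (_ * _); rewrite /=; congr (_ * _); ring.
  by congr (_ * fine _); exact/esym/leb2_rect.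
apply: le_Rintegral => //.
- have := integrableZl measurableT (m ^+ 2) (integrable_indic_rect (a + dlt) (b - dlt) (c + dlt) (e - dlt)).
  by apply: eq_integrable => // x _; rewrite EFinM.
- exact: (integrable_kern2_form v0 v0 (integrable_indic_rect a b c e)).
move=> x _; rewrite {1}indicE; case: (boolP (x \in S)) => [|_]; last first.
  rewrite mulr0 mulr_ge0//; apply: Rintegral_ge0 => y _; rewrite mulr_ge0//.
  by have /andP[] := kern2_itv x y v0 v0.
rewrite inE => -[/=]; rewrite !in_itv/= => /andP[ax xb] /andP[cx xe].
have [i1 m1] := kern_itv_ge v0 d0 ax xb.
have [i2 m2] := kern_itv_ge v0 d0 cx xe.
have -> : \1_(rect a b c e) x = 1 :> R.
  rewrite indicE mem_set//; split => /=; rewrite in_itv/=; apply/andP; split.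
  - by apply: le_lt_trans ax; rewrite lerDl ltW.
  - by apply: le_trans xb _; rewrite gerBl ltW.
  - by apply: le_lt_trans cx; rewrite lerDl ltW.
  - by apply: le_trans xe _; rewrite gerBl ltW.
rewrite mulr1 mul1r.
rewrite (_ : (\int[mu]_y _) = (\int[leb]_y (\1_(`]a, b]%classic) y * kern v (x.1 - y))) *
   (\int[leb]_y (\1_(`]c, e]%classic) y * kern v (x.2 - y)))).
  by rewrite expr2 ler_pM.
rewrite -(Rintegral_leb2_mul i1 i2); apply: eq_Rintegral => y _.
by rewrite indic_rectE /kern2; ring.
Qed.

(** The energy dominates every weighted energy; the width of the kernel tends to
    [0] first, and the margin [dlt] next. *)
Lemma hartley_rect_ge a b c e : a < b -> c < e ->
  plancherel_cst * ((b - a) * (e - c)) <= sq mu (hartley \1_(rect a b c e)).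
Proof.
move=> ab ce; set h := \1_(rect a b c e).
have ih : mu.-integrable setT (EFin \o h) by exact: integrable_indic_rect.
have [lH _] := hartley_bounded ih (L2_indic_rect a b c e).
have np n : 0 < n.+1%:R^-1 :> R by rewrite invr_gt0.
have key n dlt : 0 < dlt -> a + dlt <= b - dlt -> c + dlt <= e - dlt ->
    kern_mass n.+1%:R^-1 dlt ^+ 2 * ((b - a - 2 * dlt) * (e - c - 2 * dlt)) <= sq mu (hartley h).
  move=> d0 abd ced; apply: le_trans (hartley_rect_mass (np n) d0 abd ced) _.
  apply: le_Rintegral => //.
  - exact: (integrable_weighted (np n) (np n) ih).
  - exact: L2_mul_integrable.
  - move=> xi _; rewrite -expr2 -[leRHS]mul1r ler_wpM2r ?sqr_ge0//.
    by have /andP[] := wt2_itv xi (np n) (np n).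
have key2 dlt : 0 < dlt -> a + dlt <= b - dlt -> c + dlt <= e - dlt ->
    plancherel_cst * ((b - a - 2 * dlt) * (e - c - 2 * dlt)) <= sq mu (hartley h).
  move=> d0 abd ced.
  have cv : kern_mass n.+1%:R^-1 dlt ^+ 2 * ((b - a - 2 * dlt) * (e - c - 2 * dlt)) @[n --> \oo]
      --> plancherel_cst * ((b - a - 2 * dlt) * (e - c - 2 * dlt)).
    apply: cvgMl; rewrite /plancherel_cst; apply: (cvg_comp _ (fun x : R => x ^+ 2) (cvg_kern_mass d0)).
    exact: exprn_continuous.
  rewrite -(cvg_lim (@Rhausdorff R) cv); apply: limr_le; first by apply/cvg_ex; eexists; exact: cv.
  by apply: nearW => n; exact: key.
have cv : plancherel_cst * ((b - a - 2 * n.+1%:R^-1) * (e - c - 2 * n.+1%:R^-1)) @[n --> \oo]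
      --> plancherel_cst * ((b - a - 2 * 0) * (e - c - 2 * 0)).
  apply: cvgMr; apply: cvgM; (apply: cvgB; first exact: cvg_cst); apply: cvgMr; exact: cvg_harmonic.
rewrite !mulr0 !subr0 in cv.
rewrite -(cvg_lim (@Rhausdorff R) cv); apply: limr_le; first by apply/cvg_ex; eexists; exact: cv.
have near_small d : 0 < d -> \forall n \near \oo, n.+1%:R^-1 < d :> R.
  by move=> d0; apply: (cvgr_lt 0 (@cvg_harmonic R)).
have d1 : 0 < (b - a) / 2 by rewrite divr_gt0// subr_gt0.
have d2 : 0 < (e - c) / 2 by rewrite divr_gt0// subr_gt0.
near=> n; apply: key2 => //.
- have : n.+1%:R^-1 < (b - a) / 2 by near: n; exact: near_small.
  by move: (n.+1%:R^-1 : R) => q; lra.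
- have : n.+1%:R^-1 < (e - c) / 2 by near: n; exact: near_small.
  by move: (n.+1%:R^-1 : R) => q; lra.
Unshelve. all: by end_near. Qed.

End RectangleEnergy.

Section Plancherel.
Context {R : realType}.
Local Notation plane := (measurableTypeR R * measurableTypeR R)%type.
Local Notation mu := (@leb2 R).
Local Notation L2 f := (f \in Lfun mu 2%:E).
Implicit Types (a b c e : R) (f g h A B G K H : plane -> R).

Lemma is_hartley_integrable h : mu.-integrable setT (EFin \o h) -> L2 h ->
  is_hartley h (hartley h).
Proof.
move=> ih lh; have [lH _] := hartley_bounded ih lh; split => //.
have it n := integrable_trunc n lh.
apply: (@squeeze_cvgr _ _ _ _ (fun=> 0) (fun n => plancherel_cst * sq mu (fun x => trunc n h x - h x))).
- apply: nearW => n; rewrite sq_ge0/=.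
  have E : (fun x => hartley (trunc n h) x - hartley h x) =
      hartley (fun x => trunc n h x + -1 * h x).
    by rewrite hartleyD//; apply/funext => x; ring.
  have i2 : mu.-integrable setT (EFin \o (fun x => trunc n h x + -1 * h x)).
    have := integrableB measurableT (it n) ih.
    by apply: eq_integrable => // x _; rewrite /= mulN1r.
  have l2 : L2 (fun x => trunc n h x + -1 * h x).
    by apply: L2D; [exact: L2_trunc|apply: L2Z].
  have [_ hb] := hartley_bounded i2 l2.
  rewrite E; apply: le_trans hb _; rewrite le_eqVlt; apply/orP; left; apply/eqP.
  by congr (_ * sq mu _); apply/funext => x; rewrite mulN1r.
- exact: cvg_cst.
- by rewrite -[X in _ --> X](mulr0 plancherel_cst); apply: cvgMr; exact: trunc_cvg2.
Qed.

Lemma is_hartleyZ c f A : is_hartley f A -> is_hartley (fun x => c * f x) (fun x => c * A x).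
Proof.
move=> hf; have := is_hartleyD (c - 1) hf hf.
have E (u : plane -> R) : (fun x => u x + (c - 1) * u x) = (fun x => c * u x).
  by apply/funext => x; ring.
by rewrite !E.
Qed.

Lemma quadratic_eq0 (c d : R) : 0 <= d -> (forall t, 2 * t * c <= t ^+ 2 * d) -> c = 0.
Proof.
move=> d0 hc; have d1 : 0 < d + 1 by rewrite ltr_wpDl.
(* nearly the optimal [t = c / d], with a denominator that is never zero *)
have := hc (c / (d + 1)).
have -> : 2 * (c / (d + 1)) * c = (2 * c ^+ 2 * (d + 1)) / (d + 1) ^+ 2.
  by field; rewrite lt0r_neq0.
rewrite expr_div_n [leRHS]mulrAC ler_pM2r ?invr_gt0 ?exprn_gt0// => h.
have c2 : c ^+ 2 = 0.
  apply/eqP; rewrite eq_le sqr_ge0 andbT.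
  have := mulr_ge0 (sqr_ge0 c) d0; lra.
by apply/eqP; rewrite -sqrf_eq0 c2.
Qed.

(** The quadratic form [plancherel_cst * sq f - sq (hartley f)] is nonnegative
    and vanishes at the indicator [h] of a rectangle. Evaluated at [h + t g] it
    is a nonnegative polynomial in [t] without constant term, so its linear
    coefficient vanishes. *)
Lemma ip_hartley_rect a b c e g G : is_hartley g G ->
  ip mu (hartley \1_(rect a b c e)) G = plancherel_cst * ip mu \1_(rect a b c e) g.
Proof.
move=> hg; have [lg lG _] := hg; set h := \1_(rect a b c e).
have ih : mu.-integrable setT (EFin \o h) by exact: integrable_indic_rect.
have lh : L2 h by exact: L2_indic_rect.
have hh := is_hartley_integrable ih lh; have [_ lA _] := hh.
set A := hartley h in lA hh *.
have AE : sq mu A = plancherel_cst * sq mu h.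
  apply/eqP; rewrite eq_le is_hartley_le//=.
  have [ab|ba] := ltP a b; last first.
    rewrite (_ : sq mu h = 0) ?mulr0 ?sq_ge0// /sq /ip.
    rewrite (_ : h = fun=> 0); first by rewrite mulr0 /Rintegral integral0.
    apply/funext => x; rewrite /h indicE memNset// => -[/=]; rewrite in_itv/= => /andP[ax xb].
    by move: (lt_le_trans ax (le_trans xb ba)); rewrite ltxx.
  have [ce|ec] := ltP c e; last first.
    rewrite (_ : sq mu h = 0) ?mulr0 ?sq_ge0// /sq /ip.
    rewrite (_ : h = fun=> 0); first by rewrite mulr0 /Rintegral integral0.
    apply/funext => x; rewrite /h indicE memNset// => -[_ /=]; rewrite in_itv/= => /andP[ax xb].
    by move: (lt_le_trans ax (le_trans xb ec)); rewrite ltxx.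
  apply: le_trans (hartley_rect_ge ab ce); rewrite ler_pM2l ?plancherel_cst_gt0//.
  rewrite -lee_fin -sq_EFin// le_eqVlt; apply/orP; left; apply/eqP.
  transitivity (\int[mu]_x (h x)%:E)%E.
    by apply: eq_integral => x _; rewrite /h indicE -natrM mulnb andbb.
  rewrite /h integral_indic ?setIT//; last exact: measurable_rect.
  by apply: leb2_rect; exact: ltW.
apply/eqP; rewrite -subr_eq0; apply/eqP.
apply: (@quadratic_eq0 _ (plancherel_cst * sq mu g - sq mu G)).
  by rewrite subr_ge0 is_hartley_le.
move=> t; have := is_hartley_le (is_hartleyD t hh hg).
have ltG : L2 (fun x => t * G x) by exact: L2Z.
have ltg : L2 (fun x => t * g x) by exact: L2Z.
rewrite !sqD// !sqZ// !ipZr// AE.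
have : 0 = 0 :> R by []. lra.
Qed.

(** By symmetry, pairing [K] with the indicator of a rectangle is pairing [G]
    with the transform of this indicator, which [ip_hartley_rect] evaluates. *)
Lemma hartley_involution g G K : is_hartley g G -> is_hartley G K ->
  {ae mu, forall x, K x = plancherel_cst * g x}.
Proof.
move=> hg hG; have [lg lG _] := hg; have [_ lK _] := hG.
have lkg : L2 (fun x => plancherel_cst * g x) by exact: L2Z.
have : {ae mu, forall x, K x - plancherel_cst * g x = 0}.
  apply: ae0_of_rects; first exact: L2B.
  move=> a b c e; have lh := L2_indic_rect a b c e.
  rewrite ipBr// ipZr// -(ip_hartley_rect _ _ _ _ hg).
  have hh := is_hartley_integrable (integrable_indic_rect a b c e) lh.
  by rewrite (is_hartley_sym hh hG) subrr.
by apply: filterS => x /eqP; rewrite subr_eq0 => /eqP.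
Qed.

(** The transform is symmetric and its square is [plancherel_cst]. *)
Lemma plancherel g G : is_hartley g G -> sq mu G = plancherel_cst * sq mu g.
Proof.
move=> hg; have [lg lG _] := hg; have [K hG] := is_hartley_ex lG.
have hK := is_hartley_ae (L2Z plancherel_cst lg) (hartley_involution hg hG) hG.
by rewrite {1}/sq (is_hartley_sym hg hK) ipZr.
Qed.

(** A preimage is the transform itself divided by [plancherel_cst]. *)
Lemma hartley_surjective H : L2 H -> exists g, is_hartley g H.
Proof.
move=> lH; have [B hH] := is_hartley_ex lH; have [_ lB _] := hH.
have [K hB] := is_hartley_ex lB.
have hK := is_hartley_ae (L2Z plancherel_cst lH) (hartley_involution hH hB) hB.
exists (fun x => plancherel_cst^-1 * B x); have := is_hartleyZ plancherel_cst^-1 hK.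
rewrite (_ : (fun x => plancherel_cst^-1 * (plancherel_cst * H x)) = H)//.
by apply/funext => x; rewrite mulKf// lt0r_neq0// plancherel_cst_gt0.
Qed.

End Plancherel.

Local Open Scope complex_scope.

(** * Fourier and Hartley transforms of real functions *)

Section FourierHartley.
Context {R : realType}.
Local Notation plane := (measurableTypeR R * measurableTypeR R)%type.
Local Notation leb := (@lebesgue_measure R).
Local Notation mu := (@leb2 R).
Local Notation L2 f := (f \in Lfun mu 2%:E).
Implicit Types (f g h A B : plane -> R) (x z xi : plane) (F : plane -> R[i]).

Definition neg z : plane := (- z.1, - z.2).

Lemma measurable_neg : measurable_fun setT neg.
Proof.
apply/measurable_fun_pairP; split; rewrite /comp /=.
  apply: measurable_funN; exact: measurable_fst.
apply: measurable_funN; exact: measurable_snd.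
Qed.

Lemma integral_neg (G : plane -> \bar R) : measurable_fun setT G -> (forall z, (0 <= G z)%E) ->
  (\int[mu]_z G (neg z) = \int[mu]_z G z)%E.
Proof.
move=> mG G0.
rewrite (integral_leb2 (measurableT_comp mG measurable_neg) (fun z => G0 (neg z))).
rewrite (integral_leb2 mG G0).
transitivity (\int[leb]_s \int[leb]_t G (0 - s, t)%R)%E.
  apply: eq_integral => s _; rewrite -(@integral_reflect _ 0 (fun t => G (0 - s, t)%R))//.
    by apply: eq_integral => t _; rewrite /neg /= !sub0r.
  exact: (measurableT_comp mG (pair1_measurable _)).
rewrite (@integral_reflect _ 0 (fun s => \int[leb]_t G (s, t))%E)//.
  exact: (measurable_fun_fubini_tonelli_F G).
by move=> s; exact: integral_ge0.
Qed.

Definition refl A : plane -> R := fun z => A (neg z).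

Lemma measurable_refl A : measurable_fun setT A -> measurable_fun setT (refl A).
Proof. by move=> mA; exact: (measurableT_comp mA measurable_neg). Qed.

Lemma L2_refl A : L2 A -> L2 (refl A) /\ sq mu (refl A) = sq mu A.
Proof.
move=> lA; have mA := L2_measurable lA.
have E : (\int[mu]_z (refl A z * refl A z)%:E = \int[mu]_z (A z * A z)%:E)%E.
  apply: (integral_neg (G := fun z => (A z * A z)%:E)).
    by apply/measurable_EFinP; exact: measurable_funM.
  by move=> z; rewrite lee_fin -expr2 sqr_ge0.
split; last by rewrite /sq /ip /Rintegral E.
apply: L2P; first exact: measurable_refl.
apply/integrableP; split.
  by apply/measurable_EFinP; apply: measurable_funM; exact: measurable_refl.
under eq_integral do rewrite gee0_abs ?lee_fin -?expr2 ?sqr_ge0// expr2.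
by rewrite E sq_EFin// ltry.
Qed.

Definition evenp A : plane -> R := fun z => (A z + refl A z) / 2.
Definition oddp A : plane -> R := fun z => (A z - refl A z) / 2.

Lemma measurable_trig_dot (t : R -> R) xi : continuous t ->
  measurable_fun setT (fun x => t (dot x xi)).
Proof.
move=> ct; apply: (measurableT_comp (continuous_measurable_fun ct)).
exact: (measurableT_comp measurable_dot (pair2_measurable xi)).
Qed.

Lemma integrable_mul_trig (t : R -> R) g xi : continuous t -> (forall s, `|t s| <= 1) ->
  mu.-integrable setT (EFin \o g) -> mu.-integrable setT (EFin \o (fun x => g x * t (dot x xi))).
Proof.
move=> ct t1 ig; apply: (le_integrable measurableT _ _ ig) => /=.
  apply/measurable_EFinP; apply: measurable_funM; last exact: measurable_trig_dot.
  by apply/measurable_EFinP; exact: measurable_int ig.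
by move=> x _; rewrite lee_fin normrM -[leRHS]mulr1 ler_wpM2l.
Qed.

(** Against [cas], the even part of the transform is the cosine integral and
    the odd part is the sine integral. *)
Lemma fourier_ballE n f xi : L2 f ->
  fourier_ball n f xi = evenp (hartley (trunc n f)) xi -i* oddp (hartley (trunc n f)) xi.
Proof.
move=> lf; set g := trunc n f; have ig : mu.-integrable setT (EFin \o g) by exact: integrable_trunc.
have ic := integrable_mul_trig xi (@continuous_cos R) (@normr_cos_le1 R) ig.
have is_ := integrable_mul_trig xi (@continuous_sin R) (@normr_sin_le1 R) ig.
have H1 : hartley g xi = \int[mu]_x (g x * cos (dot x xi)) + \int[mu]_x (g x * sin (dot x xi)).
  by rewrite -RintegralD//; apply: eq_Rintegral => x _; rewrite /cas mulrDr.
have H2 : hartley g (neg xi) = \int[mu]_x (g x * cos (dot x xi)) - \int[mu]_x (g x * sin (dot x xi)).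
  rewrite -RintegralB//; apply: eq_Rintegral => x _; rewrite /cas.
  have -> : dot x (neg xi) = - dot x xi by rewrite /dot /neg /=; ring.
  by rewrite cosN sinN mulrDr mulrN.
have E (t : R -> R) : \int[mu]_(x in disk n) (f x * t (dot x xi)) = \int[mu]_x (g x * t (dot x xi)).
  rewrite Rintegral_mkcond; apply: eq_Rintegral => x _.
  by rewrite /g /trunc !patchE; case: ifP; rewrite ?mul0r.
rewrite /fourier_ball /evenp /oddp /refl H1 H2.
rewrite [X in X -i* _](E (@cos R)) [X in _ -i* X](E (@sin R)).
by congr (_ -i* _); field.
Qed.

Lemma Lnorm2E f : L2 f -> Lp_norm 2%:E f = (Num.sqrt (sq mu f))%:E.
Proof.
move=> lf; have := Lnorm2_sq lf; have := Lnorm_ge0 mu 2%:E (EFin \o f).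
rewrite -[X in (0 <= X)%E]/(Lp_norm 2%:E f) -[X in (X ^+ 2)%E]/(Lp_norm 2%:E f).
case: (Lp_norm 2%:E f) => [r r0 [] h|_|//].
  by rewrite -h -expr2 sqrtr_sqr ger0_norm.
by rewrite expe2 mulyy.
Qed.

Lemma L2_evenp A : L2 A -> L2 (evenp A).
Proof.
move=> lA; have [lr _] := L2_refl lA.
have -> : evenp A = fun z => 2^-1 * (A z + refl A z) by apply/funext => z; rewrite mulrC.
by apply: L2Z; exact: L2D.
Qed.

Lemma L2_oddp A : L2 A -> L2 (oddp A).
Proof.
move=> lA; have [lr _] := L2_refl lA.
have -> : oddp A = fun z => 2^-1 * (A z - refl A z) by apply/funext => z; rewrite mulrC.
by apply: L2Z; exact: L2B.
Qed.

(** Splits the complex mean-square error of the Fourier transform into its real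
    and imaginary parts, so that it can be compared with the error of the
    Hartley transform. *)
Lemma fourier_error n f F (D := fun xi => ComplexField.Normc.normc (F xi - fourier_ball n f xi))
  (Ec := fun xi => complex.Re (F xi) - evenp (hartley (trunc n f)) xi)
  (Es := fun xi => complex.Im (F xi) + oddp (hartley (trunc n f)) xi) :
  L2 f -> L2 (fun xi => complex.Re (F xi)) -> L2 (fun xi => complex.Im (F xi)) ->
  [/\ L2 Ec, L2 Es, L2 D & sq mu D = sq mu Ec + sq mu Es].
Proof.
move=> lf lR lI; have lH := L2_hartley_trunc n lf.
have lc : L2 Ec by apply: L2B => //; exact: L2_evenp.
have ls : L2 Es by apply: L2D => //; exact: L2_oddp.
have mc := L2_measurable lc; have ms := L2_measurable ls.
have DE xi : D xi = Num.sqrt (Ec xi ^+ 2 + Es xi ^+ 2).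
  rewrite /D fourier_ballE// /Ec /Es; case: (F xi) => u v /=.
  by rewrite opprK.
have D2 xi : D xi * D xi = Ec xi * Ec xi + Es xi * Es xi.
  by rewrite DE -expr2 sqr_sqrtr ?addr_ge0 ?sqr_ge0// !expr2.
have mD : measurable_fun setT D.
  rewrite (_ : D = fun xi => Num.sqrt (Ec xi ^+ 2 + Es xi ^+ 2)); last exact/funext.
  apply: (measurableT_comp (continuous_measurable_fun (@sqrt_continuous R))).
  by apply: measurable_funD; apply: measurable_funX.
have ic := L2_mul_integrable lc lc; have is_ := L2_mul_integrable ls ls.
split => //.
- apply: L2P => //; have := integrableD measurableT ic is_.
  by apply: eq_integrable => // xi _; rewrite D2.
- rewrite /sq /ip -RintegralD//.
  by apply: eq_Rintegral => xi _; rewrite D2.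
Qed.

(** The real part of the Fourier transform is the even part of the Hartley
    transform, and the imaginary part the opposite of its odd part. *)
Lemma is_fourier_hartley f F : is_fourier f F ->
  is_hartley f (fun xi => complex.Re (F xi) - complex.Im (F xi)).
Proof.
move=> [lf lR lI cF].
have lf' : L2 f by exact: lf.
have lR' : L2 (fun xi => complex.Re (F xi)) by exact: lR.
have lI' : L2 (fun xi => complex.Im (F xi)) by exact: lI.
split => //; first exact: L2B.
pose D n xi := ComplexField.Normc.normc (F xi - fourier_ball n f xi).
have D0 : sq mu (D n) @[n --> \oo] --> (0 : R).
  have h : Num.sqrt (sq mu (D n)) @[n --> \oo] --> (0 : R).
    move: cF; rewrite (_ : (fun n => _) = (fun n => (Num.sqrt (sq mu (D n)))%:E)).
      by move=> /fine_cvg.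
    by apply/funext => n; rewrite Lnorm2E//; have [] := fourier_error n lf' lR' lI'.
  rewrite (_ : (fun n => _) = (fun n => Num.sqrt (sq mu (D n)) * Num.sqrt (sq mu (D n)))).
    by rewrite -[X in _ --> X](mulr0 0); exact: cvgM.
  by apply/funext => n; rewrite -expr2 sqr_sqrtr ?sq_ge0.
apply: (@squeeze_cvgr _ _ _ _ (fun=> 0) (fun n => 2 * sq mu (D n))).
- apply: nearW => n; rewrite sq_ge0/=.
  have [lc ls _ ->] := fourier_error n lf' lR' lI'.
  rewrite [X in sq mu X <= _](_ : _ = fun xi =>
      (complex.Im (F xi) + oddp (hartley (trunc n f)) xi) +
      -1 * (complex.Re (F xi) - evenp (hartley (trunc n f)) xi)).
    apply: le_trans (sqD_le ls (L2Z (-1) lc)) _.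
    by rewrite (sqZ (-1) lc) sqrrN expr1n mul1r -mulrDr addrC.
  by apply/funext => xi; rewrite /evenp /oddp; field.
- exact: cvg_cst.
- by rewrite -[X in _ --> X](mulr0 2); exact: cvgMr.
Qed.

Definition fourier_of A : plane -> R[i] := fun xi => evenp A xi -i* oddp A xi.

(** Even and odd parts are orthogonal, so the error of the Fourier transform
    has exactly the norm of the error of the Hartley transform. *)
Lemma is_hartley_fourier f A : is_hartley f A -> is_fourier f (fourier_of A).
Proof.
move=> [lf lA cA].
have lR : L2 (fun xi => complex.Re (fourier_of A xi)) by exact: L2_evenp.
have lI : L2 (fun xi => complex.Im (fourier_of A xi)).
  rewrite (_ : (fun xi => _) = fun xi => -1 * oddp A xi).
    by apply: L2Z; exact: L2_oddp.
  by apply/funext => xi; rewrite mulN1r.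
split => //.
rewrite (_ : (fun n => _) = (fun n => (Num.sqrt (sq mu (fun xi => hartley (trunc n f) xi - A xi)))%:E)).
  by apply: cvg_EFin; [exact: nearW|exact: sqrt_cvg0].
apply/funext => n; have [lc ls lD sD] := fourier_error n lf lR lI.
rewrite Lnorm2E//; congr (Num.sqrt _)%:E; rewrite sD.
have lH := L2_hartley_trunc n lf.
pose B xi := hartley (trunc n f) xi - A xi.
have lB : L2 B by exact: L2B.
have [lrB srB] := L2_refl lB.
rewrite (_ : (fun xi => complex.Re _ - _) = fun xi => - 2^-1 * (B xi + refl B xi)); last first.
  by apply/funext => xi; rewrite /= /evenp /B /refl; field.
rewrite (_ : (fun xi => complex.Im _ + _) = fun xi => 2^-1 * (B xi - refl B xi)); last first.
  by apply/funext => xi; rewrite /= /oddp /B /refl; field.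
rewrite !sqZ; [|exact: L2B|exact: L2D].
by rewrite sqD// sqB// srB; field.
Qed.

End FourierHartley.

(** * Fourier multipliers through the Hartley transform *)

Section Multipliers.
Context {R : realType}.
Local Notation plane := (measurableTypeR R * measurableTypeR R)%type.
Local Notation mu := (@leb2 R).
Local Notation L2 f := (f \in Lfun mu 2%:E).
Implicit Types (f g h A B : plane -> R) (x z xi : plane) (r : plane -> R).

Lemma L2_ae A B : measurable_fun setT B -> L2 A -> {ae mu, forall x, A x = B x} -> L2 B.
Proof.
move=> mB lA AB; have mA := L2_measurable lA.
apply: L2P => //; apply/integrableP; split.
  by apply/measurable_EFinP; exact: measurable_funM.
have /integrableP[_] := L2_mul_integrable lA lA; apply: le_lt_trans.
rewrite le_eqVlt; apply/orP; left; apply/eqP; apply: ae_eq_integral => //.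
- by apply: measurableT_comp => //; apply/measurable_EFinP; exact: measurable_funM.
- by apply: measurableT_comp => //; apply/measurable_EFinP; exact: measurable_funM.
- by apply: filterS AB => x ->.
Qed.

(** A real symbol acts in the same way on the real and imaginary parts. *)
Lemma is_multiplier_hartley r f g A : measurable_fun setT r -> is_hartley f A ->
  is_multiplier (fun xi => (r xi)%:C) f g -> is_hartley g (fun xi => r xi * A xi).
Proof.
move=> mr hA [lg [F [G [hF hG FG]]]].
have hF' := is_fourier_hartley hF; have hG' := is_fourier_hartley hG.
have [_ lA _] := hA; have [_ lG _] := hG'.
have ae : {ae mu, forall xi, complex.Re (G xi) - complex.Im (G xi) = r xi * A xi}.
  have FG' : {ae mu, forall xi, G xi = (r xi)%:C * F xi} by exact: FG.
  apply: filterS2 FG' (is_hartley_unique hA hF') => xi -> ->.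
  by case: (F xi) => u v /=; ring.
apply: (is_hartley_ae _ ae hG'); apply: (L2_ae _ lG ae).
by apply: measurable_funM => //; exact: L2_measurable lA.
Qed.

(** The candidate is the function whose transform is [r * A]. The symbol has to
    be even in order to commute with taking even and odd parts. *)
Lemma hartley_multiplier_dom r f A : (forall xi, r (neg xi) = r xi) -> is_hartley f A ->
  L2 (fun xi => r xi * A xi) -> multiplier_dom (fun xi => (r xi)%:C) f.
Proof.
move=> rN hA lrA; have [g hg] := hartley_surjective lrA.
have [lg _ _] := hg; exists g; split; first exact: lg.
exists (fourier_of A), (fourier_of (fun xi => r xi * A xi)); split.
- exact: is_hartley_fourier hA.
- exact: is_hartley_fourier hg.
- apply: aeW => xi; rewrite /fourier_of /evenp /oddp /refl rN.
  by apply/eqP; rewrite eq_complex /=; apply/andP; split; apply/eqP; field.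
Qed.

Lemma multiplierP (m : plane -> R[i]) f : multiplier_dom m f -> is_multiplier m f (multiplier m f).
Proof. by move=> [g hg]; rewrite /multiplier; exact: (getPex (ex_intro _ g hg)). Qed.

Lemma multiplier_dom_hartley (m : plane -> R[i]) f : multiplier_dom m f -> exists A, is_hartley f A.
Proof. by move=> [g [_ [F [G [/is_fourier_hartley hF _ _]]]]]; eexists; exact: hF. Qed.

(** By Plancherel, the norm of a multiplier is a weighted norm of the
    transform. *)
Lemma sq_multiplier r f A : measurable_fun setT r -> is_hartley f A ->
  multiplier_dom (fun xi => (r xi)%:C) f ->
  [/\ L2 (fun xi => r xi * A xi),
      L2 (multiplier (fun xi => (r xi)%:C) f) &
      sq mu (fun xi => r xi * A xi) = plancherel_cst * sq mu (multiplier (fun xi => (r xi)%:C) f)].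
Proof.
move=> mr hA /multiplierP hm; have hg := is_multiplier_hartley mr hA hm.
by have [lg lrA _] := hg; split => //; exact: plancherel.
Qed.

Lemma Lp_norm2_sqr f : L2 f -> (Lp_norm 2%:E f ^+ 2 = (sq mu f)%:E)%E.
Proof. exact: Lnorm2_sq. Qed.

End Multipliers.

(** * A Nash-type inequality *)

Section Nash.
Context {R : realType}.
Local Notation plane := (measurableTypeR R * measurableTypeR R)%type.
Local Notation mu := (@leb2 R).
Local Notation L2 f := (f \in Lfun mu 2%:E).
Implicit Types (f g A : plane -> R) (x z xi : plane).
Variables (alpha beta p s : R).
Hypotheses (alpha01 : 0 < alpha <= 1) (beta01 : 0 < beta <= 1).
Hypotheses (s01 : 0 <= s <= 1) (ps : p * (1 + s) = 2).

Let alpha0 : 0 < alpha. Proof. by have /andP[] := alpha01. Qed.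

(** For [s = 2 / p - 1], the exponent [(alpha + beta)(2 - p) / (2 alpha beta p)]
    at which the square of the [L^2] norm decays. *)
Definition decay_rate : R := s * ((2 * alpha)^-1 + (2 * beta)^-1).
(** The constant of the low-frequency estimate, for an [L^p] integral bounded by
    [N]. *)
Definition nash_cst (N : R) : R := 9 `^ s * N `^ (1 + s) * plancherel_cst `^ (1 - s) / plancherel_cst.

(** The widths are chosen so that [(a |xi_1|) ^ (2 alpha) = lam |xi_1| ^ (2 alpha)],
    and likewise in the second coordinate; [1 - u v <= (1 - u) + (1 - v)] for
    [u] and [v] in [[0, 1]]. *)
Lemma onem_wt2_le (lam : R) xi : 0 < lam ->
  1 - wt2 (lam `^ (2 * alpha)^-1) (lam `^ (2 * beta)^-1) xi <=
  lam * ((`|xi.1| `^ alpha) ^+ 2 + (`|xi.2| `^ beta) ^+ 2).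
Proof.
move=> l0; have key (c t : R) : 0 < c <= 1 ->
    1 - wt (lam `^ (2 * c)^-1) t <= lam * (`|t| `^ c) ^+ 2.
  move=> c01; have /andP[c0 _] := c01.
  apply: le_trans (onem_wt_le _ (powR_gt0 _ l0) c01) _.
  rewrite powRM ?powR_ge0// -powRrM mulVf ?mulf_neq0 ?(lt0r_neq0 c0)//.
  by rewrite powRr1 ?(ltW l0)// -powR_mulrn ?powR_ge0// -powRrM [c * _]mulrC.
rewrite mulrDr; apply: le_trans (lerD (key _ _ alpha01) (key _ _ beta01)).
rewrite /wt2.
have /andP[u0 u1] := wt_itv xi.1 (powR_gt0 (2 * alpha)^-1 l0).
have /andP[v0 v1] := wt_itv xi.2 (powR_gt0 (2 * beta)^-1 l0).
by move: u0 u1 v0 v1; move: (wt _ _) (wt _ _) => u v; nra.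
Qed.

(** Splits the mass of the transform with the weights [wt2] and [1 - wt2]. The
    majorant [Q] of the symbol lets the same argument serve the isotropic and the
    anisotropic dissipation. *)
Lemma nash_split (lam N : R) f A (Q : plane -> R) : 0 < lam -> 0 < N -> is_hartley f A ->
  (\int[mu]_x (`|f x| `^ p)%:E <= N%:E)%E ->
  mu.-integrable setT (fun xi => (Q xi * A xi ^+ 2)%:E) ->
  (forall xi, (`|xi.1| `^ alpha) ^+ 2 + (`|xi.2| `^ beta) ^+ 2 <= Q xi) ->
  sq mu f <= lam / plancherel_cst * (\int[mu]_xi (Q xi * A xi ^+ 2)) + nash_cst N * lam `^ (- decay_rate).
Proof.
move=> l0 N0 hA fN iQ rQ.
set a := lam `^ (2 * alpha)^-1; set b := lam `^ (2 * beta)^-1.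
have a0 : 0 < a by exact: powR_gt0.
have b0 : 0 < b by exact: powR_gt0.
have [lf lA _] := hA.
have low := is_hartley_weighted_le a0 b0 s01 ps N0 hA fN.
have iA := L2_mul_integrable lA lA.
have mA := L2_measurable lA.
have iW : mu.-integrable setT (fun xi => (wt2 a b xi * A xi ^+ 2)%:E).
  apply: (le_integrable measurableT _ _ iA) => /=.
    by apply/measurable_EFinP; apply: measurable_funM; [exact: measurable_wt2|exact: measurable_funX].
  move=> xi _; rewrite lee_fin -expr2 normrM -[leRHS]mul1r ler_wpM2r//.
  by have /andP[w0 w1] := wt2_itv xi a0 b0; rewrite ger0_norm.
have split_A : sq mu A <= \int[mu]_xi (wt2 a b xi * A xi ^+ 2) + lam * \int[mu]_xi (Q xi * A xi ^+ 2).
  rewrite -RintegralZl// -RintegralD//; last first.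
    by have := integrableZl measurableT lam iQ; apply: eq_integrable => // xi _; rewrite EFinM.
  apply: le_Rintegral => //.
    have := integrableD measurableT iW (integrableZl measurableT lam iQ).
    by apply: eq_integrable => // xi _; rewrite EFinD EFinM.
  move=> xi _; have := onem_wt2_le xi l0; rewrite -/a -/b => h.
  rewrite -expr2 mulrA -mulrDl -[leLHS]mul1r ler_wpM2r ?sqr_ge0//.
  rewrite -lerBlDl; apply: le_trans h _; rewrite ler_wpM2l ?(ltW l0)//; exact: rQ.
have k0 := @plancherel_cst_gt0 R; have kn := lt0r_neq0 k0.
rewrite -(ler_pM2l k0) -(plancherel hA).
apply: le_trans split_A _; rewrite mulrDr addrC; apply: lerD.
  by rewrite le_eqVlt; apply/orP; left; apply/eqP; field.
apply: le_trans low _; rewrite le_eqVlt; apply/orP; left; apply/eqP.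
have -> : (9 / (a * b)) `^ s = 9 `^ s * lam `^ (- decay_rate).
  rewrite powRM ?invr_ge0 ?mulr_ge0 ?(ltW a0) ?(ltW b0)//; congr (_ * _).
  rewrite /a /b -powRD ?(lt0r_neq0 l0) ?implybT// -powRN -powRrM.
  by congr (_ `^ _); rewrite /decay_rate; ring.
by rewrite /nash_cst; field.
Qed.

Lemma measurable_powR_norm1 (c : R) : measurable_fun setT (fun xi : plane => `|xi.1| `^ c).
Proof.
by apply: (measurableT_comp (measurable_powR c)); apply: measurableT_comp.
Qed.

Lemma measurable_powR_norm2 (c : R) : measurable_fun setT (fun xi : plane => `|xi.2| `^ c).
Proof.
by apply: (measurableT_comp (measurable_powR c)); apply: measurableT_comp.
Qed.

Lemma measurable_powR_enorm (c : R) : measurable_fun setT (fun xi : plane => enorm xi `^ c).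
Proof.
apply: (measurableT_comp (measurable_powR c)); exact: measurable_enorm.
Qed.

Lemma enorm_le x : enorm x <= `|x.1| + `|x.2|.
Proof.
rewrite -[leRHS]ger0_norm ?addr_ge0// -sqrtr_sqr ler_sqrt ?sqr_ge0//.
rewrite sqrrD !real_normK ?num_real// -addrA lerD2l lerDr mulrn_wge0// mulr_ge0//.
Qed.

(** Bounds the isotropic symbol by the directional ones, so that the domains of
    the two directional operators together lie in the domain of the isotropic
    one. *)
Lemma powR_enorm_le (c : R) x : 0 <= c ->
  enorm x `^ c <= 2 `^ c * (`|x.1| `^ c + `|x.2| `^ c).
Proof.
move=> c0; have h : enorm x <= 2 * Num.max `|x.1| `|x.2|.
  apply: le_trans (enorm_le x) _.
  have : `|x.1| <= Num.max `|x.1| `|x.2| by rewrite le_max lexx.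
  have : `|x.2| <= Num.max `|x.1| `|x.2| by rewrite le_max lexx orbT.
  lra.
have m0 : 0 <= Num.max `|x.1| `|x.2| by rewrite le_max normr_ge0.
apply: (@le_trans _ _ ((2 * Num.max `|x.1| `|x.2|) `^ c)).
  by apply: ge0_ler_powR => //; rewrite nnegrE ?sqrtr_ge0// mulr_ge0.
rewrite powRM// ler_wpM2l ?powR_ge0//.
by case: (leP `|x.1| `|x.2|) => _; rewrite ?lerDl ?lerDr powR_ge0.
Qed.

(** When [alpha = beta] the dissipation involves [Lambda alpha f], which has a
    meaning only once [f] is known to be in the domain: [powR_enorm_le] and
    [hartley_multiplier_dom] provide this. As the directional symbols are each
    bounded by the isotropic one, the squares of both add up to at most twice
    its square, whence the factor [2]. *)
Lemma nash_dissipation (lam N : R) f : 0 < lam -> 0 < N ->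
  (\int[mu]_x (`|f x| `^ p)%:E <= N%:E)%E ->
  multiplier_dom (Lambda1_symbol alpha) f -> multiplier_dom (Lambda2_symbol beta) f ->
  (((sq mu f - nash_cst N * lam `^ (- decay_rate)) / (2 * lam))%:E <=
    dissipation_energy alpha beta f)%E.
Proof.
move=> l0 N0 fN d1 d2; have [A hA] := multiplier_dom_hartley d1.
have [lf lA _] := hA.
have [l1 lm1 e1] : [/\ L2 (fun xi => `|xi.1| `^ alpha * A xi), L2 (Lambda1 alpha f) &
    sq mu (fun xi => `|xi.1| `^ alpha * A xi) = plancherel_cst * sq mu (Lambda1 alpha f)].
  exact: (sq_multiplier (measurable_powR_norm1 alpha) hA d1).
have [l2 lm2 e2] : [/\ L2 (fun xi => `|xi.2| `^ beta * A xi), L2 (Lambda2 beta f) &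
    sq mu (fun xi => `|xi.2| `^ beta * A xi) = plancherel_cst * sq mu (Lambda2 beta f)].
  exact: (sq_multiplier (measurable_powR_norm2 beta) hA d2).
have k0 := @plancherel_cst_gt0 R; have kn := lt0r_neq0 k0; have ln := lt0r_neq0 l0.
rewrite /dissipation_energy.
move: (Lambda1 alpha f) lm1 e1 (Lambda2 beta f) lm2 e2 => g1 lm1 e1 g2 lm2 e2.
case: eqVneq => [ab|_].
- pose r (xi : plane) := enorm xi `^ alpha.
  have mr : measurable_fun setT r by exact: measurable_powR_enorm.
  have lr : L2 (fun xi => r xi * A xi).
    have l2' : L2 (fun xi => `|xi.2| `^ alpha * A xi) by rewrite ab.
    have lD := L2Z (2 `^ alpha) (L2D l1 l2').
    apply: (L2_le _ lD).
      by apply: measurable_funM => //; exact: L2_measurable lA.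
    move=> xi; rewrite -mulrDl mulrA !normrM ler_wpM2r//.
    rewrite -normrM [leLHS]ger0_norm ?powR_ge0//; apply: le_trans (ler_norm _).
    by apply: powR_enorm_le; exact: ltW.
  have [lm em] : L2 (Lambda alpha f) /\
      sq mu (fun xi => r xi * A xi) = plancherel_cst * sq mu (Lambda alpha f).
    have dr : multiplier_dom (fun xi => (r xi)%:C) f.
      apply: (hartley_multiplier_dom _ hA lr) => xi.
      by rewrite /r /enorm /neg /= !sqrrN.
    by have [_ lm em] := sq_multiplier mr hA dr; split; [exact: lm|exact: em].
  move: (Lambda alpha f) lm em => g lm em.
  have iQ : mu.-integrable setT (fun xi => (2 * r xi ^+ 2 * A xi ^+ 2)%:E).
    have := integrableZl measurableT 2 (L2_mul_integrable lr lr).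
    by apply: eq_integrable => // xi _; rewrite -EFinM; congr EFin; ring.
  have rQ xi : (`|xi.1| `^ alpha) ^+ 2 + (`|xi.2| `^ beta) ^+ 2 <= 2 * r xi ^+ 2.
    rewrite -ab mulr_natl mulr2n; apply: lerD; rewrite lerXn2r ?nnegrE ?powR_ge0//;
      apply: ge0_ler_powR; rewrite ?nnegrE ?sqrtr_ge0 ?(ltW alpha0)//.
      exact: normr1_le_enorm.
    exact: normr2_le_enorm.
  have := nash_split l0 N0 hA fN iQ rQ.
  have -> : \int[mu]_xi (2 * r xi ^+ 2 * A xi ^+ 2) = 2 * (plancherel_cst * sq mu g).
    rewrite -em /sq /ip -RintegralZl//; last exact: L2_mul_integrable.
    by apply: eq_Rintegral => xi _; ring.
  move=> h; rewrite (Lp_norm2_sqr lm) lee_fin ler_pdivrMr ?mulr_gt0// lerBlDr.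
  apply: le_trans h _; rewrite lerD2r le_eqVlt; apply/orP; left; apply/eqP.
  by field.
- pose Q (xi : plane) := (`|xi.1| `^ alpha) ^+ 2 + (`|xi.2| `^ beta) ^+ 2.
  have i1 := L2_mul_integrable l1 l1; have i2 := L2_mul_integrable l2 l2.
  have iQ : mu.-integrable setT (fun xi => (Q xi * A xi ^+ 2)%:E).
    have := integrableD measurableT i1 i2.
    by apply: eq_integrable => // xi _; rewrite -EFinD; congr EFin; rewrite /Q; ring.
  have := nash_split l0 N0 hA fN iQ (fun xi => lexx _).
  have -> : \int[mu]_xi (Q xi * A xi ^+ 2) = plancherel_cst * sq mu g1 + plancherel_cst * sq mu g2.
    rewrite -e1 -e2 /sq /ip -(RintegralD measurableT i1 i2).
    by apply: eq_Rintegral => xi _; rewrite /Q; ring.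
  move=> h; rewrite (Lp_norm2_sqr lm1) (Lp_norm2_sqr lm2).
  rewrite -EFinD lee_fin ler_pdivrMr ?mulr_gt0// lerBlDr.
  apply: le_trans h _; rewrite lerD2r.
  have q1 := sq_ge0 mu g1; have q2 := sq_ge0 mu g2.
  have -> : lam / plancherel_cst * (plancherel_cst * sq mu g1 + plancherel_cst * sq mu g2) = lam * (sq mu g1 + sq mu g2) by field.
  rewrite [leRHS]mulrC ler_wpM2r ?addr_ge0//.
  by rewrite ler_peMl ?(ltW l0)// ler1n.
Qed.

End Nash.

(** * Algebraic decay from an integrated differential inequality *)

Section Decay.
Context {R : realType}.
Implicit Types (y : R -> R) (c sg t : R).

(** An integrated form of [y' <= - c y ^ (1 + 1 / sg)] that holds from a dense
    set of starting times. Between [s] in [(t / 4, t / 2)] and [t] it gives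
    [t * y t ^ (1 + 1 / sg) <= (2 / c) * y s]; multiplied by [t ^ sg], it becomes
    an inequality for the supremum [M] of [t ^ sg * y t] over [(0, T]] that
    bounds [M] independently of [T]. For [t <= 1] the bound [Y0] is used. *)
Lemma algebraic_decay y (Y0 c sg : R) (good : set R) : 0 < sg -> 0 < c -> 0 <= Y0 ->
  (forall t, 0 <= t -> 0 <= y t <= Y0) ->
  (forall a b, 0 <= a -> a < b -> exists2 s, good s & a < s < b) ->
  (forall s t, good s -> 0 < s -> s <= t -> (t - s) * (c * (y t * y t `^ sg^-1)) <= y s) ->
  forall t, 0 <= t -> y t <= 2 `^ sg * (Y0 + (2 * 4 `^ sg / c) `^ sg) * (1 + t) `^ (- sg).
Proof.
move=> sg0 c0 Y00 yY gd diff.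
set L := 2 * 4 `^ sg / c.
have L0 : 0 < L by rewrite divr_gt0// mulr_gt0// powR_gt0.
have sgn := lt0r_neq0 sg0; have cn := lt0r_neq0 c0.
have bound T : 0 < T -> T `^ sg * y T <= L `^ sg.
  move=> T0.
  pose S := [set t `^ sg * y t | t in [set t | 0 < t <= T]].
  have Sub : has_ubound S.
    exists (T `^ sg * Y0) => _ [t /andP[t0 tT] <-].
    have /andP[y0 y1] := yY t (ltW t0).
    by apply: ler_pM => //; [exact: powR_ge0|apply: ge0_ler_powR; rewrite ?nnegrE// ltW].
  have ST : S (T `^ sg * y T) by exists T => //=; rewrite T0 lexx.
  set M := sup S.
  have SM z : S z -> z <= M by move=> Sz; exact: ub_le_sup.
  apply: (le_trans (SM _ ST)); have [M0|M0] := leP M 0.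
    exact: le_trans M0 (powR_ge0 _ _).
  have key z : S z -> z * z `^ sg^-1 <= L * M.
    move=> [t /andP[t0 tT] <-]; have /andP[y0 _] := yY t (ltW t0).
    have t4 : 0 <= t / 4 by rewrite divr_ge0// ltW.
    have t42 : t / 4 < t / 2 by lra.
    have [s gs /andP[ts st]] := gd _ _ t4 t42.
    have s0 : 0 < s by apply: le_lt_trans ts.
    have st' : s <= t by lra.
    have := diff s t gs s0 st'; have /andP[ys0 _] := yY s (ltW s0).
    have hs : s `^ sg * y s <= M by apply: SM; exists s => //=; rewrite s0 (le_trans st').
    set w := y t * y t `^ sg^-1; have w0 : 0 <= w by rewrite mulr_ge0// powR_ge0.
    move=> d.
    have d2 : t * (c * w) <= 2 * y s.
      have cw0 : 0 <= c * w by rewrite mulr_ge0// ltW.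
      have : (t / 2) * (c * w) <= (t - s) * (c * w) by apply: ler_wpM2r => //; lra.
      by move: d cw0; move: (c * w) => q; lra.
    have d3 : (t / 4) `^ sg * y s <= M.
      apply: le_trans hs; apply: ler_wpM2r => //.
      by apply: ge0_ler_powR; rewrite ?nnegrE// ltW.
    have -> : t `^ sg * y t * (t `^ sg * y t) `^ sg^-1 = t `^ sg * t * w.
      rewrite powRM ?powR_ge0// -powRrM mulfV// powRr1 ?(ltW t0)// /w; ring.
    have p4 : 0 < 4 `^ sg :> R by exact: powR_gt0.
    have d4 : t `^ sg * y s <= 4 `^ sg * M.
      have -> : t `^ sg = 4 `^ sg * (t / 4) `^ sg.
        by rewrite -powRM//; congr (_ `^ _); field.
      by rewrite -mulrA ler_pM2l.
    have -> : L * M = 2 * (4 `^ sg * M) / c by rewrite /L; field.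
    rewrite ler_pdivlMr//.
    have -> : t `^ sg * t * w * c = t `^ sg * (t * (c * w)) by ring.
    apply: le_trans (ler_wpM2l (powR_ge0 _ _) d2) _.
    by rewrite mulrCA ler_pM2l.
  (* [sg / (1 + sg)] inverts the exponent [1 + 1 / sg], which allows to pass
     to the supremum in [key] *)
  have key2 : M * M `^ sg^-1 <= L * M.
    have E (z : R) : 0 <= z -> (z * z `^ sg^-1) `^ (sg / (1 + sg)) = z.
      move=> z0; have s1 : 1 + sg != 0 by rewrite lt0r_neq0// addr_gt0.
      have -> : z * z `^ sg^-1 = z `^ (1 + sg^-1).
        have [->|zn] := eqVneq z 0.
          by rewrite mul0r powR0// lt0r_neq0// addr_gt0// invr_gt0.
        by rewrite powRD ?zn ?implybT// powRr1.
      rewrite -powRrM (_ : (1 + sg^-1) * (sg / (1 + sg)) = 1) ?powRr1//.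
      by field; rewrite s1.
    have e0 : 0 <= sg / (1 + sg) by rewrite divr_ge0 ?addr_ge0// ltW.
    have LM0 : 0 <= L * M by rewrite mulr_ge0 ?ltW.
    have h : M <= (L * M) `^ (sg / (1 + sg)).
      apply: ge_sup; first by exists (T `^ sg * y T).
      move=> z Sz; have z0 : 0 <= z.
        have [t /andP[t0 _] <-] := Sz; have /andP[y0 _] := yY t (ltW t0).
        by rewrite mulr_ge0// powR_ge0.
      rewrite -[leLHS]E//; apply: ge0_ler_powR => //; rewrite ?nnegrE ?mulr_ge0 ?powR_ge0//.
      exact: key.
    have h2 : M `^ (1 + sg^-1) <= L * M.
      apply: le_trans (ge0_ler_powR _ _ _ h) _; rewrite ?nnegrE ?powR_ge0 ?(ltW M0)//.
        by rewrite addr_ge0// invr_ge0 ltW.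
      rewrite -powRrM (_ : sg / (1 + sg) * (1 + sg^-1) = 1) ?powRr1//.
      by field; rewrite sgn lt0r_neq0// addr_gt0.
    by move: h2; rewrite powRD ?(lt0r_neq0 M0) ?implybT// powRr1 ?(ltW M0).
  move: key2; rewrite mulrC ler_pM2r// => h.
  have := ge0_ler_powR (ltW sg0) _ _ h; rewrite !nnegrE powR_ge0 (ltW L0) => /(_ isT isT).
  by rewrite -powRrM mulVf// powRr1 ?(ltW M0).
move=> t t0; have /andP[y0 y1] := yY t t0.
have t1 : 0 < 1 + t by lra.
have p2 : 0 < 2 `^ sg :> R by exact: powR_gt0.
have pL : 0 <= L `^ sg by exact: powR_ge0.
rewrite powRN ler_pdivlMr ?powR_gt0//.
have [t_le1|t_gt1] := leP t 1.
  apply: (@le_trans _ _ (Y0 * 2 `^ sg)).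
    apply: ler_pM => //; first exact: powR_ge0.
    by apply: ge0_ler_powR; rewrite ?nnegrE ?(ltW sg0) ?(ltW t1)//; lra.
  by rewrite mulrC ler_pM2l// lerDl.
apply: (@le_trans _ _ (y t * (2 `^ sg * t `^ sg))).
  rewrite ler_wpM2l// -powRM//; apply: ge0_ler_powR; rewrite ?nnegrE ?(ltW sg0) ?(ltW t1)//; lra.
have -> : y t * (2 `^ sg * t `^ sg) = 2 `^ sg * (t `^ sg * y t) by ring.
rewrite ler_pM2l//; apply: le_trans (bound t _) _; first lra.
by rewrite lerDr.
Qed.

End Decay.

(** * Almost everywhere bounds *)

Section LowerIntegral.
Context d (T : measurableType d) (R : realType).
Variable mu : {measure set T -> \bar R}.
Local Open Scope ereal_scope.

(** The integral of a nonnegative function is a supremum over the simple functions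
    below it, hence is monotone on arbitrary functions. This serves for the
    dissipation energy, whose dependence on time is an arbitrary function. *)
Lemma ge0_le_lower_integral (D : set T) (f g : T -> \bar R) :
  (forall x, D x -> 0 <= f x) -> (forall x, D x -> f x <= g x) ->
  \int[mu]_(x in D) f x <= \int[mu]_(x in D) g x.
Proof.
move=> f0 fg; rewrite !ge0_integralE//; last by move=> x Dx; exact: le_trans (f0 x Dx) (fg x Dx).
apply: ge_ereal_sup => _ [h /= hf <-]; apply: ereal_sup_ubound; exists h => //= x.
apply: le_trans (hf x) _; rewrite !patchE; case: ifPn => // xD; apply: fg; exact: set_mem.
Qed.

Lemma ae_cst_le_integral (D : set T) (g : T -> \bar R) (c : R) : measurable D -> (0 <= c)%R ->
  (forall x, D x -> 0 <= g x) -> {ae mu, forall x, D x -> c%:E <= g x} ->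
  c%:E * mu D <= \int[mu]_(x in D) g x.
Proof.
move=> mD c0 g0 [N [mN N0 Nsub]].
have mDN : measurable (D `\` N) by exact: measurableD.
apply: (@le_trans _ _ (\int[mu]_(x in D) (c * \1_(D `\` N) x)%:E)).
  under eq_integral do rewrite EFinM.
  rewrite ge0_integralZl_EFin//; last first.
    by apply/measurable_EFinP; exact: measurable_indic.
  rewrite integral_indic// setIidl; last by move=> x [].
  apply: lee_wpmul2l; first by rewrite lee_fin.
  rewrite -{1}(setDUK (_ : D `&` N `<=` D)); last by move=> x [].
  rewrite setDIr setDv set0U.
  apply: le_trans (measureU2 _ _ _) _ => //; first exact: measurableI.
  rewrite [X in X + _](_ : _ = 0) ?add0e//; apply/eqP; rewrite eq_le measure_ge0 andbT -N0.
  by apply: le_measure; rewrite ?inE//; exact: measurableI.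
apply: ge0_le_lower_integral => x Dx.
  by rewrite lee_fin mulr_ge0.
rewrite indicE; case: (boolP (x \in _)) => [|_]; last by rewrite mulr0; exact: g0.
rewrite inE mulr1 => -[_ Nx]; apply: contrapT => cg; apply: Nx; apply: Nsub => /=.
by move=> /(_ Dx).
Qed.

End LowerIntegral.

(** A nonempty open interval is not negligible. *)
Lemma ae_itv_exists (R : realType) (P : R -> Prop) (a b : R) : a < b ->
  {ae @lebesgue_measure R, forall x, P x} -> exists2 s, P s & a < s < b.
Proof.
move=> ab [N [mN N0 Nsub]]; apply: contrapT => no.
have abN : `]a, b[%classic `<=` N.
  by move=> x /=; rewrite in_itv/= => xab; apply: Nsub => /= Px; apply: no; exists x.
have : (@lebesgue_measure R `]a, b[%classic <= @lebesgue_measure R N)%E.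
  by apply: le_measure; rewrite ?inE//; exact: measurable_itv.
rewrite N0 [X in (X <= _)%E]lebesgue_measure_itv/= lte_fin ab -EFinB lee_fin subr_le0.
by rewrite leNgt ab.
Qed.

(** * Energy of weak solutions *)

Section Solutions.
Context {R : realType}.
Local Notation plane := (measurableTypeR R * measurableTypeR R)%type.
Local Notation leb := (@lebesgue_measure R).
Local Notation mu := (@leb2 R).
Local Notation L2 f := (f \in Lfun mu 2%:E).
Variables (alpha beta p s : R).
Hypotheses (alpha01 : 0 < alpha <= 1) (beta01 : 0 < beta <= 1).
Hypotheses (s01 : 0 <= s <= 1) (s_gt0 : 0 < s) (p1 : 1 <= p) (ps : p * (1 + s) = 2).
Variables (theta0 : plane -> R) (theta : R -> plane -> R).
Hypotheses (L2theta0 : Lp 2%:E theta0) (Lptheta0 : Lp p%:E theta0).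
Hypothesis sol : weak_solution alpha beta theta0 theta.

Local Notation sg := (decay_rate alpha beta s).

Lemma decay_rate_gt0 : 0 < sg.
Proof.
have /andP[a0 _] := alpha01; have /andP[b0 _] := beta01.
by rewrite /decay_rate mulr_gt0// addr_gt0// invr_gt0 mulr_gt0.
Qed.

Lemma L2theta t : 0 <= t -> L2 (theta t).
Proof. by move=> t0; exact: (weak_L2 sol t0). Qed.

Lemma integral_theta0_lty : (\int[mu]_x (`|theta0 x| `^ p)%:E < +oo)%E.
Proof.
have := Lfun_integrable p1 (Lptheta0 : theta0 \in Lfun mu p%:E).
move=> /integrableP[_]; apply: le_lt_trans.
rewrite le_eqVlt; apply/orP; left; apply/eqP; apply: eq_integral => x _.
by rewrite gee0_abs// lee_fin powR_ge0.
Qed.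

(** The summand [1] makes this positive also when [theta0] vanishes. *)
Definition Np : R := fine (\int[mu]_x (`|theta0 x| `^ p)%:E)%E + 1.

Lemma Np_gt0 : 0 < Np.
Proof. by rewrite /Np ltr_wpDl// fine_ge0// integral_ge0// => x _; rewrite lee_fin powR_ge0. Qed.

Lemma integral_theta_le t : 0 <= t -> (\int[mu]_x (`|theta t x| `^ p)%:E <= Np%:E)%E.
Proof.
move=> t0; have p0 : p != 0 by rewrite lt0r_neq0// (lt_le_trans ltr01).
have pE (f : plane -> R) : (\int[mu]_x (`|f x| `^ p)%:E = Lp_norm p%:E f `^ p)%E.
  by rewrite -[Lp_norm _ _]/('N[mu]_p%:E[EFin \o f])%E powR_Lnorm.
have p1E : (1 <= p%:E)%E by rewrite lee_fin.
apply: (@le_trans _ _ (\int[mu]_x (`|theta0 x| `^ p)%:E)%E).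
  rewrite !pE; apply: gt0_ler_poweR.
  - by rewrite (le_trans ler01).
  - by rewrite in_itv/= leey andbT; exact: (Lnorm_ge0 mu).
  - by rewrite in_itv/= leey andbT; exact: (Lnorm_ge0 mu).
  - exact: (weak_Lq sol p1E Lptheta0 t0).
rewrite /Np EFinD fineK; first by rewrite leeDl// lee_fin.
by rewrite ge0_fin_numE ?integral_theta0_lty// integral_ge0// => x _; rewrite lee_fin powR_ge0.
Qed.

Lemma sq_theta_le t : 0 <= t -> sq mu (theta t) <= sq mu theta0.
Proof.
move=> t0; have l2 : (1 <= (2%:E : \bar R))%E by rewrite lee_fin ler1n.
have := weak_Lq sol l2 L2theta0 t0.
rewrite !Lnorm2E ?lee_fin//; last exact: L2theta.
by rewrite ler_psqrt// nnegrE sq_ge0.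
Qed.

Lemma dissipation_energy_ge0 (f : plane -> R) : (0 <= dissipation_energy alpha beta f)%E.
Proof.
have sq0 (g : plane -> R) : (0 <= Lp_norm 2%:E g ^+ 2)%E.
  by rewrite expe_ge0//; exact: (Lnorm_ge0 mu).
by rewrite /dissipation_energy; case: ifP => _; rewrite ?adde_ge0.
Qed.

Lemma energy_sq t0 t : 0 <= t0 -> energy_inequality alpha beta theta t0 -> t0 <= t ->
  ((sq mu (theta t))%:E + 2%:E * \int[leb]_(tau in `[t0, t]) dissipation_energy alpha beta (theta tau)
    <= (sq mu (theta t0))%:E)%E.
Proof.
move=> t00 en t0t; have := en t t0t.
by rewrite !(Lp_norm2_sqr (L2theta _))// (le_trans t00).
Qed.

Lemma energy_nonincreasing t0 t : 0 <= t0 -> energy_inequality alpha beta theta t0 -> t0 <= t ->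
  sq mu (theta t) <= sq mu (theta t0).
Proof.
move=> t00 en t0t; rewrite -lee_fin; apply: le_trans (energy_sq t00 en t0t).
rewrite leeDl// mule_ge0// integral_ge0// => tau _; exact: dissipation_energy_ge0.
Qed.

Let C1 : R := nash_cst s Np.

Let C1_gt0 : 0 < C1.
Proof.
by rewrite /C1 /nash_cst divr_gt0 ?plancherel_cst_gt0// !mulr_gt0// powR_gt0 ?plancherel_cst_gt0// Np_gt0.
Qed.

(** At the cutoff [lam = (2 * C1 / m) ^ (1 / sg)], the lower bound [m / (4 lam)]
    for the dissipation is half of [decay_cst * m ^ (1 + 1 / sg)]. *)
Definition decay_cst : R := 2^-1 * (2 * C1) `^ (- sg^-1).

Lemma decay_cst_gt0 : 0 < decay_cst.
Proof. by rewrite mulr_gt0// powR_gt0// mulr_gt0. Qed.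

(** The cutoff is such that the low-frequency term [C1 * lam ^ (- sg)] is half of
    [m], so that the other half is paid for by the dissipation. Stating the bound
    with any [m] below the square norm makes it constant in time in the
    application. *)
Lemma dissipation_energy_ge m (f : plane -> R) : 0 <= m -> m <= sq mu f ->
  (\int[mu]_x (`|f x| `^ p)%:E <= Np%:E)%E ->
  multiplier_dom (Lambda1_symbol alpha) f -> multiplier_dom (Lambda2_symbol beta) f ->
  ((2^-1 * (decay_cst * (m * m `^ sg^-1)))%:E <= dissipation_energy alpha beta f)%E.
Proof.
move=> m0 mf fN d1 d2; have [->|mn] := eqVneq m 0.
  by rewrite mul0r !mulr0; exact: dissipation_energy_ge0.
have mp : 0 < m by rewrite lt_neqAle eq_sym mn.
have sg0 := decay_rate_gt0; have sgn := lt0r_neq0 sg0.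
pose lam := (2 * C1 / m) `^ sg^-1.
have q0 : 0 < 2 * C1 / m by rewrite divr_gt0// mulr_gt0.
have l0 : 0 < lam by exact: powR_gt0.
apply: le_trans (nash_dissipation alpha01 beta01 s01 ps l0 Np_gt0 fN d1 d2).
rewrite lee_fin -/C1 powRN /lam -powRrM mulVf// powRr1 ?(ltW q0)//.
have C1n := lt0r_neq0 C1_gt0.
have -> : C1 * (2 * C1 / m)^-1 = m / 2 by field; rewrite mn.
have lE : (2 * C1 / m) `^ sg^-1 * (decay_cst * m `^ sg^-1) = 2^-1.
  have mV : m^-1 `^ sg^-1 * m `^ sg^-1 = 1 by rewrite -powRM ?invr_ge0// mulVf// powR1.
  rewrite /decay_cst powRM ?invr_ge0//; last by rewrite mulr_ge0// ltW.
  rewrite powRN.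
  have c2 : (2 * C1) `^ sg^-1 != 0 by rewrite lt0r_neq0// powR_gt0// mulr_gt0.
  rewrite (_ : _ * _ = (m^-1 `^ sg^-1 * m `^ sg^-1) * 2^-1); first by rewrite mV mul1r.
  by field.
rewrite -/lam in lE *.
rewrite ler_pdivlMr ?mulr_gt0//.
have -> : 2^-1 * (decay_cst * (m * m `^ sg^-1)) * (2 * lam) = m * (lam * (decay_cst * m `^ sg^-1)) by field.
by rewrite lE; lra.
Qed.

(** At almost every [tau] in [[t0, t]] the energy inequality can be started, so
    the norm at [tau] is at least the norm at [t] and the dissipation is at least
    its value for the latter. *)
Lemma energy_step t0 t : 0 < t0 -> energy_inequality alpha beta theta t0 -> t0 <= t ->
  (t - t0) * (decay_cst * (sq mu (theta t) * sq mu (theta t) `^ sg^-1)) <= sq mu (theta t0).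
Proof.
move=> t00 en t0t; set m := sq mu (theta t).
have m0 : 0 <= m by exact: sq_ge0.
set e := 2^-1 * (decay_cst * (m * m `^ sg^-1)).
have e0 : 0 <= e by rewrite !mulr_ge0// ?(ltW decay_cst_gt0)// powR_ge0.
have mI : measurable (`[t0, t]%classic : set (measurableTypeR R)) by exact: measurable_itv.
have low : (e%:E * leb `[t0, t]%classic <=
    \int[leb]_(tau in `[t0, t]) dissipation_energy alpha beta (theta tau))%E.
  apply: ae_cst_le_integral => //; first by move=> tau _; exact: dissipation_energy_ge0.
  apply: (@filterS3 _ _ (ae_filter_ringOfSetsType leb) _ _ _ _ _
    (weak_Lambda1_dom sol) (weak_Lambda2_dom sol) (weak_energy sol)).
  move=> tau d1 d2 en_tau /=; rewrite in_itv/= => /andP[t0tau taut].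
  have tau0 : 0 < tau by exact: lt_le_trans t0tau.
  apply: dissipation_energy_ge => //.
  - by apply: energy_nonincreasing (en_tau tau0) taut; exact: ltW.
  - by apply: integral_theta_le; exact: ltW.
  - exact: d1.
  - exact: d2.
have lE : (leb `[t0, t]%classic = (t - t0)%:E)%E.
  rewrite [LHS]lebesgue_measure_itv/= lte_fin.
  case: ifPn => //; rewrite -leNgt => tt0; congr EFin.
  by apply/esym/eqP; rewrite subr_eq0 eq_le tt0.
rewrite lE -EFinM in low.
have := energy_sq (ltW t00) en t0t; rewrite -/m => h.
have h2 : ((2 * (e * (t - t0)))%:E <= (sq mu (theta t0))%:E)%E.
  apply: le_trans h; rewrite EFinM; apply: (@le_trans _ _ (2%:E * \int[leb]_(tau in `[t0, t]) dissipation_energy alpha beta (theta tau))%E).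
    by apply: lee_wpmul2l.
  by rewrite leeDr// lee_fin.
rewrite lee_fin in h2; apply: le_trans h2; rewrite le_eqVlt; apply/orP; left; apply/eqP.
by rewrite /e; field.
Qed.

Lemma sq_theta_decay t : 0 <= t ->
  sq mu (theta t) <=
  2 `^ sg * (sq mu theta0 + (2 * 4 `^ sg / decay_cst) `^ sg) * (1 + t) `^ (- sg).
Proof.
apply: (algebraic_decay (y := fun t => sq mu (theta t))
  (good := [set t0 | 0 < t0 -> energy_inequality alpha beta theta t0])).
- exact: decay_rate_gt0.
- exact: decay_cst_gt0.
- exact: sq_ge0.
- by move=> r r0; rewrite sq_ge0 sq_theta_le.
- by move=> a b _ ab; exact: (ae_itv_exists ab (weak_energy sol)).
- by move=> r q good r0 rq; apply: energy_step => //; exact: good.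
Qed.

End Solutions.

Theorem proposition3p1 (R : realType) (alpha beta p : R) (theta0 : R * R -> R)
    (halpha : 0 < alpha <= 1) (hbeta : 0 < beta <= 1) (hp : 1 <= p < 2)
    (htheta0 : Lp 2%:E theta0) (htheta0p : Lp p%:E theta0) :
  exists C0 : R, 0 < C0 /\
    forall theta : R -> R * R -> R,
      weak_solution alpha beta theta0 theta ->
      forall t : R, 0 <= t ->
        (Lp_norm 2%:E (theta t) <=
         (C0 * (1 + t) `^
            (- ((alpha + beta) * (2 - p) / (4 * alpha * beta * p))))%:E)%E.
Proof.
have /andP[p1 p2] := hp; have p0 : 0 < p by exact: lt_le_trans p1.
have /andP[a0 _] := halpha; have /andP[b0 _] := hbeta.
(* the interpolation exponent with [p (1 + s) = 2] *)
pose s := 2 / p - 1.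
have s0 : 0 < s by rewrite subr_gt0 ltr_pdivlMr// mul1r.
have s01 : 0 <= s <= 1.
  by rewrite (ltW s0) lerBlDr ler_pdivrMr//=; lra.
have ps : p * (1 + s) = 2 by rewrite /s; field; exact: lt0r_neq0.
set sg := decay_rate alpha beta s.
(* bounds the square of the norm, hence the square root below *)
set K := 2 `^ sg * (sq (@leb2 R) theta0 + (2 * 4 `^ sg / decay_cst alpha beta p s theta0) `^ sg).
have K0 : 0 < K.
  have d0 : 0 < decay_cst alpha beta p s theta0 by exact: decay_cst_gt0.
  have sq0 : 0 <= sq (@leb2 R) theta0 by exact: sq_ge0.
  by rewrite mulr_gt0 ?powR_gt0// ltr_wpDl// powR_gt0// divr_gt0// mulr_gt0 ?powR_gt0.
exists (Num.sqrt K); split; first by rewrite sqrtr_gt0.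
move=> theta sol t t0.
rewrite (Lnorm2E (L2theta sol t0)) lee_fin.
have t1 : 0 <= 1 + t by rewrite addr_ge0.
have -> : - ((alpha + beta) * (2 - p) / (4 * alpha * beta * p)) = - sg * 2^-1.
  by rewrite /sg /decay_rate /s; field; rewrite !lt0r_neq0.
rewrite powRrM powR12_sqrt ?powR_ge0// -sqrtrM ?(ltW K0)// ler_wsqrtr//.
exact: (sq_theta_decay halpha hbeta s01 s0 p1 ps htheta0 htheta0p sol t0).
Qed.
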